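(* For every $\mathcal{A}\in(0,\infty)$, the first (smallest) eigenvalue $\lambda_{1,L}(\mathcal{A})$, which is simple, of the Laplace operator $\boldsymbol{L}$ on the three-dimensional annulus $\Omega_{\mathcal{A}}$ with vanishing Dirichlet traces satisfies $$\lambda_{1,L}(\mathcal{A})=\pi^2 .$$
   Context: For $\mathcal{A}\in(0,\infty)$ let $\Omega_{\mathcal{A}}:=\{\underline{x}\in\mathbb{R}^3:\ \mathcal{A}/2<\|\underline{x}\|<1+\mathcal{A}/2\}$, where $\|\cdot\|$ is the Euclidean norm. The Laplace operator $\boldsymbol{L}$ on $\Omega=\Omega_{\mathcal{A}}$ is the Friedrichs extension in $L_2(\Omega)$ of $v\mapsto -\Delta v$ defined on $C_0^\infty(\Omega)$; its domain is $\mathring{W}_2^1(\Omega)\cap W_2^2(\Omega)$, where $W_2^k(\Omega)$ is the usual Sobolev space of order $k$ based on $L_2$ and $\mathring{W}_2^1(\Omega)$ is the closure of $C_0^\infty(\Omega)$ in $W_2^1(\Omega)$. This is the negative Dirichlet Laplacian, a positive self-adjoint operator with compact inverse and hence with pure point spectrum; $\lambda_{1,L}(\mathcal{A})$ denotes its smallest eigenvalue. *)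

(* Defs.v *)
From HB Require Import structures.
From mathcomp Require Import all_boot all_order all_algebra.
From mathcomp Require Import all_classical all_reals all_analysis.

Set Implicit Arguments.
Unset Strict Implicit.
Unset Printing Implicit Defensive.
Import Order.TTheory GRing.Theory Num.Theory.
Import numFieldNormedType.Exports.
Local Open Scope classical_set_scope.
Local Open Scope ring_scope.

(* Unbounded operators in a real Hilbert space. The space is presented by a set
   [H] of representatives in [V] with a semi-inner product [ip], two
   representatives being the same vector when their difference has
   [ip]-square 0. An operator is given by its graph: [T u f] means that [u] is
   in the domain of [T] and [T u] is [f]. *)
Section Operators.
Context {R : realType} {V : lmodType R}.
Variables (H : set V) (ip : V -> V -> R).
Implicit Types (S T : V -> V -> Prop) (u v f g : V) (l : R).

Definition same_vector u v : Prop := ip (u - v) (u - v) = 0.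

Definition adjoint S u f : Prop :=
  H u /\ H f /\ forall v g, S v g -> ip u g = ip f v.

(* The form domain of a nonnegative symmetric [S]: the completion, inside the
   Hilbert space, of the domain of [S] for <S v, v> + <v, v>, i.e. the limits
   in [H] of sequences of the domain of [S] that are Cauchy for <S v, v>. *)
Definition form_domain S u : Prop :=
  H u /\ exists v g : nat -> V,
    [/\ forall n, S (v n) (g n),
        (fun n => ip (v n - u) (v n - u)) @ \oo --> 0
      & forall e : R, 0 < e -> exists N : nat, forall m n : nat,
          (N <= m)%N -> (N <= n)%N -> ip (g m - g n) (v m - v n) < e].

(* The Friedrichs extension of a densely defined nonnegative symmetric [S] is
   the restriction of the adjoint of [S] to the form domain of [S]. *)
Definition friedrichs_extension S u f : Prop :=
  adjoint S u f /\ form_domain S u.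

Definition eigenvector T l u : Prop := T u (l *: u) /\ ~ same_vector u 0.

Definition eigenvalue_of T l : Prop := exists u, eigenvector T l u.

Definition smallest_eigenvalue T l : Prop :=
  eigenvalue_of T l /\ forall l', eigenvalue_of T l' -> l <= l'.

(* One-dimensional eigenspace: for a self-adjoint [T] the geometric and
   algebraic multiplicities agree. *)
Definition simple_eigenvalue T l : Prop :=
  exists2 u, eigenvector T l u
    & forall v, T v (l *: v) -> exists c : R, same_vector v (c *: u).

End Operators.

Section EuclideanSpace.
Context {R : realType}.
Local Notation R3 := (R * R * R)%type.
Implicit Types (x : R3) (f g : R3 -> R) (D : set R3).

(* The norm carried by the product type is the sup norm. *)
Definition euclidean_norm x : R :=
  Num.sqrt (x.1.1 ^+ 2 + x.1.2 ^+ 2 + x.2 ^+ 2).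

Local Notation mR := (measurableTypeR R).

Definition lebesgue3 : {measure set (mR * mR * mR)%type -> \bar R} :=
  ((@lebesgue_measure R \x @lebesgue_measure R) \x @lebesgue_measure R)%E.

Definition basis3 (i : 'I_3) : R3 :=
  ((i == 0%N :> nat)%:R, (i == 1%N :> nat)%:R, (i == 2%N :> nat)%:R).

Definition partial (i : 'I_3) f : R3 -> R := fun x => 'D_(basis3 i) f x.

Definition laplacian f : R3 -> R :=
  fun x => \sum_(i < 3) partial i (partial i f) x.

Definition smooth f : Prop :=
  forall (s : seq 'I_3) x, differentiable (foldr partial f s) x.

(* An element of C_0^oo(D) is identified with its extension by zero. *)
Definition test_function D f : Prop :=
  let supp := closure [set x | f x != 0] in
  [/\ smooth f, compact supp & supp `<=` D].

(* Representatives of L_2(D): total functions, whose values outside [D] are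
   irrelevant. *)
Definition L2 D : set (R3 -> R) :=
  [set f | (f \_ D) \in Lfun lebesgue3 2%:E].

Definition L2_ip D f g : R := \int[lebesgue3]_(x in D) (f x * g x).

Definition minimal_laplace D (u f : R3 -> R) : Prop :=
  test_function D u /\ f = - laplacian u.

Definition laplace_operator D : (R3 -> R) -> (R3 -> R) -> Prop :=
  friedrichs_extension (L2 D) (L2_ip D) (minimal_laplace D).

Definition annulus (A : R) : set R3 :=
  [set x | A / 2 < euclidean_norm x < 1 + A / 2].

End EuclideanSpace.

(* Main.v *)
Require Import Defs.
From HB Require Import structures.
From mathcomp Require Import all_boot all_order all_algebra.
From mathcomp Require Import all_classical all_reals all_analysis.
From mathcomp Require Import measurable_realfun ring lra.

(** Let [r] be the Euclidean norm and [u = sin (pi * (r - A / 2)) / r], which is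
    [ground_state]. In dimension three the Laplacian of a radial function is
    [(r u)'' / r], so that [- Delta u = pi ^ 2 * u]; moreover [u] is positive in
    the annulus and vanishes on both bounding spheres. The eigenvalue [pi ^ 2] is
    that of an interval of length one, the thickness of the annulus, whatever
    the value of [A].

    Lower bound. Since [u] is positive, Jacobi's factorisation holds for every
    test function [f]:
      [<- Delta f, f> - pi ^ 2 <f, f> = int u ^ 2 * |grad (f / u)| ^ 2 >= 0]
    ([jacobi_identity], [barta_lower_bound]). It is an integration by parts in
    which no boundary term appears, because [f] has compact support. An abstract
    argument about Friedrichs extensions, [friedrichs_eigenvalue_ge], carries the
    bound from the form on test functions to all the eigenvalues.

    The bound is attained. Integrating by parts twice shows that [u] is in the
    domain of the adjoint ([weak_eigenfunction]). It is in the form domain as the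
    limit of [chi n * u] for smooth cutoffs [chi n]: by Jacobi's factorisation
    the energy of a difference only involves [u * grad (chi n)], which is
    uniformly bounded because [u] vanishes to first order at the boundary, and
    which tends to zero pointwise; bounded convergence concludes
    ([ground_state_form_domain]).

    Simplicity. If [v] is an eigenvector for [pi ^ 2], its form approximants
    [v n] satisfy [int u ^ 2 * |grad (v n / u)| ^ 2 -> 0]
    ([friedrichs_ground_state]). On a cube inside the annulus [1 / u] is bounded,
    and an L1 Poincare-Wirtinger inequality ([poincare_wirtinger]) shows that
    [v / u] is almost everywhere constant there ([quotient_constant_on_cube]).
    The constants of overlapping cubes agree, and the annulus is connected, so
    [v = c * u] almost everywhere ([proportional_on_annulus]). *)

Set Implicit Arguments.
Unset Strict Implicit.
Unset Printing Implicit Defensive.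
Import Order.TTheory GRing.Theory Num.Theory.
Import numFieldNormedType.Exports.
Local Open Scope classical_set_scope.
Local Open Scope ring_scope.

(** * Lebesgue measure on the space and cubes *)

Section Lebesgue2.
Context {R : realType}.
Local Notation mR := (measurableTypeR R).
Local Notation mR3 := (mR * mR * mR)%type.
Local Notation leb := (@lebesgue_measure R).
Local Notation mu := (@lebesgue3 R).

(** A constant of its own, to carry a sigma-finite structure: Fubini's theorem
    is applied to [lebesgue3] as the product of [lebesgue2] with the line. *)
Definition lebesgue2 : set (mR * mR)%type -> \bar R := (leb \x leb)%E.

HB.instance Definition _ := Measure.copy lebesgue2 (leb \x leb)%E.

Let lebesgue2_sigma_finite : sigma_finite setT lebesgue2.
Proof.
have /sigma_finiteP[F [TF ndF Foo]] := sigma_finiteT leb.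
exists (fun n => F n `*` F n).
  rewrite -setXTT TF predeqE => -[x y]; split.
    move=> [/= [n _ Fnx] [k _ Gky]]; exists (maxn n k) => //; split.
    - by move: x Fnx; exact/subsetPset/ndF/leq_maxl.
    - by move: y Gky; exact/subsetPset/ndF/leq_maxr.
  by move=> [n _ []/= ? ?]; split; exists n.
move=> k; have [? ?] := Foo k.
split; first exact: measurableX.
by rewrite /lebesgue2 product_measure1E// lte_mul_pinfty// ge0_fin_numE.
Qed.

HB.instance Definition _ := Measure_isSigmaFinite.Build _ _ _ lebesgue2
  lebesgue2_sigma_finite.

Lemma fubini_z_xy (f : mR3 -> \bar R) : mu.-integrable setT f ->
  (\int[mu]_x f x = \int[leb]_z \int[lebesgue2]_xy f (xy, z))%E.
Proof.
move=> h; symmetry.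
exact (@integral21_prod_meas1 _ _ _ _ R lebesgue2 leb f h).
Qed.

Lemma fubini_xy_z (f : mR3 -> \bar R) : mu.-integrable setT f ->
  (\int[mu]_x f x = \int[lebesgue2]_xy \int[leb]_z f (xy, z))%E.
Proof.
move=> h; symmetry.
exact (@integral12_prod_meas1 _ _ _ _ R lebesgue2 leb f h).
Qed.

Lemma fubini2_x_y (f : mR * mR -> \bar R) : lebesgue2.-integrable setT f ->
  (\int[lebesgue2]_x f x = \int[leb]_x \int[leb]_y f (x, y))%E.
Proof. by move=> h; symmetry; exact (@integral12_prod_meas1 _ _ _ _ R leb leb f h). Qed.

Lemma fubini2_y_x (f : mR * mR -> \bar R) : lebesgue2.-integrable setT f ->
  (\int[lebesgue2]_x f x = \int[leb]_y \int[leb]_x f (x, y))%E.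
Proof. by move=> h; symmetry; exact (@integral21_prod_meas1 _ _ _ _ R leb leb f h). Qed.

End Lebesgue2.

Section CoordinateSpace.
Context {R : realType}.
Local Notation R3 := (R * R * R)%type.
Local Notation mR := (measurableTypeR R).
Local Notation mR3 := (mR * mR * mR)%type.
Local Notation leb := (@lebesgue_measure R).
Local Notation mu := (@lebesgue3 R).

Definition cube (c : R3) (h : R) : set R3 :=
  (`[c.1.1 - h, c.1.1 + h] `*` `[c.1.2 - h, c.1.2 + h])
    `*` `[c.2 - h, c.2 + h].

Lemma cubeP c h x : cube c h x <->
  [/\ `|x.1.1 - c.1.1| <= h, `|x.1.2 - c.1.2| <= h & `|x.2 - c.2| <= h].
Proof.
by rewrite /cube/= !in_itv/= !ler_distl; split=> [[[? ?] ?]|[? ? ?]].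
Qed.

Lemma cube_center c h : 0 <= h -> cube c h c.
Proof. by move=> h0; apply/cubeP; rewrite !subrr normr0. Qed.

Lemma cube_measurable c h : measurable (cube c h : set mR3).
Proof. by apply: measurableX; [apply: measurableX|]. Qed.

Lemma cube_compact c h : compact (cube c h).
Proof.
by apply: compact_setX; [apply: compact_setX|]; exact: segment_compact.
Qed.

Lemma lebesgue3_setX (A B C : set mR) :
  measurable A -> measurable B -> measurable C ->
  mu ((A `*` B) `*` C) = (leb A * leb B * leb C)%E.
Proof.
move=> mA mB mC.
transitivity (((leb \x leb) \x leb)%E ((A `*` B) `*` C)); first by [].
rewrite product_measure1E//; last by apply: measurableX.
by congr (_ * _)%E; exact: product_measure1E.
Qed.

Lemma lebesgue3_cube c h : 0 < h -> mu (cube c h) = ((h *+ 2) ^+ 3)%:E.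
Proof.
move=> h0; rewrite lebesgue3_setX//= !lebesgue_measure_itv/= !lte_fin.
rewrite !(ltrBlDr, ltrDl) !ifT; [|lra..].
rewrite -!EFinB -!EFinM; congr EFin; ring.
Qed.

(** Distances in the product type are maxima of coordinate distances, so its
    neighbourhoods are governed by cubes. *)
Lemma nbhs_cube (x : R3) (U : set R3) :
  nbhs x U <-> exists2 h : R, 0 < h & cube x h `<=` U.
Proof.
split.
- move=> /nbhs_ballP[e /= e0 xU]; exists (e / 2); first by rewrite divr_gt0.
  move=> y /cubeP[h1 h2 h3]; apply: xU.
  by split; [split|]; rewrite /ball/= distrC; lra.
- move=> [h h0 xU]; apply/nbhs_ballP; exists h => //= y [[]] b1 b2 b3.
  apply: xU; apply/cubeP; move: b1 b2 b3.
  by rewrite /ball/= ![`|_ - y.1.1|]distrC ![`|_ - y.1.2|]distrC ![`|_ - y.2|]distrC => *; split; apply: ltW.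
Qed.

Definition rat_point (q : rat * rat * rat) : R3 :=
  (ratr q.1.1, ratr q.1.2, ratr q.2).

(** The cubes with rational centre and half-side are countably many, and every
    open set is the union of those that it contains. *)
Lemma rat_cube_cover (U : set R3) x : nbhs x U ->
  exists q : rat * rat * rat, exists s : rat,
    [/\ 0 < (ratr s : R), cube (rat_point q) (ratr s) x
      & cube (rat_point q) (ratr s) `<=` U].
Proof.
move=> /nbhs_cube[h h0 xU].
have close (t : R) : exists q : rat, `|t - ratr q| < h / 4.
  have /rat_in_itvoo[q] : t - h / 4 < t + h / 4 by lra.
  by rewrite in_itv/= => /andP[? ?]; exists q; rewrite ltr_norml; apply/andP; lra.
have [q1 h1] := close x.1.1; have [q2 h2] := close x.1.2.
have [q3 h3] := close x.2.
have /rat_in_itvoo[s] : h / 4 < h / 2 by lra.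
rewrite in_itv/= => /andP[? ?].
exists (q1, q2, q3), s; split; first lra.
  by apply/cubeP; split => /=; lra.
move=> y /cubeP[/= y1 y2 y3]; apply: xU; apply/cubeP.
have tri (u v w : R) : `|u - v| < h / 4 -> `|w - v| <= ratr s -> `|w - u| <= h.
  by rewrite ltr_norml ler_norml => /andP[? ?] /andP[? ?]; rewrite ler_norml; apply/andP; lra.
by split; [apply: tri h1 y1|apply: tri h2 y2|apply: tri h3 y3].
Qed.

(** The measurable sets are those of the product sigma-algebra, to which an
    open set belongs as a countable union of cubes. *)
Lemma open_measurable3 (U : set R3) : open U -> measurable (U : set mR3).
Proof.
move=> oU.
pose I := ((rat * rat * rat) * rat)%type.
pose F (i : I) : set mR3 :=
  [set x | cube (rat_point i.1) (ratr i.2) `<=` U /\ cube (rat_point i.1) (ratr i.2) x].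
have -> : U = \bigcup_i F i.
  apply/seteqP; split=> [x Ux|x [i _ [iU ix]]]; last exact: iU.
  have [q [s [_ sx sU]]] := rat_cube_cover (open_nbhs_nbhs (conj oU Ux)).
  by exists (q, s).
apply: countable_bigcupT_measurable => [|i]; first exact: countableP.
have [iU|iU] := pselect (cube (rat_point i.1) (ratr i.2) `<=` U).
  rewrite (_ : F i = cube (rat_point i.1) (ratr i.2)); first exact: cube_measurable.
  by apply/seteqP; split=> [x []|x ?].
by rewrite (_ : F i = set0) -?subset0// => x [].
Qed.

Lemma continuous_measurable3 (D : set R3) (f : R3 -> R) : open D ->
  (forall x, D x -> {for x, continuous f}) ->
  measurable_fun (D : set mR3) (f : mR3 -> mR).
Proof.
move=> oD cf.
apply: (measurability _ (RGenOpens.measurableE R)) => _ [_ [a [b ->]] <-].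
apply: open_measurable3; rewrite openE => x [Dx fx].
apply: filterI; first exact: open_nbhs_nbhs.
by apply: cf => //; apply: open_nbhs_nbhs; split=> //; exact: interval_open.
Qed.

End CoordinateSpace.

(** * Integration by parts against test functions *)

Section IntegrationByParts.
Context {R : realType}.
Local Notation R3 := (R * R * R)%type.
Local Notation mR := (measurableTypeR R).
Local Notation mR3 := (mR * mR * mR)%type.
Local Notation leb := (@lebesgue_measure R).
Local Notation mu := (@lebesgue3 R).
Implicit Types (D K : set R3) (f g : R3 -> R) (i : 'I_3).

Lemma compact_sub_cube (K : set R3) : compact K ->
  exists2 M : R, 0 < M & K `<=` cube 0 M.
Proof.
move=> /compact_bounded[M [_ hM]]; exists (`|M| + 1); first by rewrite ltr_wpDl.
move=> x Kx; have := hM (`|M| + 1) _ x Kx.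
rewrite (le_lt_trans (ler_norm M)) ?ltrDl// => /(_ isT).
rewrite /= prod_normE prod_normE.
rewrite !ge_max => /andP[/andP[h1 h2] h3].
by apply/cubeP; rewrite !subr0.
Qed.

Lemma closed_notin_near (K : set R3) f x : closed K ->
  (forall y, ~ K y -> f y = 0) -> ~ K x -> \near x, (cst 0 : R3 -> R) x = f x.
Proof.
move=> cK f0 nKx; have oK : open (~` K) by apply: closed_openC.
have : nbhs x (~` K) by apply: open_nbhs_nbhs.
by apply: filterS => y /f0.
Qed.

Lemma continuous_near0 (f : R3 -> R) x :
  (\near x, (cst 0 : R3 -> R) x = f x) -> {for x, continuous f}.
Proof.
move=> fx; have fx0 : f x = 0 by have := nbhs_singleton fx.
rewrite /prop_for /continuous_at fx0.
apply: cvg_trans (near_eq_cvg fx) _; exact: cvg_cst.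
Qed.

Lemma derive_near0 (f : R3 -> R) x v :
  (\near x, (cst 0 : R3 -> R) x = f x) -> is_derive x v f 0.
Proof. by move=> fx; apply: (near_eq_is_derive fx); exact: is_derive_cst. Qed.

Lemma integrable_compact_support K f : compact K -> continuous f ->
  (forall x, ~ K x -> f x = 0) ->
  mu.-integrable [set: mR3] (EFin \o f).
Proof.
move=> cK cf f0.
have [M M0 KM] := compact_sub_cube cK.
have mf : measurable_fun setT (f : mR3 -> mR).
  by apply: (@continuous_measurable3 _ setT) => [|x _]; [exact: openT|exact: cf].
have -> : EFin \o f = (EFin \o f) \_ (cube 0 M : set mR3).
  apply/funext => x; rewrite patchE; case: ifPn => //= /negP xM.
  by rewrite f0// => /KM xK; apply: xM; exact: mem_set.
apply (@integrable_mkcond _ mR3 R mu _ (EFin \o f) (cube_measurable 0 M)).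
apply: measurable_bounded_integrable.
- exact: cube_measurable.
- by rewrite lebesgue3_cube// ltry.
- exact: measurable_funTS.
- have /compact_bounded [B [Br hB]] : compact (f @` cube 0 M).
    by apply: continuous_compact (@cube_compact _ 0 M); exact: continuous_subspaceT.
  exists B; split => // z Bz x Mx.
  by apply: hB => //; exists x.
Qed.

(** The two difference quotients are the same function, so that one-variable
    calculus applies to partial derivatives. *)
Lemma is_derive_line f x i (t : R) d :
  is_derive (x + t *: basis3 i) (basis3 i) f d ->
  is_derive t 1 (fun s : R => f (x + s *: basis3 i)) d.
Proof.
have E : (fun h : R => h^-1 *: (((fun s => f (x + s *: basis3 i)) \o shift t) (h *: 1)
             - f (x + t *: basis3 i))) =
         (fun h : R => h^-1 *: ((f \o shift (x + t *: basis3 i)) (h *: basis3 i)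
             - f (x + t *: basis3 i))).
  apply/funext => h /=; congr (_ *: (f _ - _)).
  by rewrite /GRing.scale/= mulr1 -/(GRing.scale _ _) scalerDl addrCA.
by move=> [fd fE]; split; [rewrite /derivable E|rewrite /derive E].
Qed.

(** The fundamental theorem of calculus on an interval slightly larger than
    the support. *)
Lemma integral_derive_compact_support (F dF : R -> R) (M : R) : 0 < M ->
  (forall t : R, is_derive t 1 F (dF t)) -> continuous dF ->
  (forall t : R, M < `|t| -> F t = 0) -> (forall t : R, M < `|t| -> dF t = 0) ->
  (\int[leb]_t (dF t)%:E = 0)%E.
Proof.
move=> M0 FdF cdF F0 dF0.
have cF : continuous F.
  by move=> t; apply: differentiable_continuous; apply/derivable1_diffP; exact: ex_derive.
pose N := M + 1; have NE : N = M + 1 by [].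
transitivity (\int[leb]_(t in `[(- N)%R, N]) (dF t)%:E)%E.
  rewrite [RHS]integral_mkcond; apply: eq_integral => t _.
  rewrite patchE; case: ifPn => // /negP tM; rewrite dF0//.
  rewrite ltNge; apply/negP => tM'; apply: tM; rewrite inE/= in_itv/=.
  by rewrite -ler_norml; lra.
rewrite (@continuous_FTC2 _ dF F).
- by rewrite !F0 ?subee// ?normrN ger0_norm; lra.
- lra.
- exact: continuous_subspaceT.
- split=> [t _||]; [exact: ex_derive| |];
    [apply: cvg_at_right_filter|apply: cvg_at_left_filter]; exact: cF.
- by move=> t _; rewrite derive1E derive_val.
Qed.

Lemma integrable_section (g : mR3 -> mR) M B z :
  0 < M -> measurable_fun setT g -> (forall x, `|g x| <= B) ->
  (forall x, ~ cube 0 M x -> g x = 0) ->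
  lebesgue2.-integrable setT (fun xy => (g (xy, z))%:E).
Proof.
move=> M0 mg gB g0.
pose I := `[- M, M]%classic : set mR; pose S := I `*` I : set (mR * mR).
have mI : measurable I by exact: measurable_itv.
have mS : measurable S := measurableX mI mI.
have -> : (fun xy => (g (xy, z))%:E) =
    (EFin \o (fun xy => g (xy, z))) \_ S.
  apply/funext => xy; rewrite patchE; case: ifPn => //= /negP xS.
  rewrite g0// => /cubeP[]; rewrite !subr0/= => h1 h2 _; apply: xS.
  by rewrite inE; split; rewrite /I/= in_itv/= -ler_norml.
apply (@integrable_mkcond _ (mR * mR)%type R lebesgue2 _ _ mS).
apply (@measurable_bounded_integrable _ (mR * mR)%type R lebesgue2 (fun xy => g (xy, z)) S mS).
- apply: (@le_lt_trans _ _ (leb I * leb I)%E).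
    by rewrite le_eqVlt; apply/orP; left; apply/eqP; exact: product_measure1E.
  by rewrite lebesgue_measure_itv/=; case: ifP => _; rewrite -?EFinB -?EFinM ?mule0 ltry.
- by apply: measurable_funTS; exact: measurable_fun_pair1.
- by exists B; split; [exact: num_real|move=> b Bb xy _ /=; exact: le_trans (gB _) (ltW Bb)].
Qed.

Lemma line_continuous (x v : R3) : continuous (fun t : R => x + t *: v).
Proof.
move=> t; apply (@continuousD R R3 R (cst x) (fun t => t *: v) t).
  exact: cvg_cst.
by apply (@continuousZ R R3 R (fun t => t) (cst v) t); [exact: cvg_id|exact: cvg_cst].
Qed.

(** By the fundamental theorem of calculus the integral vanishes on each line
    in direction [i], and Fubini's theorem collects the lines. *)
Lemma integral_partial_compact_support i (K : set R3) (F dF : R3 -> R) :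
  compact K -> (forall x, ~ K x -> F x = 0) ->
  (forall x, is_derive x (basis3 i) F (dF x)) -> continuous dF ->
  (\int[mu]_x (dF x)%:E = 0)%E.
Proof.
move=> cK F0 FdF cdF.
have clK : closed K by apply: compact_closed => //; exact: norm_hausdorff.
have dF0 x : ~ K x -> dF x = 0.
  move=> nKx; have h := derive_near0 (basis3 i) (closed_notin_near clK F0 nKx).
  by rewrite -(@derive_val _ _ _ _ _ _ _ h) (@derive_val _ _ _ _ _ _ _ (FdF x)).
have idF := integrable_compact_support cK cdF dF0.
have [M M0 KM] := compact_sub_cube cK.
have line (x : R3) : (forall t : R, M < `|t| -> ~ cube 0 M (x + t *: basis3 i)) ->
    (\int[leb]_t (dF (x + t *: basis3 i))%:E = 0)%E.
  move=> out; apply: (@integral_derive_compact_support (fun t => F (x + t *: basis3 i)) _ M) => //.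
  - by move=> t; apply: is_derive_line.
  - move=> t; apply (@continuous_comp R R3 R (fun t : R => x + t *: basis3 i) dF t).
      exact: line_continuous.
    exact: cdF.
  - by move=> t /out nK; apply: F0 => /KM.
  - by move=> t /out nK; apply: dF0 => /KM.
have mdF : measurable_fun setT (dF : mR3 -> mR).
  by apply: (@continuous_measurable3 _ setT) => [|x _]; [exact: openT|exact: cdF].
have [B hB] : exists B, forall x, `|dF x| <= B.
  have /compact_bounded [B [Br hB]] : compact (dF @` K).
    by apply: continuous_compact cK; exact: continuous_subspaceT.
  exists (`|B| + 1) => x; have [Kx|nKx] := pselect (K x).
    by apply: hB; [rewrite (le_lt_trans (ler_norm B)) ?ltrDl|exists x].
  by rewrite dF0// normr0 addr_ge0.
have dF0' x : ~ cube 0 M x -> dF x = 0 by move=> h; apply: dF0 => /KM.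
have isec z := integrable_section z M0 mdF hB dF0'.
case: i FdF line => [[|[|[|//]]] hi] FdF line.
- rewrite (fubini_z_xy idF).
  apply: integral0_eq => z _.
  rewrite (fubini2_y_x (isec z)).
  apply: integral0_eq => y _; rewrite /fubini_G /=.
  have E t : (t, y, z) = (0, y, z) + t *: basis3 (Ordinal hi) :> R3.
    by congr (_, _, _); rewrite /= /GRing.scale/= ?mulr1 ?mulr0 ?add0r ?addr0.
  under eq_integral do rewrite E.
  apply: line => t Mt; rewrite -E => /cubeP[+ _ _].
  by rewrite subr0 leNgt Mt.
- rewrite (fubini_z_xy idF).
  apply: integral0_eq => z _.
  rewrite (fubini2_x_y (isec z)).
  apply: integral0_eq => x _; rewrite /fubini_F /=.
  have E t : (x, t, z) = (x, 0, z) + t *: basis3 (Ordinal hi) :> R3.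
    by congr (_, _, _); rewrite /= /GRing.scale/= ?mulr1 ?mulr0 ?add0r ?addr0.
  under eq_integral do rewrite E.
  apply: line => t Mt; rewrite -E => /cubeP[_ + _].
  by rewrite subr0 leNgt Mt.
- rewrite (fubini_xy_z idF).
  apply: integral0_eq => xy _; rewrite /fubini_F /=.
  have E t : (xy, t) = (xy, 0) + t *: basis3 (Ordinal hi) :> R3.
    case: xy => x y.
    by congr (_, _, _); rewrite /= /GRing.scale/= ?mulr1 ?mulr0 ?add0r ?addr0.
  under eq_integral do rewrite E.
  apply: line => t Mt; rewrite -E => /cubeP[_ _ +].
  by rewrite subr0 leNgt Mt.
Qed.

Lemma test_smooth D f : test_function D f -> smooth f.
Proof. by case. Qed.

Lemma test_partial D f i : test_function D f -> test_function D (partial i f).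
Proof.
move=> [sf cf fD].
have sub : closure [set x | partial i f x != 0] `<=` closure [set x | f x != 0].
  rewrite [X in _ `<=` X]((closure_id _).1 (@closed_closure _ [set x | f x != 0])).
  apply: closureS => x /= /eqP dx; apply: contrapT => nx; apply: dx.
  have h : forall y, ~ closure [set x | f x != 0] y -> f y = 0.
    move=> y ny; apply/eqP; apply: contra_notT ny => fy.
    exact: subset_closure.
  have := derive_near0 (basis3 i) (closed_notin_near (@closed_closure _ _) h nx).
  by move=> [_ df0]; exact: df0.
split.
- by move=> s x; have := sf (rcons s i) x; rewrite foldr_rcons.
- by apply: subclosed_compact cf sub; exact: closed_closure.
- exact: subset_trans sub fD.
Qed.

Lemma smooth_continuous f : smooth f -> continuous f.
Proof. by move=> sf x; apply: differentiable_continuous; exact: (sf [::]). Qed.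

Lemma smooth_is_derive f i x : smooth f -> is_derive x (basis3 i) f (partial i f x).
Proof. by move=> sf; apply: derivableP; apply: diff_derivable; exact: (sf [::]). Qed.

Lemma test_out D f x : test_function D f -> ~ D x -> f x = 0.
Proof.
move=> [_ _ fD] nD; apply/eqP; apply: contra_notT nD => fx; apply: fD.
exact: subset_closure.
Qed.

(** Off the support of [f], every product [f * g] vanishes near the point: this
    extends to the whole space the regularity of such products on [D]. *)
Lemma test_local D f (P : R3 -> Prop) : test_function D f ->
  (forall x, D x -> P x) ->
  (forall x, (\near x, (forall g : R, 0 = f x * g)) -> P x) ->
  forall x, P x.
Proof.
move=> [_ _ fD] PD P0 x.
have [Dx|nDx] := pselect (closure [set x | f x != 0] x); first by apply: PD; exact: fD.
apply: P0.
have : nbhs x (~` closure [set x | f x != 0]).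
  by apply: open_nbhs_nbhs; split => //; apply: closed_openC; exact: closed_closure.
apply: filterS => y ny g; rewrite (_ : f y = 0) ?mul0r//.
by apply/eqP; apply: contra_notT ny => fy; exact: subset_closure.
Qed.

Lemma test_mul_continuous D f (G : R3 -> R) : test_function D f ->
  (forall x, D x -> {for x, continuous G}) -> continuous (f \* G).
Proof.
move=> tf cG; apply: (test_local tf) => x.
- by move=> Dx; apply: continuousM; [exact: smooth_continuous (test_smooth tf) _|exact: cG].
- by move=> h; apply: continuous_near0; apply: filterS h => y /(_ (G y)).
Qed.

Lemma test_mul_integrable D f (G : R3 -> R) : open D -> test_function D f ->
  (forall x, D x -> {for x, continuous G}) ->
  mu.-integrable (D : set mR3) (EFin \o (f \* G)).
Proof.
move=> oD tf cG; have cfG := test_mul_continuous tf cG.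
apply: (@integrableS _ _ _ _ setT) => //; first exact: open_measurable3.
case: (tf) => _ cK _; apply: (integrable_compact_support cK cfG) => x nx /=.
rewrite (_ : f x = 0) ?mul0r//; apply/eqP; apply: contra_notT nx => fx.
exact: subset_closure.
Qed.

(** The partial derivative of [f * G], which is continuous with compact support
    in [D], integrates to zero. Outside [D] the product is zero, whatever
    [G] is there. *)
Lemma integration_by_parts D f i (G dG : R3 -> R) : open D -> test_function D f ->
  (forall x, D x -> is_derive x (basis3 i) G (dG x)) ->
  (forall x, D x -> {for x, continuous G}) ->
  (forall x, D x -> {for x, continuous dG}) ->
  \int[mu]_(x in D) (partial i f x * G x) = - \int[mu]_(x in D) (f x * dG x).
Proof.
move=> oD tf GdG cG cdG.
have tdf := test_partial i tf.
have i1 := test_mul_integrable oD tdf cG.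
have i2 := test_mul_integrable oD tf cdG.
apply/eqP; rewrite -addr_eq0 -(RintegralD (open_measurable3 oD) i1 i2)/=.
apply/eqP.
pose dF x := partial i f x * G x + f x * dG x.
transitivity (fine (\int[mu]_x (dF x)%:E)%E); last first.
  case: (tf) => _ cK _.
  suff -> : (\int[mu]_x (dF x)%:E)%E = 0%:E by [].
  apply: (@integral_partial_compact_support i _ (f \* G) dF cK).
  - move=> x nx /=; rewrite (_ : f x = 0) ?mul0r//; apply/eqP.
    by apply: contra_notT nx => fx; exact: subset_closure.
  - have E (x : R3) (g : R) : (\near x, forall g : R, 0 = f x * g) -> partial i f x * g = 0.
      move=> h; have [_ h'] := derive_near0 (basis3 i) (f := f)
        (filterS (fun y (hy : forall g : R, 0 = f y * g) => etrans (hy 1) (mulr1 _)) h).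
      by rewrite /partial h' mul0r.
    apply: (test_local tf) => x.
      move=> Dx.
      have h := @is_deriveM _ _ f G x (basis3 i) _ _
        (smooth_is_derive i x (test_smooth tf)) (GdG x Dx).
      by apply: (is_derive_eq h); rewrite /dF /GRing.scale/= addrC mulrC.
    move=> h; rewrite /dF E// add0r -(nbhs_singleton h)/=.
    by apply: derive_near0; apply: filterS h => y /(_ (G y)).
  - have c1 := test_mul_continuous tdf cG; have c2 := test_mul_continuous tf cdG.
    by move=> x; apply: cvgD; [exact: c1|exact: c2].
rewrite /Rintegral integral_mkcond; congr fine; apply: eq_integral => x _.
rewrite patchE; case: ifPn => //= /negP nx.
have nDx : ~ D x by move=> Dx; apply: nx; exact: mem_set.
by rewrite /dF (test_out tdf nDx) (test_out tf nDx) !mul0r addr0.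
Qed.

End IntegrationByParts.

(** * Eigenvalues of a Friedrichs extension *)

Section FormBounds.
Context {R : realType} {V : lmodType R}.
Variables (H : set V) (ip : V -> V -> R).
Hypothesis HD : forall u v, H u -> H v -> H (u + v).
Hypothesis HZ : forall (c : R) u, H u -> H (c *: u).
Hypothesis ipC : forall u v, ip u v = ip v u.
Hypothesis ipD : forall u v w, H u -> H v -> H w -> ip (u + v) w = ip u w + ip v w.
Hypothesis ipZ : forall (c : R) u v, H u -> H v -> ip (c *: u) v = c * ip u v.
Hypothesis ip_ge0 : forall u, H u -> 0 <= ip u u.

Let HB u v : H u -> H v -> H (u - v).
Proof. by move=> Hu Hv; rewrite -scaleN1r; apply: HD => //; exact: HZ. Qed.

Lemma ipB u v w : H u -> H v -> H w -> ip (u - v) w = ip u w - ip v w.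
Proof.
move=> Hu Hv Hw; rewrite -scaleN1r ipD ?ipZ ?mulN1r//; exact: HZ.
Qed.

Lemma ip_sqrB u v : H u -> H v ->
  ip (u - v) (u - v) = ip u u - ip u v *+ 2 + ip v v.
Proof.
move=> Hu Hv; have Huv := HB Hu Hv.
rewrite ipB// ![ip _ (u - v)]ipC !ipB// [ip v u]ipC; ring.
Qed.

(** The form may degenerate, so the case [ip v v = 0] is separate: there the
    quadratic polynomial [q] is affine and can only be nonnegative if its slope
    vanishes. *)
Lemma ip_cauchy_schwarz u v : H u -> H v -> ip u v ^+ 2 <= ip u u * ip v v.
Proof.
move=> Hu Hv.
have q (t : R) : 0 <= ip u u - (t * ip u v) *+ 2 + t ^+ 2 * ip v v.
  have := ip_ge0 (HB Hu (HZ t Hv)).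
  rewrite ip_sqrB//; last exact: HZ.
  rewrite ipZ//; last exact: HZ.
  rewrite [ip u (_ *: _)]ipC [ip v (_ *: _)]ipC !ipZ// [ip v u]ipC.
  by congr (0 <= _); ring.
have [v0|v0] := eqVneq (ip v v) 0.
  rewrite v0 mulr0; have := q ((ip u u + 1) / ip u v); rewrite v0 mulr0 addr0.
  have [-> _|n0] := eqVneq (ip u v) 0; first by rewrite expr0n.
  by rewrite divfK//; have := ip_ge0 Hu; lra.
have vp : 0 < ip v v by rewrite lt_neqAle eq_sym v0 ip_ge0.
have := q (ip u v / ip v v); rewrite -(pmulr_lge0 _ vp).
have -> : (ip u u - (ip u v / ip v v * ip u v) *+ 2
    + (ip u v / ip v v) ^+ 2 * ip v v) * ip v v = ip u u * ip v v - ip u v ^+ 2.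
  by field.
by rewrite subr_ge0.
Qed.

Lemma cvg_ip (v : nat -> V) u w : (forall n, H (v n)) -> H u -> H w ->
  (fun n => ip (v n - u) (v n - u)) @ \oo --> 0 ->
  (fun n => ip (v n) w) @ \oo --> ip u w.
Proof.
move=> Hv Hu Hw vu; apply/subr_cvg0.
have bnd n : `|ip (v n) w - ip u w| <= Num.sqrt (ip (v n - u) (v n - u) * ip w w).
  rewrite -ipB// -sqrtr_sqr ler_sqrt; last exact: mulr_ge0 (ip_ge0 (HB _ _)) (ip_ge0 _).
  exact: ip_cauchy_schwarz (HB _ _) _.
apply/norm_cvg0P.
apply: (@squeeze_cvgr _ _ _ _ (cst 0)
  (fun n => Num.sqrt (ip (v n - u) (v n - u) * ip w w))).
- by apply: nearW => n; rewrite normr_ge0 bnd.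
- exact: cvg_cst.
- rewrite [X in _ --> X](_ : _ = Num.sqrt (0 * ip w w)); last by rewrite mul0r sqrtr0.
  apply: continuous_cvg; first exact: sqrt_continuous.
  by apply: cvgM => //; exact: cvg_cst.
Qed.

Lemma cvg_ip_sqr (v : nat -> V) u : (forall n, H (v n)) -> H u ->
  (fun n => ip (v n - u) (v n - u)) @ \oo --> 0 ->
  (fun n => ip (v n) (v n)) @ \oo --> ip u u.
Proof.
move=> Hv Hu vu.
have -> : (fun n => ip (v n) (v n)) =
    (fun n => ip (v n - u) (v n - u) + (ip (v n) u *+ 2 - ip u u)).
  by apply/funext => n; rewrite ip_sqrB//; ring.
rewrite [X in _ --> X](_ : _ = 0 + (ip u u *+ 2 - ip u u)); last by ring.
apply: cvgD => //; apply: cvgB; last exact: cvg_cst.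
by apply: cvgMn; exact: cvg_ip.
Qed.

Variables (S : V -> V -> Prop) (k : R).
Hypothesis SH : forall v g, S v g -> H v /\ H g.
Hypothesis S_sym : forall v g w h, S v g -> S w h -> ip g w = ip v h.
Hypothesis S_ge : forall v g, S v g -> k * ip v v <= ip g v.

(** The hypotheses present [S] as a symmetric operator bounded below by [k].
    Along a form-Cauchy sequence [v n] tending to an eigenvector [u], pass to
    the limit in the first index of [q (v m - v n)]: the mixed term
    [<v m, S (v n)>] tends to [<u, S (v n)> = l <u, v n>], while the first term
    is bounded below by [k <v m, v m>]. *)
Lemma friedrichs_eigenvector_form l u :
  friedrichs_extension H ip S u (l *: u) ->
  H u /\ exists v g : nat -> V,
    [/\ forall n, S (v n) (g n),
        (fun n => ip (v n - u) (v n - u)) @ \oo --> 0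
      & forall e : R, 0 < e -> exists N : nat, forall n, (N <= n)%N ->
          k * ip u u + ip (g n) (v n) - (l * ip u (v n)) *+ 2 <= e].
Proof.
move=> [[Hu [_ adj]] [_ [v [g [Sv vu cauchy]]]]]; split=> //.
exists v, g; split=> // e e0; have [N hN] := cauchy _ e0.
have Hv n : H (v n) by case: (SH (Sv n)).
have Hg n : H (g n) by case: (SH (Sv n)).
exists N => n Nn.
have lim : (fun m => k * ip (v m) (v m) + ip (g n) (v n) - ip (v m) (g n) *+ 2) @ \oo
    --> k * ip u u + ip (g n) (v n) - (l * ip u (v n)) *+ 2.
  have -> : l * ip u (v n) = ip u (g n) by rewrite (adj _ _ (Sv n)) ipZ.
  apply: cvgB; last by apply: cvgMn; exact: cvg_ip.
  apply: cvgD; last exact: cvg_cst.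
  by apply: cvgM; [exact: cvg_cst|exact: cvg_ip_sqr].
apply: (cvgr_to_le lim).
exists N => // m /= Nm; apply: ltW; apply: le_lt_trans (hN m n Nm Nn).
rewrite ipB//; last exact: HB.
have E x : H x -> ip x (v m - v n) = ip x (v m) - ip x (v n).
  by move=> Hx; rewrite ipC ipB// !(ipC _ x).
rewrite !E// (S_sym (Sv m) (Sv n)) (ipC (g n) (v m)).
by have := S_ge (Sv m); lra.
Qed.

(** Bounding [<S (v n), v n>] from below as well and letting [n] tend to
    infinity leaves [2 k <u, u> <= 2 l <u, u>]. *)
Lemma friedrichs_eigenvalue_ge l u :
  eigenvector ip (friedrichs_extension H ip S) l u -> k <= l.
Proof.
move=> [/friedrichs_eigenvector_form[Hu [v [g [Sv vu hN]]]]].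
rewrite /same_vector subr0 => /eqP u0.
have up : 0 < ip u u by rewrite lt_neqAle eq_sym u0 ip_ge0.
have Hv n : H (v n) by case: (SH (Sv n)).
rewrite -(ler_pM2r up).
have lim : (fun n => k * ip u u + k * ip (v n) (v n) - (l * ip (v n) u) *+ 2) @ \oo
    --> k * ip u u + k * ip u u - (l * ip u u) *+ 2.
  apply: cvgB; last by apply: cvgMn; apply: cvgM; [exact: cvg_cst|exact: cvg_ip].
  apply: cvgD; first exact: cvg_cst.
  by apply: cvgM; [exact: cvg_cst|exact: cvg_ip_sqr].
suff : k * ip u u + k * ip u u - (l * ip u u) *+ 2 <= 0 by lra.
apply/ler_addgt0Pl => e e0; rewrite addr0; have [N hN'] := hN _ e0.
apply: (cvgr_to_le lim); exists N => // n /= Nn.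
have := hN' n Nn; have := S_ge (Sv n); rewrite [ip u (v n)]ipC; lra.
Qed.

(** When [l = k] the inequality of [friedrichs_eigenvector_form] bounds
    [<S (v n), v n> - k <v n, v n> + k <v n - u, v n - u>], and its last term is
    nonnegative. *)
Lemma friedrichs_ground_state u : 0 <= k ->
  friedrichs_extension H ip S u (k *: u) ->
  H u /\ exists v g : nat -> V,
    [/\ forall n, S (v n) (g n),
        (fun n => ip (v n - u) (v n - u)) @ \oo --> 0
      & forall e : R, 0 < e -> exists N : nat, forall n, (N <= n)%N ->
          ip (g n) (v n) - k * ip (v n) (v n) <= e].
Proof.
move=> kge0 /friedrichs_eigenvector_form[Hu [v [g [Sv vu hN]]]]; split=> //.
exists v, g; split=> // e e0; have [N hN'] := hN _ e0; exists N => n Nn.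
have [Hv _] := SH (Sv n).
have k0 : 0 <= k * ip (v n - u) (v n - u).
  by apply: mulr_ge0 => //; apply: ip_ge0; exact: HB.
by have := hN' n Nn; move: k0; rewrite ip_sqrB// [ip u (v n)]ipC; lra.
Qed.
End FormBounds.

(** * The semi-inner product of square-integrable functions *)

Section L2Space.
Context {R : realType}.
Local Notation R3 := (R * R * R)%type.
Local Notation mR := (measurableTypeR R).
Local Notation mR3 := (mR * mR * mR)%type.
Local Notation mu := (@lebesgue3 R).
Variable D : set R3.
Hypothesis mD : measurable (D : set mR3).
Implicit Types (f g h : R3 -> R).

Lemma L2_measurable f : L2 D f -> measurable_fun (D : set mR3) (f : mR3 -> mR).
Proof.
rewrite /L2/= inE => /andP[+ _]; rewrite inE/= => mf.
by apply/(measurable_restrictT _ mD).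
Qed.

Lemma L2_mul_integrable f g : L2 D f -> L2 D g ->
  mu.-integrable (D : set mR3) (EFin \o (f \* g)).
Proof.
move=> Lf Lg; have /Lfun1_integrable := Lfun2_mul_Lfun1 Lf Lg.
move=> h; apply (@integrable_mkcond _ mR3 R mu _ (EFin \o (f \* g)) mD).
apply: eq_integrable h => // x _ /=.
by rewrite !patchE; case: ifP => //=; rewrite ?mulr0.
Qed.

Lemma L2_of_integrable f : measurable_fun (D : set mR3) (f : mR3 -> mR) ->
  mu.-integrable (D : set mR3) (EFin \o (f \* f)) -> L2 D f.
Proof.
move=> mf fi; rewrite /L2/= inE; apply/andP; split.
  by rewrite inE/=; apply/(measurable_restrictT _ mD).
rewrite inE/= /finite_norm unlock /Lnorm.
apply: poweR_lty.
have /integrableP[_] := (@integrable_mkcond _ mR3 R mu _ (EFin \o (f \* f)) mD).1 fi.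
apply: le_lt_trans; rewrite le_eqVlt; apply/orP; left; apply/eqP.
apply: eq_integral => x _ /=; rewrite !patchE; case: ifP => _ /=.
  by rewrite powR_mulrn// -normrX expr2.
by rewrite normr0 powR0.
Qed.

Lemma L2_add f g : L2 D f -> L2 D g -> L2 D (f + g).
Proof.
move=> Lf Lg; have mf := L2_measurable Lf; have mg := L2_measurable Lg.
apply: L2_of_integrable; first exact: measurable_funD.
have i1 := L2_mul_integrable Lf Lf; have i2 := L2_mul_integrable Lg Lg.
have i3 := L2_mul_integrable Lf Lg.
have i := integrableD mD (integrableD mD i1 i2) (integrableD mD i3 i3).
apply: eq_integrable i => // x _ /=.
by rewrite -!EFinD; congr EFin; rewrite /= !fctE; ring.
Qed.

Lemma L2_scale (c : R) f : L2 D f -> L2 D (c *: f).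
Proof.
move=> Lf; have mf := L2_measurable Lf.
apply: L2_of_integrable; first exact: measurable_funM.
have i1 := integrableZl mD (c ^+ 2) (L2_mul_integrable Lf Lf).
apply: eq_integrable i1 => // x _ /=.
have E : (c *: f) x = c * f x by [].
by rewrite -EFinM; congr EFin; rewrite /= E; ring.
Qed.

Lemma L2_ipC f g : L2_ip D f g = L2_ip D g f.
Proof. by apply: eq_Rintegral => x _; rewrite mulrC. Qed.

Lemma L2_ipD f g h : L2 D f -> L2 D g -> L2 D h ->
  L2_ip D (f + g) h = L2_ip D f h + L2_ip D g h.
Proof.
move=> Lf Lg Lh.
rewrite /L2_ip -(RintegralD mD (L2_mul_integrable Lf Lh) (L2_mul_integrable Lg Lh)).
by apply: eq_Rintegral => x _; rewrite /= fctE mulrDl.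
Qed.

Lemma L2_ipZ (c : R) f g : L2 D f -> L2 D g ->
  L2_ip D (c *: f) g = c * L2_ip D f g.
Proof.
move=> Lf Lg; rewrite /L2_ip -(RintegralZl c mD (L2_mul_integrable Lf Lg)).
by apply: eq_Rintegral => x _; rewrite /= mulrA.
Qed.

Lemma L2_ip_ge0 f : L2 D f -> 0 <= L2_ip D f f.
Proof. by move=> _; apply: Rintegral_ge0 => x _; rewrite -expr2 sqr_ge0. Qed.

Lemma L2_ip_eq0 f : L2 D f -> L2_ip D f f = 0 ->
  mu.-negligible (D `&` [set x | f x != 0] : set mR3).
Proof.
move=> Lf f0; have mf := L2_measurable Lf; have fi := L2_mul_integrable Lf Lf.
have mff : measurable_fun (D : set mR3) (fun x => (f x * f x)%:E).
  by apply/measurable_EFinP; exact: measurable_funM.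
have : (\int[mu]_(x in D) `|(f x * f x)%:E| = 0)%E.
  move: f0; rewrite /L2_ip /Rintegral => f0.
  under eq_integral do rewrite gee0_abs ?lee_fin -?expr2 ?sqr_ge0//.
  rewrite -[LHS]fineK; first by rewrite f0.
  exact: integrable_fin_num.
move=> /(ae_eq_integral_abs _ mD mff).1.
rewrite /ae_eq/= => -[N [mN N0 hN]]; exists N; split=> // x [Dx fx].
apply: hN => /= /(_ Dx) /eqP; rewrite eqe mulf_eq0 orbb.
by apply/negP.
Qed.

Lemma L2_ip_negligible f g : L2 D f -> L2 D g ->
  mu.-negligible (D `&` [set x | f x != 0] : set mR3) -> L2_ip D f g = 0.
Proof.
move=> Lf Lg fN; rewrite /L2_ip /Rintegral.
rewrite (@ae_eq_integral _ _ _ mu D (cst 0%E)) ?integral0//.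
- by have /integrableP[] := L2_mul_integrable Lf Lg.
- case: fN => N [mN N0 hN]; exists N; split => // x /= nx; apply: hN.
  split; first by apply: contrapT => nD; apply: nx => /nD.
  by apply/eqP => fx; apply: nx => _; rewrite fx mul0r.
Qed.

End L2Space.

(** * Jacobi factorisation by a positive solution *)

Section GroundStateRepresentation.
Context {R : realType}.
Local Notation R3 := (R * R * R)%type.
Local Notation mR := (measurableTypeR R).
Local Notation mR3 := (mR * mR * mR)%type.
Local Notation mu := (@lebesgue3 R).
Implicit Types (D : set R3) (f g G H : R3 -> R) (i : 'I_3).

(** Pointwise continuity in the whole space at the points of [D], rather than
    continuity of a restriction: for an open [D] this is the notion that
    multiplies well with test functions. *)
Definition cont_on D G := forall x, D x -> {for x, continuous G}.

Lemma cont_onD D G H : cont_on D G -> cont_on D H -> cont_on D (fun x => G x + H x).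
Proof. move=> cG cH x Dx; exact (@continuousD R R R3 G H x (cG x Dx) (cH x Dx)). Qed.

Lemma cont_onN D G : cont_on D G -> cont_on D (fun x => - G x).
Proof. move=> cG x Dx; exact (@continuousN R R R3 G x (cG x Dx)). Qed.

Lemma cont_onB D G H : cont_on D G -> cont_on D H -> cont_on D (fun x => G x - H x).
Proof. by move=> cG cH; apply: cont_onD => //; exact: cont_onN. Qed.

Lemma cont_onM D G H : cont_on D G -> cont_on D H -> cont_on D (fun x => G x * H x).
Proof. move=> cG cH x Dx; exact (@continuousM R R3 G H x (cG x Dx) (cH x Dx)). Qed.

Lemma cont_onV D G : (forall x, D x -> G x != 0) -> cont_on D G ->
  cont_on D (fun x => (G x)^-1).
Proof. move=> G0 cG x Dx; exact (@continuousV R R3 G x (G0 x Dx) (cG x Dx)). Qed.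

Lemma cont_on_cst D (c : R) : cont_on D (fun=> c).
Proof. by move=> x _; apply: cst_continuous. Qed.

Lemma cont_on_sum D n (G : 'I_n -> R3 -> R) : (forall j, cont_on D (G j)) ->
  cont_on D (fun x => \sum_(j < n) G j x).
Proof.
elim: n G => [|n IH] G cG.
  by under [X in cont_on _ X]eq_fun do rewrite big_ord0; exact: cont_on_cst.
under [X in cont_on _ X]eq_fun do rewrite big_ord_recr/=.
by apply: cont_onD => //; exact: IH.
Qed.

Lemma cont_on_test D E f : test_function E f -> cont_on D f.
Proof. by move=> /test_smooth/smooth_continuous cf x _; exact: cf. Qed.

Lemma test_laplacian_cont_on D E f : test_function E f -> cont_on D (laplacian f).
Proof.
move=> tf; apply: cont_on_sum => j; apply: (@cont_on_test D E).
by do 2 apply: test_partial.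
Qed.

Lemma integrable_sum_ord (E : set R3) n (G : 'I_n -> R3 -> R) :
  measurable (E : set mR3) ->
  (forall j, mu.-integrable (E : set mR3) (EFin \o G j)) ->
  mu.-integrable (E : set mR3) (EFin \o (fun x => \sum_(j < n) G j x)).
Proof.
move=> mE iG; have h := @integrable_sum _ _ R mu _ mE 'I_n (index_enum 'I_n) xpredT _ (fun j _ => iG j).
by apply: eq_integrable h => // x _ /=; rewrite sumEFin.
Qed.

Lemma Rintegral_sum (E : set R3) n (G : 'I_n -> R3 -> R) :
  measurable (E : set mR3) ->
  (forall j, mu.-integrable (E : set mR3) (EFin \o G j)) ->
  \int[mu]_(x in E) (\sum_(j < n) G j x) = \sum_(j < n) \int[mu]_(x in E) G j x.
Proof.
move=> mE; elim: n G => [|n IH] G iG.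
  rewrite big_ord0 (@eq_Rintegral _ _ _ _ _ (cst 0)) ?Rintegral_cst ?mul0r// => x _.
  by rewrite big_ord0.
rewrite big_ord_recr/= -IH; last by move=> j; exact: iG.
have iS := integrable_sum_ord mE (fun j => iG (widen_ord (leqnSn n) j)).
rewrite -(RintegralD mE iS (iG _)).
by apply: eq_Rintegral => x _; rewrite /= big_ord_recr.
Qed.

Lemma Rintegral_test_sum D f n (G : 'I_n -> R3 -> R) : open D -> test_function D f ->
  (forall j, cont_on D (G j)) ->
  \int[mu]_(x in D) (f x * \sum_(j < n) G j x)
  = \sum_(j < n) \int[mu]_(x in D) (f x * G j x).
Proof.
move=> oD tf cG; rewrite -Rintegral_sum; last 2 first.
- exact: open_measurable3.
- by move=> j; exact: test_mul_integrable oD tf (cG j).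
by apply: eq_Rintegral => x _; rewrite mulr_sumr.
Qed.

Variable D : set R3.
Hypothesis oD : open D.

(** Green's first identity. *)
Lemma green_first f (G : R3 -> R) (dG : 'I_3 -> R3 -> R) : test_function D f ->
  (forall i x, D x -> is_derive x (basis3 i) G (dG i x)) ->
  cont_on D G -> (forall i, cont_on D (dG i)) ->
  L2_ip D (- laplacian f) G
  = \sum_(i < 3) \int[mu]_(x in D) (partial i f x * dG i x).
Proof.
move=> tf GdG cG cdG; have mD := open_measurable3 oD.
have E i : \int[mu]_(x in D) (partial i f x * dG i x)
    = - \int[mu]_(x in D) (partial i (partial i f) x * G x).
  have h := integration_by_parts oD (test_partial i tf) (GdG i) cG (cdG i).
  by rewrite h opprK.
under [RHS]eq_bigr do rewrite E.
have ti i := test_mul_integrable oD (test_partial i (test_partial i tf)) cG.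
rewrite sumrN -(Rintegral_sum mD ti) -[RHS]mulN1r.
apply: (etrans _ (RintegralZl (-1) mD (integrable_sum_ord mD ti))).
apply: eq_Rintegral => x _.
have -> : (- laplacian f) x = - laplacian f x by [].
by rewrite /laplacian mulN1r -mulr_suml mulNr.
Qed.

Lemma laplacian_symmetric f g : test_function D f -> test_function D g ->
  L2_ip D (- laplacian f) g = L2_ip D f (- laplacian g).
Proof.
move=> tf tg; rewrite [RHS]L2_ipC.
have green a b : test_function D a -> test_function D b ->
    L2_ip D (- laplacian a) b
    = \sum_(i < 3) \int[mu]_(x in D) (partial i a x * partial i b x).
  move=> ta tb; apply: green_first => //.
  - by move=> i x _; exact: smooth_is_derive (test_smooth tb).
  - exact: cont_on_test tb.
  - by move=> i; exact: cont_on_test (test_partial i tb).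
apply: (eq_trans (green f g tf tg)); apply: esym.
apply: (eq_trans (green g f tg tf)).
by apply: eq_bigr => i _; apply: eq_Rintegral => x _; rewrite mulrC.
Qed.

Variables (u : R3 -> R) (du ddu : 'I_3 -> R3 -> R) (k : R).
Hypothesis u_du : forall i x, D x -> is_derive x (basis3 i) u (du i x).
Hypothesis du_ddu : forall i x, D x -> is_derive x (basis3 i) (du i) (ddu i x).
Hypothesis cu : cont_on D u.
Hypothesis cdu : forall i, cont_on D (du i).
Hypothesis cddu : forall i, cont_on D (ddu i).
Hypothesis u_gt0 : forall x, D x -> 0 < u x.
Hypothesis u_eigen : forall x, D x -> \sum_(i < 3) ddu i x = - (k * u x).

(** Integrating by parts twice moves the Laplacian from [f] to [u]; the
    behaviour of [u] at the boundary does not matter, because [f] vanishes near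
    it. *)
Lemma weak_eigenfunction f : test_function D f ->
  L2_ip D u (- laplacian f) = k * L2_ip D u f.
Proof.
move=> tf; have mD := open_measurable3 oD.
rewrite L2_ipC (green_first tf u_du cu cdu).
under eq_bigr => i _ do
  rewrite (integration_by_parts oD tf (@du_ddu i) (@cdu i) (@cddu i)).
rewrite sumrN -(Rintegral_test_sum oD tf cddu) /L2_ip.
rewrite -RintegralZl//; last first.
  have := test_mul_integrable oD tf cu.
  by apply: eq_integrable => // x _ /=; rewrite mulrC.
rewrite -mulN1r -RintegralZl//; last first.
  by have := test_mul_integrable oD tf (cont_on_sum cddu).
by apply: eq_Rintegral => x /set_mem Dx; rewrite u_eigen//; ring.
Qed.

Let u_neq0 x : D x -> u x != 0. Proof. by move=> Dx; rewrite gt_eqF ?u_gt0. Qed.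

Let p i x := du i x / u x.

Let cp i : cont_on D (p i).
Proof. by apply: cont_onM => //; exact: cont_onV. Qed.

(** Jacobi's factorisation: the right-hand side is the integral of [u ^ 2 *
    |grad (f / u)| ^ 2]. With [p = grad u / u] the equation of [u] reads [div p
    + |p| ^ 2 = - k], and integrating by parts the divergence of [f ^ 2 * p]
    removes the mixed term of [|grad f - f p| ^ 2]. *)
Lemma jacobi_identity f : test_function D f ->
  L2_ip D (- laplacian f) f - k * L2_ip D f f
  = \sum_(i < 3) \int[mu]_(x in D) (partial i f x - f x * (du i x / u x)) ^+ 2.
Proof.
move=> tf; have mD := open_measurable3 oD.
have cf : cont_on D f := cont_on_test tf.
have tdf i := test_partial i tf.
have cdf i : cont_on D (partial i f) := cont_on_test (tdf i).
have cddf i : cont_on D (partial i (partial i f)) := cont_on_test (test_partial i (tdf i)).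
pose G i x := partial i f x - f x * p i x.
have cG i : cont_on D (G i) by apply: cont_onB => //; exact: cont_onM.
pose dp i x := ddu i x / u x - p i x ^+ 2.
have cdp i : cont_on D (dp i).
  apply: cont_onB; first by apply: cont_onM => //; exact: cont_onV.
  exact: (@cont_onM _ (p i) (p i)).
pose dG i x := partial i (partial i f) x - (partial i f x * p i x + f x * dp i x).
have cdG i : cont_on D (dG i).
  by apply: cont_onB => //; apply: cont_onD; exact: cont_onM.
have p_dp i x : D x -> is_derive x (basis3 i) (p i) (dp i x).
  move=> Dx; have d1 := du_ddu i Dx; have d2 := u_du i Dx.
  have dV : is_derive x (basis3 i) (fun y => (u y)^-1) (- u x ^- 2 *: du i x).
    apply: DeriveDef; first by apply: derivableV; [exact: u_neq0|exact: ex_derive].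
    by rewrite deriveV ?derive_val//; exact: u_neq0.
  have h := @is_deriveM _ _ (du i) (fun y => (u y)^-1) x (basis3 i) _ _ d1 dV.
  apply: (is_derive_eq h); rewrite /dp /p /GRing.scale/=.
  by field; exact: u_neq0.
have G_dG i x : D x -> is_derive x (basis3 i) (G i) (dG i x).
  move=> Dx; have d1 := smooth_is_derive i x (test_smooth (tdf i)).
  have d2 := smooth_is_derive i x (test_smooth tf).
  have h1 := @is_deriveM _ _ f (p i) x (basis3 i) _ _ d2 (p_dp i x Dx).
  have h := @is_deriveB _ _ _ (partial i f) (f * p i) x (basis3 i) _ _ d1 h1.
  by apply: (is_derive_eq h); rewrite /dG /GRing.scale/=; ring.
have step i : \int[mu]_(x in D) (partial i f x - f x * (du i x / u x)) ^+ 2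
    = \int[mu]_(x in D) (f x * (f x * (ddu i x / u x) - partial i (partial i f) x)).
  have cpG : cont_on D (fun x => p i x * G i x) by exact: cont_onM.
  transitivity (\int[mu]_(x in D) (partial i f x * G i x - f x * (p i x * G i x))).
    by apply: eq_Rintegral => x _; rewrite /G /p; ring.
  rewrite RintegralB//; last 2 first.
  - exact: (test_mul_integrable oD (tdf i) (cG i)).
  - exact: (test_mul_integrable oD tf cpG).
  rewrite (integration_by_parts oD tf (G_dG i) (cG i) (cdG i)).
  rewrite -opprD -RintegralD//; last 2 first.
  - exact: (test_mul_integrable oD tf (cdG i)).
  - exact: (test_mul_integrable oD tf cpG).
  rewrite -mulN1r -RintegralZl//; last first.
    have := test_mul_integrable oD tf (cont_onD (cdG i) cpG).
    by apply: eq_integrable => // x _ /=; rewrite mulrDr.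
  by apply: eq_Rintegral => x _; rewrite /dG /dp /G; ring.
under [RHS]eq_bigr do rewrite step.
have cS i : cont_on D (fun x => f x * (ddu i x / u x) - partial i (partial i f) x).
  by apply: cont_onB => //; apply: cont_onM => //; apply: cont_onM => //; exact: cont_onV.
rewrite -(Rintegral_test_sum oD tf cS) L2_ipC /L2_ip.
rewrite -RintegralZl//; last exact: (test_mul_integrable oD tf cf).
rewrite -RintegralB//; last 2 first.
- exact: (test_mul_integrable oD tf (cont_onN (test_laplacian_cont_on tf))).
- have := test_mul_integrable oD tf (cont_onM (@cont_on_cst D k) cf).
  by apply: eq_integrable => // x _ /=; congr EFin; ring.
apply: eq_Rintegral => x /set_mem Dx.
have -> : (- laplacian f) x = - laplacian f x by [].
rewrite sumrB -mulr_sumr -mulr_suml u_eigen//.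
by rewrite /laplacian; field; exact: u_neq0.
Qed.

(** The right-hand side of [jacobi_identity] is a sum of integrals of squares.
    *)
Lemma barta_lower_bound f : test_function D f ->
  k * L2_ip D f f <= L2_ip D (- laplacian f) f.
Proof.
move=> tf; rewrite -subr_ge0 jacobi_identity//.
by apply: sumr_ge0 => i _; apply: Rintegral_ge0 => x _; exact: sqr_ge0.
Qed.

End GroundStateRepresentation.

(** * Smooth functions built from the norm *)

Section FlatFunctions.
Context {R : realType}.
Implicit Types (k : nat) (y z : R).

(** The family [y ^ (- k) * exp (- 1 / y)], extended by zero to [y <= 0].
    Keeping the power as a parameter makes the family closed under
    differentiation, which is how its members are seen to be smooth. *)
Definition flat k (y : R) : R := if 0 < y then y^-1 ^+ k * expR (- y^-1) else 0.

Lemma flat_le0 k y : y <= 0 -> flat k y = 0.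
Proof. by rewrite leNgt /flat => /negbTE ->. Qed.

Lemma flat_ge0 k y : 0 <= flat k y.
Proof.
rewrite /flat; case: ifP => // y0.
by rewrite mulr_ge0 ?expR_ge0// exprn_ge0// invr_ge0 ltW.
Qed.

Lemma flatS k y : flat k y = y * flat k.+1 y.
Proof.
rewrite /flat; case: ifP => y0; last by rewrite mulr0.
by rewrite exprS !mulrA divff ?mul1r// gt_eqF.
Qed.

Lemma exprn_expRN k z : 0 <= z -> z ^+ k * expR (- z) <= k`!%:R.
Proof.
move=> z0; rewrite expRN ler_pdivrMr ?expR_gt0//.
have f0 : (0 : R) < k`!%:R by rewrite ltr0n fact_gt0.
rewrite -ler_pdivrMl// mulrC; case: k f0 => [|k] f0.
  by rewrite expr0 fact0 divr1; have := expR_ge1Dx z; lra.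
by have := expR_ge1Dxn k z0; lra.
Qed.

Lemma flat_le k y : flat k y <= k`!%:R.
Proof.
rewrite /flat; case: ifP => [y0|_]; last exact: ler0n.
by apply: exprn_expRN; rewrite invr_ge0 ltW.
Qed.

(** All the members vanish at the origin at least linearly, since [flat k.+1] is
    bounded. *)
Lemma flat_le_norm k y : `|flat k y| <= k.+1`!%:R * `|y|.
Proof.
rewrite ger0_norm ?flat_ge0// flatS.
have [y0|y0] := ltP 0 y; last by rewrite flat_le0 ?mulr0 ?mulr_ge0.
rewrite (ger0_norm (ltW y0)) mulrC; apply: ler_wpM2r; first exact: ltW.
exact: flat_le.
Qed.

(** At the origin [flat k y = y * flat k.+1 y] exhibits [flat k.+1] as a
    continuous slope function, in the sense of Caratheodory. *)
Lemma is_derive_flat k y :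
  is_derive y (1 : R) (flat k) (flat k.+2 y - k%:R * flat k.+1 y).
Proof.
have [y0|y0|->] := ltgtP y 0.
- apply: (@near_eq_is_derive _ _ _ (cst 0) (flat k)).
    near=> z; rewrite flat_le0//; apply: ltW; near: z; exact: lt_nbhsl.
  by rewrite !flat_le0 ?mulr0 ?subr0 ?ltW//; exact: is_derive_cst.
- apply: (@near_eq_is_derive _ _ _ (fun z => z^-1 ^+ k * expR (- z^-1)) (flat k)).
    near=> z; rewrite /flat ifT//; near: z; exact: lt_nbhsr.
  have yn0 : y != 0 by rewrite gt_eqF.
  have dV : is_derive y (1 : R) (fun z : R => z^-1) (- y ^- 2 *: (1 : R)).
    exact: (@is_deriveV R id y 1 1 yn0 (is_derive_id _ _)).
  have d1 := @is_deriveX _ _ (fun z : R => z^-1) k y 1 _ dV.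
  have d2 := @is_derive1_comp R expR (fun z => - z^-1) y _ _
    (is_derive_expR _) (@is_deriveN _ _ _ _ _ _ _ dV).
  have d := @is_deriveM _ _ ((fun z : R => z^-1) ^+ k) (expR \o (fun z => - z^-1)) y 1 _ _ d1 d2.
  have -> : (fun z : R => z^-1 ^+ k * expR (- z^-1)) =
      (fun z : R => z^-1) ^+ k * (expR \o (fun z => - z^-1)).
    by apply/funext => z; rewrite fctE/= fctE.
  apply: (is_derive_eq d); rewrite /flat y0 /GRing.scale/= fctE/= -!exprVn.
  move: (expR (- y^-1)) => e; set z := y^-1; clearbody z.
  case: k {d1 d} => [|k]; first by ring.
  by rewrite /= !exprS; ring.
- apply/is_derive1_caratheodory; exists (flat k.+1); split.
  + by move=> z; rewrite (flat_le0 k (lexx 0)) !subr0 flatS mulrC.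
  + rewrite /prop_for /continuous_at (flat_le0 _ (lexx 0)).
    apply/norm_cvg0P.
    apply: (@squeeze_cvgr _ _ _ _ (cst 0) (fun z : R => k.+2`!%:R * `|z|)).
    * by apply: nearW => z; rewrite normr_ge0 flat_le_norm.
    * exact: cvg_cst.
    * rewrite [X in _ --> X](_ : _ = k.+2`!%:R * `|0 : R|); last by rewrite normr0 mulr0.
      by apply: cvgMr; apply: cvg_norm; exact: cvg_id.
  + by rewrite !flat_le0// mulr0 subr0.
Unshelve. all: by end_near. Qed.

End FlatFunctions.

Section SmoothRadial.
Context {R : realType}.
Local Notation R3 := (R * R * R)%type.
Implicit Types (x : R3) (f g : R3 -> R) (i j : 'I_3).

Definition coord i x : R :=
  if val i is 0 then x.1.1 else if val i is 1 then x.1.2 else x.2.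

Lemma sum_coord_sqr x : \sum_(i < 3) coord i x ^+ 2 = euclidean_norm x ^+ 2.
Proof.
rewrite !big_ord_recl big_ord0 addr0 /euclidean_norm sqr_sqrtr ?addrA//.
by rewrite !addr_ge0// sqr_ge0.
Qed.

Lemma coord_continuous i : continuous (coord i).
Proof.
move=> x; apply/cvgrPdist_le => e e0; apply/nbhs_cube; exists e => // y /cubeP[h1 h2 h3].
by rewrite /= distrC; case: i => [[|[|[|//]]] hi].
Qed.

Lemma differentiable_coord3 i x : differentiable (coord i) x.
Proof.
have lin : linear (coord i : R3 -> R^o).
  by move=> c y z; case: i => [[|[|[|//]]] hi].
pose L : {linear R3 -> R^o} := HB.pack (coord i : R3 -> R^o)
  (GRing.isLinear.Build _ _ _ _ _ lin).
exact: (@linear_differentiable R R3 R^o L x (@coord_continuous i)).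
Qed.

Lemma is_derive_coord i j x :
  is_derive x (basis3 j) (coord i) (i == j)%:R.
Proof.
have E h : h != 0 -> h^-1 *: ((coord i \o shift x) (h *: basis3 j) - coord i x) = (i == j)%:R.
  move=> h0.
  have -> : (coord i \o shift x) (h *: basis3 j) = h * coord i (basis3 j) + coord i x.
    by case: i => [[|[|[|//]]] hi].
  rewrite addrK /GRing.scale/= mulKf//.
  by case: i => [[|[|[|//]]] hi]; case: j => [[|[|[|//]]] hj].
have C : (fun h => h^-1 *: ((coord i \o shift x) (h *: basis3 j) - coord i x)) @ 0^'
    --> ((i == j)%:R : R).
  apply: cvg_near_cst; near=> h.
  by rewrite E//; near: h; exact: nbhs_dnbhs_neq.
by split; [apply/cvg_ex; exists (i == j)%:R|exact/cvg_lim].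
Unshelve. all: by end_near. Qed.

(** The derivative of [h \o f] only involves [f] along a line, so the chain
    rule for functions of one variable suffices. *)
Lemma is_derive_comp1 (h : R -> R) f x v (df dh : R) :
  is_derive x v f df -> is_derive (f x) 1 h dh -> is_derive x v (h \o f) (dh * df).
Proof.
have line g dg : is_derive x v g dg <-> is_derive (0 : R) 1 (fun t : R => g (t *: v + x)) dg.
  have E : (fun t : R => t^-1 *: (((fun t : R => g (t *: v + x)) \o shift 0) (t *: 1) - g (0 *: v + x)))
      = (fun t => t^-1 *: ((g \o shift x) (t *: v) - g x)).
    apply/funext => t /=; congr (_ *: (g _ - g _)); last by rewrite scale0r add0r.
    by rewrite addr0 /GRing.scale/= mulr1.
  by split => -[gd gE]; split; [rewrite /derivable E|rewrite /derive E|
    move: gd; rewrite /derivable E|move: gE; rewrite /derive E].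
move=> /line fd hd; apply/line.
apply: (@is_derive1_comp R h (fun t : R => f (t *: v + x))) => //.
by rewrite scale0r add0r.
Qed.

(** A syntactic class of functions that are smooth away from the origin. It is
    closed under partial derivatives, so that smoothness reduces to
    differentiability of its members. *)
Inductive elementary : (R3 -> R) -> Prop :=
| elem_cst c : elementary (fun=> c)
| elem_coord i : elementary (coord i)
| elem_norm : elementary euclidean_norm
| elem_inv_norm : elementary (fun x => (euclidean_norm x)^-1)
| elem_add f g : elementary f -> elementary g -> elementary (fun x => f x + g x)
| elem_mul f g : elementary f -> elementary g -> elementary (fun x => f x * g x)
| elem_sin f : elementary f -> elementary (fun x => sin (f x))
| elem_cos f : elementary f -> elementary (fun x => cos (f x))
| elem_flat k f : elementary f -> elementary (fun x => flat k (f x)).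

Definition punctured : set R3 := [set x | 0 < euclidean_norm x].

Lemma norm_sqr_gt0 x : punctured x -> 0 < x.1.1 ^+ 2 + x.1.2 ^+ 2 + x.2 ^+ 2.
Proof.
rewrite /punctured/= /euclidean_norm => x0.
by rewrite ltNge; apply/negP => /ler0_sqrtr h; rewrite h ltxx in x0.
Qed.

Let nsq x : R := x.1.1 ^+ 2 + x.1.2 ^+ 2 + x.2 ^+ 2.

Let nsqE : nsq = (fun x => coord ord0 x ^+ 2 + coord (lift ord0 ord0) x ^+ 2
   + coord (lift ord0 (lift ord0 ord0)) x ^+ 2).
Proof. by []. Qed.

Let differentiable_nsq x : differentiable nsq x.
Proof.
have d i : differentiable (coord i ^+ 2) x.
  by apply: differentiableX; exact: differentiable_coord3.
rewrite nsqE; exact: differentiableD (differentiableD (d _) (d _)) (d _).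
Qed.

Let is_derive_nsq x i : is_derive x (basis3 i) nsq (2 * coord i x).
Proof.
rewrite nsqE.
have d j := @is_deriveX _ _ _ 2 _ _ _ (is_derive_coord j i x).
have h := @is_deriveD _ _ _ _ _ _ _ _ _
  (@is_deriveD _ _ _ _ _ _ _ _ _ (d ord0) (d (lift ord0 ord0))) (d (lift ord0 (lift ord0 ord0))).
apply: (is_derive_eq h); rewrite /GRing.scale/= !expr1.
by case: i {h d} => [[|[|[|//]]] hi]; rewrite /= ?mulr1 ?mulr0 ?addr0 ?add0r.
Qed.

Lemma is_derive_norm x i : punctured x ->
  is_derive x (basis3 i) euclidean_norm (coord i x / euclidean_norm x).
Proof.
move=> x0; have n0 := norm_sqr_gt0 x0.
have h := is_derive_comp1 (is_derive_nsq x i) (is_derive1_sqrt n0).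
apply: (is_derive_eq h); rewrite -/(euclidean_norm x).
by field; rewrite gt_eqF.
Qed.

Lemma is_derive_inv_norm x i : punctured x ->
  is_derive x (basis3 i) (fun x => (euclidean_norm x)^-1)
    (- (coord i x * (euclidean_norm x)^-1 ^+ 3)).
Proof.
move=> x0; have r0 : euclidean_norm x != 0 by rewrite gt_eqF.
have h := is_derive_comp1 (is_derive_norm i x0)
  (@is_deriveV R id (euclidean_norm x) 1 1 r0 (is_derive_id _ _)).
by apply: (is_derive_eq h); rewrite /GRing.scale/=; field.
Qed.

Lemma differentiable_comp1 (h : R -> R) f x dh : differentiable f x ->
  is_derive (f x) 1 h dh -> differentiable (h \o f) x.
Proof.
move=> df dh'; apply: differentiable_comp => //.
by apply/derivable1_diffP; exact: ex_derive.
Qed.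

Lemma elementary_differentiable f x : elementary f -> punctured x ->
  differentiable f x.
Proof.
move=> + x0; elim=> {f}.
- by move=> c; exact: differentiable_cst.
- by move=> i; exact: differentiable_coord3.
- apply: (@differentiable_comp1 Num.sqrt nsq _ _ _ (is_derive1_sqrt (norm_sqr_gt0 x0))).
  exact: differentiable_nsq.
- have r0 : euclidean_norm x != 0 by rewrite gt_eqF.
  apply: (@differentiable_comp1 (fun z => z^-1) euclidean_norm _ _ _
    (@is_deriveV R id (euclidean_norm x) 1 1 r0 (is_derive_id _ _))).
  apply: (@differentiable_comp1 Num.sqrt nsq _ _ _ (is_derive1_sqrt (norm_sqr_gt0 x0))).
  exact: differentiable_nsq.
- by move=> f g _ df _ dg; exact: differentiableD.
- by move=> f g _ df _ dg; exact: differentiableM.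
- by move=> f _ df; exact: (differentiable_comp1 df (is_derive_sin _)).
- by move=> f _ df; exact: (differentiable_comp1 df (is_derive_cos _)).
- by move=> k f _ df; exact: (differentiable_comp1 df (is_derive_flat k _)).
Qed.

Lemma elementary_partial f i : elementary f ->
  exists2 g, elementary g & forall x, punctured x -> is_derive x (basis3 i) f (g x).
Proof.
elim=> {f}.
- move=> c; exists (fun=> 0); first exact: elem_cst.
  by move=> x _; exact: is_derive_cst.
- move=> j; exists (fun=> (j == i)%:R); first exact: elem_cst.
  by move=> x _; exact: is_derive_coord.
- exists (fun x => coord i x * (euclidean_norm x)^-1).
    by apply: elem_mul; [exact: elem_coord|exact: elem_inv_norm].
  by move=> x x0; exact: is_derive_norm.
- exists (fun x => (-1) * (coord i x * ((euclidean_norm x)^-1 * ((euclidean_norm x)^-1 * (euclidean_norm x)^-1)))).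
    by do !apply: elem_mul; [exact: elem_cst|exact: elem_coord|exact: elem_inv_norm..].
  by move=> x x0; rewrite mulN1r; exact: is_derive_inv_norm.
- move=> f g _ [df ef fdf] _ [dg eg gdg]; exists (fun x => df x + dg x); first exact: elem_add.
  by move=> x x0; exact: (@is_deriveD _ _ _ _ _ _ _ _ _ (fdf x x0) (gdg x x0)).
- move=> f g ef' [df ef fdf] eg' [dg eg gdg].
  exists (fun x => f x * dg x + g x * df x); first by apply: elem_add; exact: elem_mul.
  by move=> x x0; exact: (@is_deriveM _ _ _ _ _ _ _ _ (fdf x x0) (gdg x x0)).
- move=> f ef' [df ef fdf]; exists (fun x => cos (f x) * df x).
    by apply: elem_mul => //; exact: elem_cos.
  by move=> x x0; exact: (is_derive_comp1 (fdf x x0) (is_derive_sin _)).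
- move=> f ef' [df ef fdf]; exists (fun x => (-1) * sin (f x) * df x).
    by apply: elem_mul => //; apply: elem_mul; [exact: elem_cst|exact: elem_sin].
  by move=> x x0; rewrite mulN1r; exact: (is_derive_comp1 (fdf x x0) (is_derive_cos _)).
- move=> k f ef' [df ef fdf].
  exists (fun x => (flat k.+2 (f x) + (-1) * (k%:R * flat k.+1 (f x))) * df x).
    apply: elem_mul => //; apply: elem_add; first exact: elem_flat.
    by apply: elem_mul; [exact: elem_cst|apply: elem_mul; [exact: elem_cst|exact: elem_flat]].
  by move=> x x0; rewrite mulN1r; exact: (is_derive_comp1 (fdf x x0) (is_derive_flat k _)).
Qed.

Lemma elementary_cont_on f : elementary f -> cont_on punctured f.
Proof.
by move=> ef x x0; apply: differentiable_continuous; exact: elementary_differentiable.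
Qed.

Lemma euclidean_norm_continuous : continuous (euclidean_norm : R3 -> R).
Proof.
move=> x; apply: (@continuous_comp _ _ _ nsq Num.sqrt); last exact: sqrt_continuous.
apply: differentiable_continuous.
exact: differentiable_nsq.
Qed.

Lemma punctured_open : open punctured.
Proof.
rewrite (_ : punctured = euclidean_norm @^-1` [set t | 0 < t])//.
apply: open_comp; last exact: open_gt.
by move=> x _; exact: euclidean_norm_continuous.
Qed.

(** The zero map is the differential of a function that is locally zero. *)
Lemma differentiable_near0 f x :
  (\near x, (cst 0 : R3 -> R) x = f x) -> differentiable f x.
Proof.
move=> fx; have f0 := nbhs_singleton fx.
have fs : \forall y \near (0 : R3), 0 = f (y + x).
  by move: fx; rewrite (near_shift 0 x) subr0.
have c0 : continuous (\0 : R3 -> R^o) by move=> y; exact: cst_continuous.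
have E : f \o shift x = cst (f x) + (\0 : {linear R3 -> R^o}) +o_ (0 : R3) id.
  apply/eqaddoP => e e0; near=> y.
  rewrite /= !fctE/= -f0 addr0 subr0.
  have <- : 0 = f (y + x) by near: y.
  by rewrite normr0 mulr_ge0// ltW.
by apply/diff_locallyP; rewrite (diff_unique c0 E).
Unshelve. all: by end_near. Qed.

Lemma near_eq_differentiable f g x :
  (\near x, f x = g x) -> differentiable f x -> differentiable g x.
Proof.
move=> fg df; have -> : g = f + (g - f) by rewrite addrC subrK.
apply: differentiableD => //; apply: differentiable_near0.
apply: filterS fg => y fgy.
by have -> : (g - f) y = g y - f y by []; rewrite fgy subrr.
Qed.

(** Each iterated partial derivative agrees with a member of the class away from
    the origin and vanishes on [U], which contains the origin. *)
Lemma elementary_smooth f (U : set R3) : elementary f -> open U ->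
  (forall x, U x -> f x = 0) -> punctured `|` U = setT -> smooth f.
Proof.
move=> ef oU f0 cover s x.
have : (exists2 g, elementary g & forall x, punctured x -> foldr partial f s x = g x)
    /\ (forall x, U x -> foldr partial f s x = 0).
  elim: s => [|i s [[g eg sg] s0]]/=; first by split => //; exists f.
  split.
  - have [dg edg gdg] := elementary_partial i eg.
    exists dg => // y y0; have [_ <-] := gdg y y0.
    apply: near_eq_derive; have : nbhs y punctured by apply: open_nbhs_nbhs; split=> //; exact: punctured_open.
    by apply: filterS => z /sg.
  - move=> y Uy; have h : \near y, (cst 0 : R3 -> R) y = foldr partial f s y.
      have : nbhs y U by exact: open_nbhs_nbhs.
      by apply: filterS => z /s0.
    by have [_ df0] := derive_near0 (basis3 i) h; exact: df0.
move=> [[g eg sg] s0].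
have : (punctured `|` U) x by rewrite cover.
case=> [x0|Ux].
- have nx : nbhs x punctured by apply: open_nbhs_nbhs; split=> //; exact: punctured_open.
  have : \near x, g x = foldr partial f s x by apply: filterS nx => z /sg.
  move=> h; have dg := elementary_differentiable eg x0.
  exact: near_eq_differentiable h dg.
- have : \near x, (cst 0 : R3 -> R) x = foldr partial f s x.
    have : nbhs x U by exact: open_nbhs_nbhs.
    by apply: filterS => z /s0.
  by move=> h; apply: near_eq_differentiable h _; exact: differentiable_cst.
Qed.

End SmoothRadial.

(** * Test functions as square-integrable functions *)

Section TestFunctionSpace.
Context {R : realType}.
Local Notation R3 := (R * R * R)%type.
Local Notation mR := (measurableTypeR R).
Local Notation mR3 := (mR * mR * mR)%type.
Local Notation mu := (@lebesgue3 R).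
Implicit Types (D : set R3) (f g : R3 -> R).

Lemma sum_ord3 (V : nmodType) (F : 'I_3 -> V) :
  \sum_(i < 3) F i = F ord0 + (F (lift ord0 ord0) + F (lift ord0 (lift ord0 ord0))).
Proof. by rewrite 3!big_ord_recl big_ord0 addr0. Qed.

Lemma foldr_partial_sub f g s : smooth f -> smooth g ->
  foldr partial (f - g) s = foldr partial f s - foldr partial g s.
Proof.
move=> sf sg; elim: s => //= i s ->; apply/funext => x.
rewrite /partial; apply: deriveB; apply: diff_derivable; [exact: sf|exact: sg].
Qed.

Lemma smooth_sub f g : smooth f -> smooth g -> smooth (f - g).
Proof.
by move=> sf sg s x; rewrite foldr_partial_sub//; apply: differentiableB.
Qed.

Lemma laplacian_sub f g : smooth f -> smooth g ->
  laplacian (f - g) = laplacian f - laplacian g.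
Proof.
move=> sf sg; apply/funext => x.
rewrite [RHS](_ : _ = laplacian f x - laplacian g x)// /laplacian -sumrB.
apply: eq_bigr => i _.
by rewrite -[partial i (partial i (f - g))]/(foldr partial (f - g) [:: i; i]) foldr_partial_sub.
Qed.

Lemma test_sub D f g : test_function D f -> test_function D g ->
  test_function D (f - g).
Proof.
move=> [sf cf fD] [sg cg gD].
have sub : closure [set x | (f - g) x != 0] `<=`
    closure [set x | f x != 0] `|` closure [set x | g x != 0].
  rewrite -closureU; apply: closure_subset => x /= fg.
  have [f0|] := eqVneq (f x) 0; last by left.
  right; apply: contra_neq fg => g0.
  by have -> : (f - g) x = f x - g x by []; rewrite f0 g0 subrr.
split; first exact: smooth_sub.
- by apply: (subclosed_compact _ (compactU cf cg) sub); exact: closed_closure.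
- by move=> x /sub [/fD|/gD].
Qed.

Lemma test_L2 D f : open D -> test_function D f -> L2 D f.
Proof.
move=> oD tf; have cf : cont_on D f := cont_on_test tf.
apply: (L2_of_integrable (open_measurable3 oD)).
- by apply: continuous_measurable3.
- exact: test_mul_integrable.
Qed.

Lemma test_laplacian_L2 D f : open D -> test_function D f -> L2 D (- laplacian f).
Proof.
move=> oD tf; have tddf i := test_partial i (test_partial i tf).
have mD := open_measurable3 oD.
have L i : L2 D (partial i (partial i f)) := test_L2 oD (tddf i).
pose p0 := partial ord0 (partial ord0 f).
pose p1 := partial (lift ord0 ord0) (partial (lift ord0 ord0) f).
pose p2 := partial (lift ord0 (lift ord0 ord0)) (partial (lift ord0 (lift ord0 ord0)) f).
have -> : - laplacian f = (-1) *: (p0 + (p1 + p2)).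
  rewrite scaleN1r; congr (- _); apply/funext => x.
  exact: sum_ord3.
apply: (L2_scale mD); apply: (L2_add mD); first exact: L.
by apply: (L2_add mD); exact: L.
Qed.

Lemma bounded_integrable D f (B : R) : measurable (D : set mR3) ->
  (mu D < +oo)%E -> measurable_fun (D : set mR3) (f : mR3 -> mR) ->
  (forall x, D x -> `|f x| <= B) -> mu.-integrable (D : set mR3) (EFin \o f).
Proof.
move=> mD fD mf fB; apply (@measurable_bounded_integrable _ mR3 R mu f D mD fD mf).
exists B; split; first exact: num_real.
by move=> b Bb x Dx /=; exact: le_trans (fB _ Dx) (ltW Bb).
Qed.

Lemma bounded_L2 D f (B : R) : measurable (D : set mR3) ->
  (mu D < +oo)%E -> measurable_fun (D : set mR3) (f : mR3 -> mR) ->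
  (forall x, D x -> `|f x| <= B) -> L2 D f.
Proof.
move=> mD fD mf fB; apply: L2_of_integrable => //.
apply: (@bounded_integrable _ _ (B * B)) => //; first exact: measurable_funM.
by move=> x Dx; rewrite normrM ler_pM// fB.
Qed.

(** Dominated convergence by a constant, on a domain of finite measure. *)
Lemma bounded_convergence0 D (h : nat -> R3 -> R) (B : R) :
  measurable (D : set mR3) -> (mu D < +oo)%E ->
  (forall n, measurable_fun (D : set mR3) (h n : mR3 -> mR)) ->
  (forall n x, D x -> `|h n x| <= B) ->
  (forall x, D x -> (fun n => h n x) @ \oo --> 0) ->
  (fun n => L2_ip D (h n) (h n)) @ \oo --> 0.
Proof.
move=> mD fD mh hB h0.
have [] := @dominated_convergence _ mR3 R mu D mD (fun n x => (h n x * h n x)%:E)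
  (cst 0%E) (cst (B * B)%:E).
- by move=> n; apply/measurable_EFinP; apply: measurable_funM; exact: mh.
- exact: measurable_cst.
- apply: aeW => x Dx; apply/(fine_cvgP _ 0); split; first by apply: nearW => n; rewrite fin_numE.
  by rewrite -[X in _ --> X](mulr0 0); apply: cvgM; exact: h0.
- apply: (@bounded_integrable D (cst (B * B)) `|B * B|) => //.
- apply: aeW => x n Dx /=; rewrite lee_fin normrM ler_pM//; exact: hB.
move=> _ _; rewrite integral0 => /fine_cvgP[_].
exact.
Qed.

Lemma L2_ip_sub_le D f g : measurable (D : set mR3) -> L2 D f -> L2 D g ->
  L2_ip D (f - g) (f - g) <= L2_ip D f f *+ 2 + L2_ip D g g *+ 2.
Proof.
move=> mD Lf Lg.
have LN : L2 D (- g) by rewrite -scaleN1r; exact: L2_scale.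
have s f1 g1 := ip_sqrB (H := L2 D) (@L2_add R D mD) (@L2_scale R D mD)
  (@L2_ipC R D) (@L2_ipD R D mD) (@L2_ipZ R D mD) (u := f1) (v := g1).
have e1 := s f g Lf Lg.
have e2 := s f ((-1) *: g) Lf (L2_scale mD (-1) Lg).
have := L2_ip_ge0 (L2_add mD Lf Lg).
have <- : f - (-1) *: g = f + g by rewrite scaleN1r opprK.
rewrite e2 e1 (L2_ipC D f (_ *: g)) (L2_ipZ mD (-1) Lg Lf).
rewrite (L2_ipZ mD (-1) Lg (L2_scale mD (-1) Lg)).
rewrite (L2_ipC D g (_ *: g)) (L2_ipZ mD (-1) Lg Lg) (L2_ipC D g f).
by lra.
Qed.

End TestFunctionSpace.

(** * The radial ground state of the annulus *)

Section GroundState.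
Context {R : realType}.
Local Notation R3 := (R * R * R)%type.
Local Notation mR := (measurableTypeR R).
Local Notation mR3 := (mR * mR * mR)%type.
Local Notation mu := (@lebesgue3 R).
Implicit Types (x : R3) (i : 'I_3).

Lemma sin_le_id (t : R) : 0 <= t -> sin t <= t.
Proof.
rewrite le_eqVlt => /predU1P[<-|t0]; first by rewrite sin0.
have [|c _] := @MVT R sin cos 0 t t0 (fun y _ => is_derive_sin y).
  by apply: continuous_subspaceT; exact: continuous_sin.
rewrite sin0 !subr0 => ->.
by have := cos_le1 c; nra.
Qed.

(** The sine is at most [pi * t] and, by symmetry, at most [pi * (1 - t)]; one
    of [t] and [1 - t] is at least one half, which costs the factor 2. *)
Lemma sin_pi_le (t : R) : 0 < t -> t < 1 -> sin (pi * t) <= 2 * pi * (t * (1 - t)).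
Proof.
move=> t0 t1; have p0 := pi_gt0 R.
have h1 : sin (pi * t) <= pi * t by apply: sin_le_id; nra.
have h2 : sin (pi * t) <= pi * (1 - t).
  have -> : sin (pi * t) = sin (pi * (1 - t)).
    by rewrite mulrBr mulr1 sinB sinpi cospi; ring.
  by apply: sin_le_id; nra.
have [t2|t2] := leP t (1 / 2).
  have : 0 <= pi * t * (1 - 2 * t) :> R.
    by apply: mulr_ge0; [apply: mulr_ge0; exact: ltW|lra].
  by move=> ?; apply: (le_trans h1); nra.
have : 0 <= pi * (1 - t) * (2 * t - 1) :> R.
  by apply: mulr_ge0; [apply: mulr_ge0|]; lra.
by move=> ?; apply: (le_trans h2); nra.
Qed.

Variable A : R.
Hypothesis A_gt0 : 0 < A.

Local Notation D := (annulus A).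
Local Notation r := (@euclidean_norm R).

Lemma annulus_open : open D.
Proof.
rewrite (_ : D = r @^-1` `]A / 2, 1 + A / 2[%classic).
  by apply: open_comp (interval_open _ _) => // x _; exact: euclidean_norm_continuous.
by apply/seteqP; split => x /=; rewrite in_itv.
Qed.

Lemma annulus_punctured : D `<=` @punctured R.
Proof. by move=> x /andP[h _]; rewrite /punctured/=; apply: lt_trans h; rewrite divr_gt0. Qed.

Lemma coord_le_norm i x : `|coord i x| <= r x.
Proof.
rewrite -sqrtr_sqr /euclidean_norm ler_sqrt; last by rewrite !addr_ge0 ?sqr_ge0.
have h1 := sqr_ge0 x.1.1; have h2 := sqr_ge0 x.1.2; have h3 := sqr_ge0 x.2.
by case: i => [[|[|[|//]]] hi]; rewrite /coord/=; lra.
Qed.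

Lemma norm_le_cube x b : r x <= b -> cube 0 b x.
Proof.
move=> xb; apply/cubeP; rewrite !subr0; split; apply: le_trans xb.
- exact: (coord_le_norm ord0).
- exact: (coord_le_norm (lift ord0 ord0)).
- exact: (coord_le_norm (lift ord0 (lift ord0 ord0))).
Qed.

Lemma annulus_finite : (mu (D : set mR3) < +oo)%E.
Proof.
have A0 := A_gt0; have b0 : 0 < 1 + A / 2 by lra.
apply: (@le_lt_trans _ _ (mu (cube 0 (1 + A / 2)))); last by rewrite lebesgue3_cube ?ltry.
apply: le_measure; rewrite ?inE; [exact: open_measurable3 annulus_open|exact: cube_measurable|].
by move=> x /andP[_ h]; apply: norm_le_cube; exact: ltW.
Qed.

Let sn x := sin (pi * (r x - A / 2)).
Let cs x := cos (pi * (r x - A / 2)).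
Let q x := (r x)^-1.

(** The function [sin (pi * (r - A / 2)) / r]. Its product with [r] solves [y''
    = - pi ^ 2 * y] and vanishes at the radii [A / 2] and [1 + A / 2] of the
    bounding spheres. *)
Definition ground_state x : R := sn x * q x.

(** [dground_state] and [ddground_state] are the partial derivatives of the
    first order and the unmixed ones of the second order, written out so that
    they are seen to be continuous. *)
Definition dground_state i x : R :=
  pi * cs x * coord i x * q x ^+ 2 - sn x * coord i x * q x ^+ 3.

Definition ddground_state i x : R :=
  - (pi ^+ 2 * sn x * coord i x ^+ 2 * q x ^+ 3) + pi * cs x * q x ^+ 2
  - 3 * pi * cs x * coord i x ^+ 2 * q x ^+ 4 - sn x * q x ^+ 3
  + 3 * sn x * coord i x ^+ 2 * q x ^+ 5.

Let elem_arg : elementary (fun x => pi * (r x - A / 2)).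
Proof.
by apply: elem_mul; [exact: elem_cst|apply: elem_add; [exact: elem_norm|exact: elem_cst]].
Qed.

Let elem_opp f : elementary f -> elementary (fun x => - f x : R).
Proof.
move=> ef; under eq_fun do rewrite -mulN1r.
by apply: elem_mul => //; exact: elem_cst.
Qed.

Let elem_exp f n : elementary f -> elementary (fun x => f x ^+ n : R).
Proof.
move=> ef; elim: n => [|n IH]; first by under eq_fun do rewrite expr0; exact: elem_cst.
by under eq_fun do rewrite exprS; exact: elem_mul.
Qed.

Let elem_sn : elementary sn. Proof. exact: elem_sin elem_arg. Qed.
Let elem_cs : elementary cs. Proof. exact: elem_cos elem_arg. Qed.
Let elem_q : elementary q. Proof. exact: elem_inv_norm. Qed.

Lemma ground_state_elementary : elementary ground_state.
Proof. exact: elem_mul. Qed.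

Lemma dground_state_elementary i : elementary (dground_state i).
Proof.
apply: elem_add; last apply: elem_opp.
  apply: elem_mul (elem_mul (elem_mul (elem_cst _) elem_cs) (elem_coord i)) _.
  exact: elem_exp.
apply: elem_mul (elem_mul elem_sn (elem_coord i)) _; exact: elem_exp.
Qed.

Lemma ddground_state_elementary i : elementary (ddground_state i).
Proof.
have ex : elementary (fun x => coord i x ^+ 2) by apply: elem_exp; exact: elem_coord.
have eq n : elementary (fun x => q x ^+ n) by exact: elem_exp.
have ec c : elementary (fun=> c : R) by exact: elem_cst.
apply: elem_add; last exact: elem_mul (elem_mul (elem_mul (ec 3) elem_sn) ex) (eq 5%N).
apply: elem_add; last by apply: elem_opp; exact: elem_mul elem_sn (eq 3%N).
apply: elem_add; last first.
  apply: elem_opp.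
  exact: elem_mul (elem_mul (elem_mul (elem_mul (ec 3) (ec pi)) elem_cs) ex) (eq 4%N).
apply: elem_add; last exact: elem_mul (elem_mul (ec pi) elem_cs) (eq 2%N).
apply: elem_opp.
exact: elem_mul (elem_mul (elem_mul (ec (pi ^+ 2)) elem_sn) ex) (eq 3%N).
Qed.

Section Derivatives.
Variables (x : R3) (i : 'I_3).
Hypothesis x0 : punctured x.

Let dr : is_derive x (basis3 i) (fun y => pi * (r y - A / 2)) (pi * (coord i x * q x)).
Proof.
have d := is_derive_norm i x0.
have h := @is_derive_comp1 R (fun t => pi * (t - A / 2)) r x (basis3 i) _ pi d.
apply: h.
have d1 := @is_deriveB _ _ _ id (cst (A / 2)) (r x) 1 _ _ (is_derive_id _ _) (is_derive_cst _ _ _).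
have h := @is_deriveZ _ _ _ (id - cst (A / 2)) pi (r x) 1 _ d1.
by apply: (is_derive_eq h); rewrite /GRing.scale/= subr0 mulr1.
Qed.

Let dsn : is_derive x (basis3 i) sn (cs x * (pi * (coord i x * q x))).
Proof. exact: (is_derive_comp1 dr (is_derive_sin _)). Qed.

Let dcs : is_derive x (basis3 i) cs (- sn x * (pi * (coord i x * q x))).
Proof. exact: (is_derive_comp1 dr (is_derive_cos _)). Qed.

Let dq : is_derive x (basis3 i) q (- (coord i x * q x ^+ 3)).
Proof. exact: is_derive_inv_norm. Qed.

Lemma is_derive_ground_state : is_derive x (basis3 i) ground_state (dground_state i x).
Proof.
have h := @is_deriveM _ _ _ _ _ _ _ _ dsn dq.
by apply: (is_derive_eq h); rewrite /dground_state /GRing.scale/=; ring.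
Qed.

Lemma is_derive_dground_state : is_derive x (basis3 i) (dground_state i) (ddground_state i x).
Proof.
have dx := is_derive_coord i i x; rewrite eqxx in dx.
have dpcs : is_derive x (basis3 i) (fun y => pi * cs y)
    (pi * (- sn x * (pi * (coord i x * q x)))).
  exact: (@is_deriveZ _ _ _ cs pi _ _ _ dcs).
have d1 := @is_deriveM _ _ _ _ _ _ _ _
  (@is_deriveM _ _ _ _ _ _ _ _ dpcs dx)
  (@is_deriveX _ _ _ 2 _ _ _ dq).
have d2 := @is_deriveM _ _ _ _ _ _ _ _
  (@is_deriveM _ _ _ _ _ _ _ _ dsn dx) (@is_deriveX _ _ _ 3 _ _ _ dq).
have h := @is_deriveB _ _ _ _ _ _ _ _ _ d1 d2.
apply: (is_derive_eq h).
by rewrite /ddground_state /GRing.scale/= !fctE/=; ring.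
Qed.

End Derivatives.

(** Summing over the three coordinates replaces [coord i x ^+ 2] by [r ^+ 2].
    The cosine terms cancel because the dimension is three. *)
Lemma ground_state_eigen x : punctured x -> \sum_(i < 3) ddground_state i x = - (pi ^+ 2 * ground_state x).
Proof.
move=> x0; have r0 : r x != 0 by rewrite gt_eqF.
have S := sum_coord_sqr x; rewrite sum_ord3 in S.
rewrite sum_ord3 /ddground_state /ground_state /q.
move: S; set x1 := coord _ x; set x2 := coord _ x; set x3 := coord _ x => S.
have E : x3 ^+ 2 = r x ^+ 2 - x1 ^+ 2 - x2 ^+ 2 by rewrite -S; ring.
rewrite E; by field.
Qed.

Lemma ground_state_gt0 x : D x -> 0 < ground_state x.
Proof.
move=> /andP[h1 h2]; have p0 := pi_gt0 R.
have A0 := A_gt0; have rx : 0 < r x by lra.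
rewrite /ground_state /sn /q mulr_gt0 ?invr_gt0//.
by apply: sin_gt0_pi; apply/andP; split; nra.
Qed.

Lemma ground_state_cont_on : cont_on D ground_state.
Proof. by move=> x /annulus_punctured; exact: elementary_cont_on ground_state_elementary _. Qed.

Lemma dground_state_cont_on i : cont_on D (dground_state i).
Proof. by move=> x /annulus_punctured; exact: elementary_cont_on (dground_state_elementary i) _. Qed.

Lemma ddground_state_cont_on i : cont_on D (ddground_state i).
Proof. by move=> x /annulus_punctured; exact: elementary_cont_on (ddground_state_elementary i) _. Qed.

Lemma ground_state_le x : D x -> ground_state x <= 2 / A.
Proof.
move=> /andP[h1 h2]; have A0 := A_gt0; have rx : 0 < r x by lra.
rewrite /ground_state /q; apply: (@le_trans _ _ (1 * (r x)^-1)).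
  by rewrite ler_wpM2r ?invr_ge0 ?sin_le1// ltW.
rewrite mul1r -[leRHS]invrK invf_div lef_pV2 ?posrE//; last by rewrite divr_gt0.
exact: ltW.
Qed.

Lemma ground_state_L2 : L2 D ground_state.
Proof.
apply: (@bounded_L2 _ _ _ (2 / A)).
- exact: open_measurable3 annulus_open.
- exact: annulus_finite.
- exact: continuous_measurable3 annulus_open ground_state_cont_on.
- by move=> x Dx; rewrite ger0_norm ?ground_state_le// ltW// ground_state_gt0.
Qed.

End GroundState.

(** * The ground state belongs to the form domain *)

Section Approximation.
Context {R : realType}.
Local Notation R3 := (R * R * R)%type.
Local Notation mR := (measurableTypeR R).
Local Notation mR3 := (mR * mR * mR)%type.
Local Notation mu := (@lebesgue3 R).
Implicit Types (x : R3) (i : 'I_3) (n : nat).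

Variable A : R.
Hypothesis A_gt0 : 0 < A.

Local Notation D := (annulus A).
Local Notation r := (@euclidean_norm R).
Local Notation a := (A / 2).
Local Notation b := (1 + A / 2).
Local Notation gs := (ground_state A).
Local Notation dgs := (dground_state A).

(** Positive exactly on the annulus and comparable to the distance to its
    boundary; unlike that distance it is a polynomial in the coordinates. *)
Definition boundary_defining x : R := (r x ^+ 2 - a ^+ 2) * (b ^+ 2 - r x ^+ 2).

Let ddef i x : R := 2 * coord i x * (a ^+ 2 + b ^+ 2 - 2 * r x ^+ 2).

Lemma boundary_defining_gt0 x : (0 < boundary_defining x) <-> D x.
Proof.
have A0 := A_gt0; have r0 : 0 <= r x by exact: sqrtr_ge0.
have E : boundary_defining x = ((r x + a) * (b + r x)) * ((r x - a) * (b - r x)).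
  by rewrite /boundary_defining; ring.
have p : 0 < (r x + a) * (b + r x) by apply: mulr_gt0; lra.
rewrite E pmulr_rgt0//; split=> [h|/andP[h1 h2]].
- apply/andP; have [ra|ra] := ltP a (r x).
    split=> //; have : 0 < r x - a by lra.
    by move=> h'; move: h; rewrite pmulr_rgt0//; lra.
  by exfalso; move: h; apply/negP; rewrite -leNgt; apply: mulr_le0_ge0; lra.
- by apply: mulr_gt0; lra.
Qed.

Lemma boundary_defining_continuous : continuous boundary_defining.
Proof.
have c2 : cont_on setT (fun x => r x ^+ 2).
  by apply: cont_onM => x _; exact: euclidean_norm_continuous.
move=> x; apply: (@cont_onM R setT (fun x => r x ^+ 2 - a ^+ 2)) => //.
- by apply: cont_onB => //; exact: cont_on_cst.
- by apply: cont_onB => //; exact: cont_on_cst.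
Qed.

(** The ground state vanishes at the boundary to first order. *)
Lemma ground_state_le_boundary_defining x : D x -> gs x <= 2 * pi / (a ^+ 2 * b) * boundary_defining x.
Proof.
have A0 := A_gt0; have p0 := pi_gt0 R; move=> /andP[h1 h2].
have a0 : 0 < a by lra.
have b0 : 0 < b by lra.
have r0 : 0 < r x by lra.
set P := (r x - a) * (b - r x).
have P0 : 0 < P by apply: mulr_gt0; lra.
have s : sin (pi * (r x - a)) <= 2 * pi * P.
  by rewrite /P (_ : b - r x = 1 - (r x - a)); [apply: sin_pi_le; lra|ring].
apply: (@le_trans _ _ (2 * pi * P / a)).
  rewrite /gs; apply: (@le_trans _ _ (2 * pi * P * (r x)^-1)).
    by apply: ler_wpM2r => //; rewrite invr_ge0 ltW.
  apply: ler_wpM2l; first by apply: mulr_ge0; [lra|exact: ltW].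
  by rewrite lef_pV2 ?posrE//; lra.
rewrite -subr_ge0.
have -> : 2 * pi / (a ^+ 2 * b) * boundary_defining x - 2 * pi * P / a =
   2 * pi * P / (a ^+ 2 * b) * ((r x + a) * (b + r x) - a * b).
  rewrite /boundary_defining /P; field; apply/andP; split; lra.
apply: mulr_ge0; last by nra.
apply: ltW; apply: divr_gt0; first by apply: mulr_gt0 => //; lra.
by apply: mulr_gt0 => //; exact: exprn_gt0.
Qed.

Let arg n x : R := n.+1%:R * boundary_defining x - 1.

(** The shift by one in [arg] keeps the support in the set where
    [boundary_defining] is at least [1 / n.+1], hence away from the boundary;
    inside the annulus the cutoffs tend to one. *)
Definition cutoff n x : R := flat 0 (arg n x).
Let dcut n i x : R := flat 2 (arg n x) * (n.+1%:R * ddef i x).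

Let boundary_defining_elementary : elementary boundary_defining.
Proof.
have e2 : elementary (fun x => r x ^+ 2) := elem_mul elem_norm elem_norm.
apply: elem_mul.
- by apply: elem_add => //; exact: elem_cst.
- have -> : (fun x => b ^+ 2 - r x ^+ 2) = (fun x => b ^+ 2 + (-1) * r x ^+ 2).
    by apply/funext => x; ring.
  by apply: elem_add; [exact: elem_cst|apply: elem_mul => //; exact: elem_cst].
Qed.

Let arg_elementary n : elementary (arg n).
Proof.
by apply: elem_add (elem_cst _); apply: elem_mul (elem_cst _) _.
Qed.

Definition approx n x : R := cutoff n x * gs x.

Lemma approx_elementary n : elementary (approx n).
Proof. by apply: elem_mul; [apply: elem_flat; exact: arg_elementary|exact: ground_state_elementary]. Qed.

Lemma approx_test n : test_function D (approx n).
Proof.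
have A0 := A_gt0.
have out x : arg n x <= 0 -> approx n x = 0.
  by move=> h; rewrite /approx /cutoff flat_le0// mul0r.
have np : (0 : R) < n.+1%:R by rewrite ltr0n.
have sub : closure [set x | approx n x != 0] `<=` [set x | n.+1%:R^-1 <= boundary_defining x].
  have -> : [set x | n.+1%:R^-1 <= boundary_defining x] = closure [set x | n.+1%:R^-1 <= boundary_defining x].
    apply/closure_id; apply: (@closed_comp _ _ boundary_defining [set t | n.+1%:R^-1 <= t]).
      by move=> x _; exact: boundary_defining_continuous.
    exact: closed_ge.
  apply: closureS => x /= xn; apply: contraT; rewrite -ltNge => h.
  move: xn; rewrite out ?eqxx// /arg subr_le0.
  by rewrite -ler_pdivlMl// mulr1 ltW.
have inD x : n.+1%:R^-1 <= boundary_defining x -> D x.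
  by move=> h; apply/boundary_defining_gt0; apply: lt_le_trans h; rewrite invr_gt0.
split.
- apply: (@elementary_smooth R _ [set x | boundary_defining x < 0]).
  + exact: approx_elementary.
  + apply: (@open_comp _ _ boundary_defining [set t | t < 0]); last exact: open_lt.
    by move=> x _; exact: boundary_defining_continuous.
  + move=> x /= h; apply: out; rewrite /arg.
    have : n.+1%:R * boundary_defining x < 0 by rewrite pmulr_rlt0.
    by lra.
  + apply/seteqP; split => // x _.
    have [x0|x0] := ltP 0 (r x); [by left|right => /=].
    have r0 : r x = 0 by apply/eqP; rewrite eq_le x0 sqrtr_ge0.
    rewrite /boundary_defining r0 expr0n/= sub0r subr0 mulNr oppr_lt0.
    by apply: mulr_gt0; apply: exprn_gt0; lra.
- apply: (@subclosed_compact _ _ (cube 0 b)) (@closed_closure _ _) (@cube_compact R 0 b) _.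
  by move=> x /sub /inD /andP[_ h]; apply: norm_le_cube; exact: ltW.
- by move=> x /sub /inD.
Qed.

Let is_derive_boundary_defining x i : punctured x -> is_derive x (basis3 i) boundary_defining (ddef i x).
Proof.
move=> x0; have r0 : r x != 0 by rewrite gt_eqF.
have dr := is_derive_norm i x0.
have d2 := @is_deriveX _ _ r 2 x _ _ dr.
have h1 := @is_deriveB _ _ _ (r ^+ 2) (cst (a ^+ 2)) x _ _ _ d2 (is_derive_cst _ _ _).
have h2 := @is_deriveB _ _ _ (cst (b ^+ 2)) (r ^+ 2) x _ _ _ (is_derive_cst _ _ _) d2.
have h := @is_deriveM _ _ _ _ x _ _ _ h1 h2.
apply: (is_derive_eq h).
by rewrite /ddef /GRing.scale/= !fctE/=; field.
Qed.

Let is_derive_cutoff n x i : punctured x ->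
  is_derive x (basis3 i) (cutoff n) (dcut n i x).
Proof.
move=> x0; have d := is_derive_boundary_defining i x0.
have dm : is_derive x (basis3 i) (fun y => n.+1%:R * boundary_defining y) (n.+1%:R * ddef i x).
  exact: (@is_deriveZ _ _ _ boundary_defining n.+1%:R x _ _ d).
have d1 := @is_deriveB R R3 R _ (cst (1 : R)) x _ _ _ dm (is_derive_cst _ _ _).
have h := is_derive_comp1 d1 (is_derive_flat 0 _).
by apply: (is_derive_eq h); rewrite mul0r !subr0.
Qed.

(** The left-hand side is the quantity whose square enters [jacobi_identity]:
    the derivatives of the ground state cancel, and only the gradient of the
    cutoff is left. *)
Lemma partial_approx n x i : D x ->
  partial i (approx n) x - approx n x * (dgs i x / gs x) = gs x * dcut n i x.
Proof.
move=> Dx; have x0 := annulus_punctured A_gt0 Dx.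
have g0 : gs x != 0 by rewrite gt_eqF// ground_state_gt0.
have h := @is_deriveM _ _ _ _ x _ _ _ (is_derive_cutoff n i x0) (is_derive_ground_state A i x0).
have -> : partial i (approx n) x = cutoff n x *: dgs i x + gs x *: dcut n i x.
  by have [_ <-] := h.
by rewrite /approx /GRing.scale/=; field.
Qed.

Lemma cutoff_le1 n x : 0 <= cutoff n x <= 1.
Proof. by rewrite flat_ge0/=; have := flat_le 0 (arg n x); rewrite fact0. Qed.

(* The constant of [ground_state_le_boundary_defining] times a bound for the
   gradient of [boundary_defining]. *)
Let C := 2 * pi / (a ^+ 2 * b) * (8 * b ^+ 3).

Let C_ge0 : 0 <= C.
Proof.
have A0 := A_gt0; have p0 := pi_gt0 R.
rewrite /C; apply: mulr_ge0; last by apply: mulr_ge0 => //; apply: exprn_ge0; lra.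
by apply: divr_ge0; [lra|apply: mulr_ge0; [exact: sqr_ge0|lra]].
Qed.

(** The factor [n.+1] produced by differentiating the cutoff is absorbed by the
    ground state, which is at most a multiple of [boundary_defining]: indeed
    [n.+1 * boundary_defining = arg n + 1], and
    [(1 + y) * flat 2 y = flat 2 y + flat 1 y]. *)
Let grad_bound n i x : D x ->
  `|gs x * dcut n i x| <= C * (flat 1 (arg n x) + flat 2 (arg n x)).
Proof.
move=> Dx; have A0 := A_gt0; have p0 := pi_gt0 R.
have g0 := ground_state_gt0 A_gt0 Dx; have gle := ground_state_le_boundary_defining Dx.
have /andP[h1 h2] := Dx.
have dd : `|ddef i x| <= 8 * b ^+ 3.
  rewrite /ddef !normrM ger0_norm; last lra.
  have cb : `|coord i x| <= b by apply: le_trans (coord_le_norm i x) _; exact: ltW.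
  have : `|a ^+ 2 + b ^+ 2 - 2 * r x ^+ 2| <= 4 * b ^+ 2.
    by rewrite ler_norml; apply/andP; split; nra.
  move=> h; rewrite (_ : 8 * b ^+ 3 = 2 * b * (4 * b ^+ 2)); last ring.
  by apply: ler_pM => //; lra.
have f2 := flat_ge0 2 (arg n x).
rewrite normrM (ger0_norm (ltW g0)) /dcut normrM (ger0_norm f2) normrM (@ger0_norm _ n.+1%:R)//.
have S0 : 0 < boundary_defining x by apply/boundary_defining_gt0.
set c := 2 * pi / (a ^+ 2 * b) in gle *.
have c0 : 0 <= c.
  by apply: divr_ge0; [lra|apply: mulr_ge0; [exact: sqr_ge0|lra]].
have -> : flat 1 (arg n x) + flat 2 (arg n x) = flat 2 (arg n x) * (n.+1%:R * boundary_defining x).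
  have -> : n.+1%:R * boundary_defining x = arg n x + 1 by rewrite subrK.
  by rewrite [flat 1 _]flatS; ring.
rewrite /C -/c (_ : c * (8 * b ^+ 3) * _ =
  (c * boundary_defining x) * (flat 2 (arg n x) * (n.+1%:R * (8 * b ^+ 3)))); last ring.
apply: ler_pM => //; [exact: ltW|by rewrite !mulr_ge0|].
by apply: ler_wpM2l => //; apply: ler_wpM2l.
Qed.

(* Eventually [n.+1 * boundary_defining x >= 2], so that [arg n x] is at least
   half of [n.+1 * boundary_defining x]. *)
Let arg_inv_bound x : D x -> \forall n \near \oo,
  0 < arg n x /\ (arg n x)^-1 <= 2 / boundary_defining x * n.+1%:R^-1.
Proof.
move=> Dx; have S0 : 0 < boundary_defining x by apply/boundary_defining_gt0.
near=> n; have np : (0 : R) < n.+1%:R by rewrite ltr0n.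
have h : 2 <= n.+1%:R * boundary_defining x.
  rewrite -ler_pdivrMr//; apply: (@le_trans _ _ n%:R); last by rewrite ler_nat.
  by near: n; exact: nbhs_infty_ger.
have ge : n.+1%:R * boundary_defining x / 2 <= arg n x by rewrite /arg; lra.
have gp : 0 < n.+1%:R * boundary_defining x / 2 by lra.
split; first exact: lt_le_trans ge.
rewrite (_ : 2 / boundary_defining x * n.+1%:R^-1 = (n.+1%:R * boundary_defining x / 2)^-1).
  by rewrite lef_pV2 ?posrE//; exact: lt_le_trans ge.
by field; rewrite !gt_eqF.
Unshelve. all: by end_near. Qed.

Let small_cvg x (c : R) (u : nat -> R) : D x -> 0 <= c ->
  (\forall n \near \oo, `|u n| <= c * (2 / boundary_defining x * n.+1%:R^-1)) ->
  u @ \oo --> 0.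
Proof.
move=> Dx c0 hu; apply/norm_cvg0P.
apply: (@squeeze_cvgr _ _ _ _ (cst 0) (fun n => c * (2 / boundary_defining x * n.+1%:R^-1))).
- by apply: filterS hu => n hn; rewrite normr_ge0.
- exact: cvg_cst.
- rewrite -[X in _ --> X](mulr0 c) -[X in _ --> c * X](mulr0 (2 / boundary_defining x)).
  by apply: cvgMr; apply: cvgMr; exact: cvg_harmonic.
Qed.

Let flatS_cvg k x : D x -> (fun n => flat k.+1 (arg n x)) @ \oo --> 0.
Proof.
move=> Dx; apply: (@small_cvg x k`!%:R) => //.
near=> n.
have [a0 ai] : 0 < arg n x /\ (arg n x)^-1 <= 2 / boundary_defining x * n.+1%:R^-1.
  by near: n; exact: arg_inv_bound.
rewrite ger0_norm ?flat_ge0//.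
have -> : flat k.+1 (arg n x) = flat k (arg n x) * (arg n x)^-1.
  by rewrite [flat k _]flatS mulrC mulKf// gt_eqF.
by apply: ler_pM => //; rewrite ?flat_ge0 ?flat_le ?invr_ge0 ?ltW.
Unshelve. all: by end_near. Qed.

Let cutoff_cvg x : D x -> (fun n => cutoff n x - 1) @ \oo --> 0.
Proof.
move=> Dx; apply: (@small_cvg x 1) => //.
near=> n; rewrite mul1r.
have [a0 ai] : 0 < arg n x /\ (arg n x)^-1 <= 2 / boundary_defining x * n.+1%:R^-1.
  by near: n; exact: arg_inv_bound.
apply: le_trans ai; have /andP[c0 c1] := cutoff_le1 n x.
rewrite ler0_norm ?opprB; last lra.
rewrite /cutoff /flat a0 expr0 mul1r.
by have := expR_ge1Dx (- (arg n x)^-1); lra.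
Unshelve. all: by end_near. Qed.

Let mD : measurable (D : set mR3) := open_measurable3 (@annulus_open R A).

Let elem_measurable f : elementary f -> measurable_fun (D : set mR3) (f : mR3 -> mR).
Proof.
move=> ef; apply: continuous_measurable3 (@annulus_open R A) _.
by move=> x /(annulus_punctured A_gt0); exact: elementary_cont_on ef _.
Qed.

Let ddef_elementary i : elementary (ddef i).
Proof.
have e2 : elementary (fun x => r x ^+ 2) := elem_mul elem_norm elem_norm.
rewrite (_ : ddef i = fun x => 2 * coord i x * ((a ^+ 2 + b ^+ 2) + (-2) * r x ^+ 2)); last first.
  by apply/funext => x; rewrite /ddef mulNr.
apply: elem_mul; first by apply: elem_mul; [exact: elem_cst|exact: elem_coord].
by apply: elem_add; [exact: elem_cst|apply: elem_mul => //; exact: elem_cst].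
Qed.

Let hcut n i x : R := gs x * dcut n i x.

Let hcut_measurable n i : measurable_fun (D : set mR3) (hcut n i : mR3 -> mR).
Proof.
apply: elem_measurable; apply: elem_mul (ground_state_elementary A) _.
apply: elem_mul; first by apply: elem_flat; exact: arg_elementary.
by apply: elem_mul; [exact: elem_cst|exact: ddef_elementary].
Qed.

Let hcut_le n i x : D x -> `|hcut n i x| <= C * 3.
Proof.
move=> Dx; apply: le_trans (grad_bound n i Dx) _; apply: ler_wpM2l => //.
have := flat_le 1 (arg n x); have := flat_le 2 (arg n x).
by rewrite (_ : 2`! = 2)%N// (_ : 1`! = 1)%N//; lra.
Qed.

Let hcut_L2 n i : L2 D (hcut n i).
Proof. exact: bounded_L2 mD (annulus_finite A_gt0) (hcut_measurable n i) (@hcut_le n i). Qed.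

Let hcut_cvg i : (fun n => L2_ip D (hcut n i) (hcut n i)) @ \oo --> 0.
Proof.
apply: (bounded_convergence0 mD (annulus_finite A_gt0)
  (fun n => hcut_measurable n i) (fun n => @hcut_le n i)).
move=> x Dx; apply/norm_cvg0P.
apply: (@squeeze_cvgr _ _ _ _ (cst 0) (fun n => C * (flat 1 (arg n x) + flat 2 (arg n x)))).
- by apply: nearW => n; rewrite normr_ge0 grad_bound.
- exact: cvg_cst.
- rewrite -[X in _ --> X](mulr0 C) -[X in _ --> C * X](addr0 0).
  by apply: cvgMr; apply: cvgD; exact: flatS_cvg.
Qed.

Lemma approx_cvg : (fun n => L2_ip D (approx n - gs) (approx n - gs)) @ \oo --> 0.
Proof.
have E n x : (approx n - gs) x = (cutoff n x - 1) * gs x.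
  by rewrite (_ : (approx n - gs) x = cutoff n x * gs x - gs x)//; ring.
apply: (@bounded_convergence0 R D (fun n => approx n - gs) (2 / A) mD (annulus_finite A_gt0)).
- move=> n; apply: measurable_funB; apply: elem_measurable; [exact: approx_elementary|exact: ground_state_elementary].
- move=> n x Dx; rewrite E normrM; have /andP[c0 c1] := cutoff_le1 n x.
  rewrite (ger0_norm (ltW (ground_state_gt0 A_gt0 Dx))) -[leRHS]mul1r.
  apply: ler_pM (ground_state_le A_gt0 Dx) => //; first exact: ltW (ground_state_gt0 A_gt0 Dx).
  by rewrite ler_norml; apply/andP; split; lra.
- move=> x Dx.
  have -> : (fun n => (approx n - gs) x) = (fun n => (cutoff n x - 1) * gs x).
    by apply/funext => n; exact: E.
  rewrite -[X in _ --> X](mul0r (gs x)); apply: cvgM; last exact: cvg_cst.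
  exact: cutoff_cvg.
Qed.

(** By [jacobi_identity], the energy of [approx m - approx n] is [pi ^+ 2] times
    its [L2]-square plus the [L2]-squares of [hcut m i - hcut n i]. Both
    [approx n - gs] and [hcut n i] are uniformly bounded and tend to zero
    pointwise, hence in [L2]. *)
Lemma ground_state_form_domain : form_domain (L2 D) (L2_ip D) (minimal_laplace D) gs.
Proof.
have oD := @annulus_open R A.
split; first exact: ground_state_L2.
exists approx, (fun n => - laplacian (approx n)); split.
- by move=> n; split => //; exact: approx_test.
- exact: approx_cvg.
pose K n := pi ^+ 2 * (L2_ip D (approx n - gs) (approx n - gs) *+ 2)
  + \sum_(i < 3) L2_ip D (hcut n i) (hcut n i) *+ 2.
have K0 : K @ \oo --> 0.
  pose Hn n i := L2_ip D (hcut n i) (hcut n i).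
  have -> : K = fun n => pi ^+ 2 * (L2_ip D (approx n - gs) (approx n - gs) *+ 2)
      + (Hn n ord0 *+ 2 + (Hn n (lift ord0 ord0) *+ 2
         + Hn n (lift ord0 (lift ord0 ord0)) *+ 2)).
    by apply/funext => n; rewrite /K sum_ord3.
  rewrite [X in _ --> X](_ : _ = pi ^+ 2 * (0 *+ 2) + (0 *+ 2 + (0 *+ 2 + 0 *+ 2))); last first.
    by rewrite !mul0rn mulr0 !addr0.
  apply: cvgD; first by apply: cvgMr; apply: cvgMn; exact: approx_cvg.
  by apply: cvgD; [|apply: cvgD]; apply: cvgMn; exact: hcut_cvg.
have bound m n : L2_ip D (- laplacian (approx m) - - laplacian (approx n)) (approx m - approx n)
    <= K m + K n.
  have sm := test_smooth (approx_test m); have sn := test_smooth (approx_test n).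
  have tV := test_sub (approx_test m) (approx_test n).
  have -> : - laplacian (approx m) - - laplacian (approx n) = - laplacian (approx m - approx n).
    by rewrite laplacian_sub// opprB opprK addrC.
  have J := @jacobi_identity R D oD gs dgs (ddground_state A) (pi ^+ 2)
    (fun i x Dx => is_derive_ground_state A i (annulus_punctured A_gt0 Dx))
    (fun i x Dx => is_derive_dground_state A i (annulus_punctured A_gt0 Dx))
    (ground_state_cont_on A_gt0) (dground_state_cont_on A_gt0) (ddground_state_cont_on A_gt0)
    (@ground_state_gt0 R A A_gt0) (fun x Dx => ground_state_eigen A (annulus_punctured A_gt0 Dx)) _ tV.
  rewrite -[X in X <= _](subrK (pi ^+ 2 * L2_ip D (approx m - approx n) (approx m - approx n))) J.
  have Lv k : L2 D (approx k - gs).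
    have -> : approx k - gs = approx k + (-1) *: gs by rewrite scaleN1r.
    apply: (L2_add mD); first exact: test_L2 oD (approx_test k).
    by apply: (L2_scale mD); exact: ground_state_L2.
  have e1 := L2_ip_sub_le mD (Lv m) (Lv n).
  have EV : (approx m - gs) - (approx n - gs) = approx m - approx n.
    by rewrite opprB addrA subrK.
  rewrite EV in e1.
  have e2 i : \int[mu]_(x in D) (partial i (approx m - approx n) x
        - (approx m - approx n) x * (dgs i x / gs x)) ^+ 2
      <= L2_ip D (hcut m i) (hcut m i) *+ 2 + L2_ip D (hcut n i) (hcut n i) *+ 2.
    apply: le_trans (L2_ip_sub_le mD (hcut_L2 m i) (hcut_L2 n i)).
    rewrite le_eqVlt; apply/orP; left; apply/eqP; apply: eq_Rintegral => x /set_mem Dx.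
    rewrite -expr2; congr (_ ^+ 2).
    have -> : (hcut m i - hcut n i) x = gs x * dcut m i x - gs x * dcut n i x by [].
    rewrite -!partial_approx//.
    have -> : partial i (approx m - approx n) x = partial i (approx m) x - partial i (approx n) x.
      rewrite /partial; apply: deriveB; apply: diff_derivable; [exact: (sm [::])|exact: (sn [::])].
    by rewrite (_ : (approx m - approx n) x = approx m x - approx n x)//; ring.
  rewrite /K addrACA -mulrDr -big_split/= addrC.
  apply: lerD; first by apply: ler_sum => i _; exact: e2.
  by apply: ler_wpM2l => //; exact: sqr_ge0.
move=> e e0.
have : \forall n \near \oo, K n < e / 2.
  by apply: (cvgr_lt _ K0); lra.
move=> [N _ hN]; exists N => m n Nm Nn.
apply: le_lt_trans (bound m n) _.
by have := hN m Nm; have := hN n Nn; rewrite /=; lra.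
Qed.

End Approximation.

(** * Integrals over boxes and their marginals *)

Section ProductSets.
Local Open Scope ereal_scope.
Context d1 d2 (T1 : measurableType d1) (T2 : measurableType d2) (R : realType).
Variable m1 : {sigma_finite_measure set T1 -> \bar R}.
Variable m2 : {sigma_finite_measure set T2 -> \bar R}.
Variables (P : set T1) (Q : set T2) (f : (T1 * T2)%type -> \bar R).
Hypotheses (mP : measurable P) (mQ : measurable Q).
Hypotheses (mf : measurable_fun setT f) (f0 : forall x, 0 <= f x).

Let mPQ : measurable (P `*` Q) := measurableX mP mQ.

Let mfPQ : measurable_fun setT (f \_ (P `*` Q)).
Proof. by apply/(measurable_restrictT _ mPQ); exact: measurable_funTS. Qed.

Let fPQ0 x : 0 <= (f \_ (P `*` Q)) x.
Proof. by rewrite patchE; case: ifP. Qed.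

Lemma tonelli_set12 :
  \int[m1 \x m2]_(x in P `*` Q) f x = \int[m1]_(x in P) \int[m2]_(y in Q) f (x, y).
Proof.
rewrite integral_mkcond fubini_tonelli1// [RHS]integral_mkcond.
apply: eq_integral => x _; rewrite /fubini_F [RHS]patchE.
case: ifPn => Px.
  rewrite [RHS]integral_mkcond; apply: eq_integral => y _.
  by rewrite !patchE in_setX/= Px.
by apply: integral0_eq => y _; rewrite patchE in_setX/= (negbTE Px).
Qed.

Lemma tonelli_set21 :
  \int[m1 \x m2]_(x in P `*` Q) f x = \int[m2]_(y in Q) \int[m1]_(x in P) f (x, y).
Proof.
rewrite integral_mkcond fubini_tonelli2// [RHS]integral_mkcond.
apply: eq_integral => y _; rewrite /fubini_G [RHS]patchE.
case: ifPn => Qy.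
  rewrite [RHS]integral_mkcond; apply: eq_integral => x _.
  by rewrite !patchE in_setX/= Qy andbT.
by apply: integral0_eq => x _; rewrite patchE in_setX/= (negbTE Qy) andbF.
Qed.

Lemma measurable_section_integral :
  measurable_fun setT (fun x => \int[m2]_(y in Q) f (x, y)).
Proof.
have mTQ : measurable ([set: T1] `*` Q) by exact: measurableX.
have -> : (fun x => \int[m2]_(y in Q) f (x, y)) = fubini_F m2 (f \_ ([set: T1] `*` Q)).
  apply/funext => x; rewrite integral_mkcond; apply: eq_integral => y _.
  by rewrite !patchE in_setX/= in_setT.
apply: measurable_fun_fubini_tonelli_F => [|x]; last by rewrite patchE; case: ifP.
by apply/(measurable_restrictT _ mTQ); exact: measurable_funTS.
Qed.

End ProductSets.

Section ProductSetsMarginals.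
Local Open Scope ereal_scope.
Context d1 d2 (T1 : measurableType d1) (T2 : measurableType d2) (R : realType).
Variable m1 : {sigma_finite_measure set T1 -> \bar R}.
Variable m2 : {sigma_finite_measure set T2 -> \bar R}.
Variables (P : set T1) (Q : set T2).
Hypotheses (mP : measurable P) (mQ : measurable Q).

Lemma integral_setX_fst (k : T1 -> \bar R) :
  measurable_fun setT k -> (forall x, 0 <= k x) ->
  \int[m1 \x m2]_(x in P `*` Q) k x.1 = m2 Q * \int[m1]_(x in P) k x.
Proof.
move=> mk k0; rewrite (tonelli_set12 m1 m2 mP mQ (f := fun x => k x.1))//; last first.
  by apply: measurableT_comp mk _; exact: measurable_fst.
rewrite -ge0_integralZl//; last exact: measurable_funTS.
by apply: eq_integral => x _; rewrite [RHS]muleC; exact: (integral_cst m2 mQ (k x)).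
Qed.

Lemma integral_setX_snd (k : T2 -> \bar R) :
  measurable_fun setT k -> (forall x, 0 <= k x) ->
  \int[m1 \x m2]_(x in P `*` Q) k x.2 = m1 P * \int[m2]_(x in Q) k x.
Proof.
move=> mk k0; rewrite (tonelli_set21 m1 m2 mP mQ (f := fun x => k x.2))//; last first.
  by apply: measurableT_comp mk _; exact: measurable_snd.
rewrite -ge0_integralZl//; last exact: measurable_funTS.
by apply: eq_integral => x _; rewrite [RHS]muleC; exact: (integral_cst m1 mP (k x)).
Qed.

End ProductSetsMarginals.

Section Poincare.
Context {R : realType}.
Local Notation R3 := (R * R * R)%type.
Local Notation mR := (measurableTypeR R).
Local Notation mR3 := (mR * mR * mR)%type.
Local Notation leb := (@lebesgue_measure R).
Local Notation mu := (@lebesgue3 R).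

(** In these lemmas [g] is first integrated over the full length of some axes,
    which makes it independent of those coordinates, and the outer integral over
    the box then contributes one factor [l] for each of them. *)
Section Marginals.
Local Open Scope ereal_scope.
Variables (I J K : set mR) (l : R).
Hypotheses (mI : measurable I) (mJ : measurable J) (mK : measurable K).
Hypotheses (lI : leb I = l%:E) (lJ : leb J = l%:E) (lK : leb K = l%:E).
Hypothesis l0 : (0 <= l)%R.
Local Notation Q := ((I `*` J) `*` K).
Let mIJ : measurable (I `*` J : set (mR * mR)) := measurableX mI mJ.

Let lIJ : lebesgue2 (I `*` J) = (l * l)%:E.
Proof. by rewrite [LHS](product_measure1E leb leb mI mJ) EFinM -{1}lI -lJ. Qed.

Variable g : mR3 -> \bar R.
Hypotheses (mg : measurable_fun setT g) (g0 : forall x, 0 <= g x).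

Let box_z : \int[mu]_(x in Q) g x = \int[leb]_(z in K) \int[lebesgue2]_(xy in I `*` J) g (xy, z).
Proof. exact (@tonelli_set21 _ _ _ _ R lebesgue2 leb _ _ g mIJ mK mg g0). Qed.

Let box_xy : \int[mu]_(x in Q) g x = \int[lebesgue2]_(xy in I `*` J) \int[leb]_(z in K) g (xy, z).
Proof. exact (@tonelli_set12 _ _ _ _ R lebesgue2 leb _ _ g mIJ mK mg g0). Qed.

Let swap23 : measurable_fun setT (fun x : mR3 => ((x.2, x.1.1), x.1.2) : mR3).
Proof.
apply: measurable_fun_pair; first apply: measurable_fun_pair.
- exact: measurable_snd.
- by apply: measurableT_comp => //; exact: measurable_fst.
- by apply: measurableT_comp.
Qed.

Let mI1 : measurable_fun setT (fun yz : mR * mR => \int[leb]_(u in I) g ((u, yz.1), yz.2)).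
Proof.
apply (@measurable_section_integral _ _ (mR * mR)%type mR R leb I
  (fun x => g ((x.2, x.1.1), x.1.2)) mI); last by [].
exact: measurableT_comp mg swap23.
Qed.

Let mJ2 t : measurable_fun setT (fun x : mR => \int[leb]_(u in J) g ((x, u), t)).
Proof.
apply (@measurable_section_integral _ _ mR mR R leb J (fun x => g (x, t)) mJ); last by [].
exact: measurable_fun_pair1.
Qed.

Let mK3 : measurable_fun setT (fun xy : mR * mR => \int[leb]_(u in K) g (xy, u)).
Proof. exact: measurable_section_integral. Qed.

Let mIJ3 : measurable_fun setT (fun z : mR => \int[lebesgue2]_(xy in I `*` J) g (xy, z)).
Proof.
apply (@measurable_section_integral _ _ mR (mR * mR)%type R lebesgue2 (I `*` J)
  (fun x => g (x.2, x.1)) mIJ); last by [].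
by apply: measurableT_comp mg _; apply: measurable_fun_pair; [exact: measurable_snd|exact: measurable_fst].
Qed.

Lemma marginal3 :
  \int[mu]_(y in Q) \int[leb]_(u in K) g (y.1, u) = l%:E * \int[mu]_(x in Q) g x.
Proof.
rewrite box_xy -lK.
apply (@integral_setX_fst _ _ _ _ R lebesgue2 leb _ _ mIJ mK
  (fun xy => \int[leb]_(u in K) g (xy, u))) => // xy; exact: integral_ge0.
Qed.

Lemma marginal2 t :
  \int[mu]_(y in Q) \int[leb]_(u in J) g ((y.1.1, u), t)
  = (l * l)%:E * \int[lebesgue2]_(xy in I `*` J) g (xy, t).
Proof.
have mgt : measurable_fun setT (fun xy : mR * mR => g (xy, t)) by exact: measurable_fun_pair1.
have k0 (x : mR) : 0 <= \int[leb]_(u in J) g ((x, u), t) by exact: integral_ge0.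
transitivity (leb K * \int[lebesgue2]_(xy in I `*` J) \int[leb]_(u in J) g ((xy.1, u), t)).
  apply (@integral_setX_fst _ _ _ _ R lebesgue2 leb _ _ mIJ mK
    (fun xy => \int[leb]_(u in J) g ((xy.1, u), t))) => //.
  by apply: measurableT_comp (mJ2 t) _; exact: measurable_fst.
rewrite lK EFinM -muleA; congr (_ * _).
rewrite [X in _ = _ * X](@tonelli_set12 _ _ _ _ R leb leb _ _ (fun xy => g (xy, t)) mI mJ mgt)//.
rewrite -lJ.
exact (@integral_setX_fst _ _ _ _ R leb leb _ _ mI mJ
  (fun x => \int[leb]_(u in J) g ((x, u), t)) (mJ2 t) k0).
Qed.

Lemma marginal2' :
  \int[mu]_(x in Q) \int[lebesgue2]_(xy in I `*` J) g (xy, x.2)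
  = (l * l)%:E * \int[mu]_(x in Q) g x.
Proof.
rewrite box_z -lIJ.
apply (@integral_setX_snd _ _ _ _ R lebesgue2 leb _ _ mIJ mK
  (fun z => \int[lebesgue2]_(xy in I `*` J) g (xy, z)) mIJ3) => z; exact: integral_ge0.
Qed.

Lemma marginal1 :
  \int[mu]_(x in Q) \int[leb]_(u in I) g ((u, x.1.2), x.2) = l%:E * \int[mu]_(x in Q) g x.
Proof.
have k0 (y z : mR) : 0 <= \int[leb]_(u in I) g ((u, y), z) by exact: integral_ge0.
transitivity (\int[leb]_(z in K) \int[lebesgue2]_(xy in I `*` J) \int[leb]_(u in I) g ((u, xy.2), z)).
  apply (@tonelli_set21 _ _ _ _ R lebesgue2 leb _ _
    (fun x : mR3 => \int[leb]_(u in I) g ((u, x.1.2), x.2)) mIJ mK) => //.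
  apply: (measurableT_comp mI1 (g := fun x : mR3 => (x.1.2, x.2))).
  apply: measurable_fun_pair; last exact: measurable_snd.
  by apply: measurableT_comp.
rewrite box_z -ge0_integralZl//; last 2 first.
- exact: measurable_funTS.
- by move=> z _; exact: integral_ge0.
apply: eq_integral => z _.
have mgz : measurable_fun setT (fun xy : mR * mR => g (xy, z)) by exact: measurable_fun_pair1.
rewrite [X in _ = _ * X](@tonelli_set21 _ _ _ _ R leb leb _ _ (fun xy => g (xy, z)) mI mJ mgz)//.
rewrite -lI.
apply (@integral_setX_snd _ _ _ _ R leb leb _ _ mI mJ
  (fun y => \int[leb]_(u in I) g ((u, y), z))) => //.
by apply: (measurableT_comp mI1 (g := fun y : mR => (y, z))); exact: pair2_measurable.
Qed.

End Marginals.

(** Integrating over the whole interval gives a bound that no longer depends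
    on [s] and [t]. *)
Lemma increment_le_integral (F dF : R -> R) (lo hi s t : R) :
  (forall u, u \in `[lo, hi] -> is_derive u (1 : R) F (dF u)) ->
  {within `[lo, hi], continuous dF} -> s \in `[lo, hi] -> t \in `[lo, hi] ->
  ((`|F s - F t|)%:E <= \int[leb]_(u in `[lo, hi]) (`|dF u|)%:E)%E.
Proof.
move=> FdF cdF.
wlog st : s t / s <= t.
  move=> W hs ht; have [st|/ltW ts] := leP s t; first exact: W.
  by rewrite distrC; exact: W.
move=> hs ht; move: st; rewrite le_eqVlt => /predU1P[->|st].
  by rewrite subrr normr0; apply: integral_ge0 => u _; rewrite lee_fin.
have sub : `[s, t] `<=` `[lo, hi].
  move: hs ht; rewrite !in_itv/= => /andP[h1 h2] /andP[h3 h4] u/=.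
  by rewrite !in_itv/= => /andP[u1 u2]; apply/andP; lra.
have cF u : u \in `[lo, hi] -> {for u, continuous F}.
  by move=> hu; apply: differentiable_continuous; apply/derivable1_diffP; have [] := FdF u hu.
have csub : {within `[s, t], continuous dF} by exact: continuous_subspaceW cdF.
have mst : measurable_fun (`[s, t] : set mR) (dF : mR -> mR).
  by apply: subspace_continuous_measurable_fun.
have mlohi : measurable_fun (`[lo, hi] : set mR) (dF : mR -> mR).
  by apply: subspace_continuous_measurable_fun.
have := @continuous_FTC2 R dF F s t st csub.
rewrite distrC -abse_EFin EFinB => <-.
- apply: (@le_trans _ _ (\int[leb]_(u in `[s, t]) `|(dF u)%:E|)%E).
    by apply: le_abse_integral => //; exact/measurable_EFinP.
  apply: ge0_subset_integral => //.
  by apply/measurable_EFinP; apply: measurableT_comp.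
- split=> [u ust||].
  + have [] := FdF u _ => //; apply: sub; exact: subset_itv_oo_cc.
  + by apply: cvg_at_right_filter; apply: cF.
  + by apply: cvg_at_left_filter; apply: cF.
- move=> u ust; rewrite derive1E; have [] := FdF u _ => //.
  by apply: sub; exact: subset_itv_oo_cc.
Qed.

End Poincare.

(** * The Poincare-Wirtinger inequality on a cube *)

Section PoincareWirtinger.
Context {R : realType}.
Local Notation R3 := (R * R * R)%type.
Local Notation mR := (measurableTypeR R).
Local Notation mR3 := (mR * mR * mR)%type.
Local Notation leb := (@lebesgue_measure R).
Local Notation mu := (@lebesgue3 R).

Lemma increment_along_axis (D : set R3) (w dw : R3 -> R) (i : 'I_3) (z : R3) (lo hi s t : R) :
  (forall x, D x -> is_derive x (basis3 i) w (dw x)) -> cont_on D dw ->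
  (forall u, u \in `[lo, hi] -> D (z + u *: basis3 i)) ->
  s \in `[lo, hi] -> t \in `[lo, hi] ->
  ((`|w (z + s *: basis3 i) - w (z + t *: basis3 i)|)%:E
    <= \int[leb]_(u in `[lo, hi]) (`|dw (z + u *: basis3 i)|)%:E)%E.
Proof.
move=> wdw cdw inD hs ht.
apply: (@increment_le_integral R (fun u => w (z + u *: basis3 i)) (fun u => dw (z + u *: basis3 i))) => //.
  by move=> u hu; apply: is_derive_line; apply: wdw; exact: inD.
apply: continuous_in_subspaceT => u /set_mem hu.
apply (@continuous_comp R R3 R (fun u : R => z + u *: basis3 i) dw u).
  exact: line_continuous.
by apply: cdw; exact: inD.
Qed.

Variables (D : set R3) (w : R3 -> R) (dw : 'I_3 -> R3 -> R) (c : R3) (h : R).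
Hypotheses (oD : open D) (h0 : 0 < h) (QD : cube c h `<=` D).
Hypothesis w_dw : forall i x, D x -> is_derive x (basis3 i) w (dw i x).
Hypothesis cw : cont_on D w.
Hypothesis cdw : forall i, cont_on D (dw i).

Local Notation Q := (cube c h).
Let l := h *+ 2.
Let I : set mR := `[c.1.1 - h, c.1.1 + h]%classic.
Let J : set mR := `[c.1.2 - h, c.1.2 + h]%classic.
Let K : set mR := `[c.2 - h, c.2 + h]%classic.

Let leb_side (t : R) : leb `[t - h, t + h]%classic = l%:E.
Proof.
have hp := h0; rewrite lebesgue_measure_itv/= lte_fin ifT; last lra.
by rewrite -EFinB; congr EFin; rewrite /l; ring.
Qed.

Let mI : measurable I. Proof. exact: measurable_itv. Qed.
Let mJ : measurable J. Proof. exact: measurable_itv. Qed.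
Let mK : measurable K. Proof. exact: measurable_itv. Qed.
Let mQ : measurable (Q : set mR3). Proof. exact: cube_measurable. Qed.

Let g i : mR3 -> \bar R := (fun x => (`|dw i x|)%:E) \_ (Q : set mR3).

Let mg i : measurable_fun setT (g i).
Proof.
apply/(measurable_restrictT _ mQ); apply/measurable_EFinP.
apply: measurableT_comp => //.
exact: measurable_funS (open_measurable3 oD) QD (continuous_measurable3 oD (@cdw i)).
Qed.

Let g_ge0 i x : (0 <= g i x)%E.
Proof. by rewrite /g patchE; case: ifP => // _; rewrite lee_fin. Qed.

Let gQ i x : Q x -> g i x = (`|dw i x|)%:E.
Proof. by move=> Qx; rewrite /g patchE mem_set. Qed.

Let gI i : (\int[mu]_(x in Q) g i x = \int[mu]_(x in Q) (`|dw i x|)%:E)%E.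
Proof. by apply: eq_integral => x /set_mem Qx; rewrite gQ. Qed.

Let i0 : 'I_3 := ord0.
Let i1 : 'I_3 := lift ord0 ord0.
Let i2 : 'I_3 := lift ord0 (lift ord0 ord0).

(* Going from [x] to [y] one coordinate at a time, [A1], [A2] and [A3] bound the
   variation of [w] on the three legs. Each is an integral over a full edge of
   the cube and so depends on two coordinates only. *)
Let A1 (x : mR3) : \bar R := (\int[leb]_(u in I) g i0 ((u, x.1.2), x.2))%E.
Let A2 (y : mR3) (t : mR) : \bar R := (\int[leb]_(u in J) g i1 ((y.1.1, u), t))%E.
Let A3 (y : mR3) : \bar R := (\int[leb]_(u in K) g i2 (y.1, u))%E.

Let leg1 (x y : R3) : Q x -> Q y ->
  ((`|w x - w ((y.1.1, x.1.2), x.2)|)%:E <= A1 x)%E.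
Proof.
move=> [[x1 x2] x3] [[y1 y2] y3].
have E u : ((u, x.1.2), x.2) = ((0, x.1.2), x.2) + u *: basis3 i0 :> R3.
  by congr (_, _, _); rewrite /= /GRing.scale/= ?mulr1 ?mulr0 ?add0r ?addr0.
have inQ u : u \in `[c.1.1 - h, c.1.1 + h] -> Q ((u, x.1.2), x.2) by move=> hu.
have -> : w x = w ((x.1.1, x.1.2), x.2) by case: (x) => -[].
have := @increment_along_axis D w (dw i0) i0 ((0, x.1.2), x.2) (c.1.1 - h) (c.1.1 + h)
  x.1.1 y.1.1 (@w_dw i0) (@cdw i0).
rewrite -!E => H; apply: le_trans (H _ _ _) _ => //.
- by move=> u hu; rewrite -E; apply: QD; exact: inQ.
- rewrite le_eqVlt; apply/orP; left; apply/eqP; apply: eq_integral => u /set_mem hu.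
  by rewrite -E gQ//; exact: inQ.
Qed.

Let leg2 (x y : R3) : Q x -> Q y ->
  ((`|w ((y.1.1, x.1.2), x.2) - w ((y.1.1, y.1.2), x.2)|)%:E <= A2 y x.2)%E.
Proof.
move=> [[x1 x2] x3] [[y1 y2] y3].
have E u : ((y.1.1, u), x.2) = ((y.1.1, 0), x.2) + u *: basis3 i1 :> R3.
  by congr (_, _, _); rewrite /= /GRing.scale/= ?mulr1 ?mulr0 ?add0r ?addr0.
have inQ u : u \in `[c.1.2 - h, c.1.2 + h] -> Q ((y.1.1, u), x.2) by move=> hu.
have := @increment_along_axis D w (dw i1) i1 ((y.1.1, 0), x.2) (c.1.2 - h) (c.1.2 + h)
  x.1.2 y.1.2 (@w_dw i1) (@cdw i1).
rewrite -!E => H; apply: le_trans (H _ _ _) _ => //.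
- by move=> u hu; rewrite -E; apply: QD; exact: inQ.
- rewrite le_eqVlt; apply/orP; left; apply/eqP; apply: eq_integral => u /set_mem hu.
  by rewrite -E gQ//; exact: inQ.
Qed.

Let leg3 (x y : R3) : Q x -> Q y ->
  ((`|w ((y.1.1, y.1.2), x.2) - w ((y.1.1, y.1.2), y.2)|)%:E <= A3 y)%E.
Proof.
move=> [[x1 x2] x3] [[y1 y2] y3].
have E u : ((y.1.1, y.1.2), u) = ((y.1.1, y.1.2), 0) + u *: basis3 i2 :> R3.
  by congr (_, _, _); rewrite /= /GRing.scale/= ?mulr1 ?mulr0 ?add0r ?addr0.
have inQ u : u \in `[c.2 - h, c.2 + h] -> Q ((y.1.1, y.1.2), u) by move=> hu.
have := @increment_along_axis D w (dw i2) i2 ((y.1.1, y.1.2), 0) (c.2 - h) (c.2 + h)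
  x.2 y.2 (@w_dw i2) (@cdw i2).
rewrite -!E => H; apply: le_trans (H _ _ _) _ => //.
- by move=> u hu; rewrite -E; apply: QD; exact: inQ.
- rewrite le_eqVlt; apply/orP; left; apply/eqP; apply: eq_integral => u /set_mem hu.
  have Ey : (y.1.1, y.1.2) = y.1 by case: (y.1).
  by rewrite -E Ey gQ//; rewrite -Ey; exact: inQ.
Qed.

Let increment_le (x y : R3) : Q x -> Q y ->
  ((`|w x - w y|)%:E <= A1 x + (A2 y x.2 + A3 y))%E.
Proof.
move=> Qx Qy; have l1 := leg1 Qx Qy; have l2 := leg2 Qx Qy; have l3 := leg3 Qx Qy.
apply: le_trans (leeD l1 (leeD l2 l3)).
rewrite -!EFinD lee_fin.
have -> : w y = w ((y.1.1, y.1.2), y.2) by case: (y) => -[].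
have -> : w x - w ((y.1.1, y.1.2), y.2) = (w x - w ((y.1.1, x.1.2), x.2))
  + ((w ((y.1.1, x.1.2), x.2) - w ((y.1.1, y.1.2), x.2))
  + (w ((y.1.1, y.1.2), x.2) - w ((y.1.1, y.1.2), y.2))) by ring.
by apply: le_trans (ler_normD _ _) _; rewrite lerD2l ler_normD.
Qed.

Let mA1 : measurable_fun setT (A1 : mR3 -> \bar R).
Proof.
apply (@measurable_section_integral _ _ mR3 mR R leb I
  (fun x => g i0 ((x.2, x.1.1.2), x.1.2)) mI); last by [].
apply: measurableT_comp (mg i0) _.
apply: measurable_fun_pair; first apply: measurable_fun_pair.
- exact: measurable_snd.
- by do !apply: measurableT_comp.
- by do !apply: measurableT_comp.
Qed.

Let mA2 t : measurable_fun setT (fun y : mR3 => A2 y t).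
Proof.
apply (@measurable_section_integral _ _ mR3 mR R leb J
  (fun x => g i1 ((x.1.1.1, x.2), t)) mJ); last by [].
apply: measurableT_comp (mg i1) _.
apply: measurable_fun_pair; first apply: measurable_fun_pair.
- by do !apply: measurableT_comp.
- exact: measurable_snd.
- exact: measurable_cst.
Qed.

Let mA3 : measurable_fun setT (A3 : mR3 -> \bar R).
Proof.
apply (@measurable_section_integral _ _ mR3 mR R leb K
  (fun x => g i2 (x.1.1, x.2)) mK); last by [].
apply: measurableT_comp (mg i2) _.
apply: measurable_fun_pair; last exact: measurable_snd.
by do !apply: measurableT_comp.
Qed.

Let L (t : mR) : \bar R := (\int[lebesgue2]_(xy in I `*` J) g i1 (xy, t))%E.

Let mL : measurable_fun setT (fun x : mR3 => L x.2).
Proof.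
apply (@measurable_section_integral _ _ mR3 (mR * mR)%type R lebesgue2 (I `*` J)
  (fun x => g i1 (x.2, x.1.2)) (measurableX mI mJ)); last by [].
apply: measurableT_comp (mg i1) _.
by apply: measurable_fun_pair; [exact: measurable_snd|apply: measurableT_comp].
Qed.

Let l_gt0 : 0 < l. Proof. by rewrite /l pmulrn_lgt0. Qed.

Definition cube_mean : R := (\int[mu]_(x in Q) w x) / l ^+ 3.

Let w_int : mu.-integrable (Q : set mR3) (EFin \o w).
Proof.
have mw : measurable_fun (Q : set mR3) (w : mR3 -> mR).
  exact: measurable_funS (open_measurable3 oD) QD (continuous_measurable3 oD cw).
have /compact_bounded[B [Br hB]] : compact (w @` Q).
  apply: continuous_compact (@cube_compact R c h).
  by apply: continuous_in_subspaceT => x /set_mem /QD; exact: cw.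
apply: (@bounded_integrable R Q w (`|B| + 1)) => //.
- by rewrite lebesgue3_cube// ltry.
- move=> x Qx; apply: hB; last by exists x.
  by rewrite (le_lt_trans (ler_norm B)) ?ltrDl.
Qed.

(* The deviation from the mean is the average over [y] of [w x - w y]. *)
Let deviation_le x : Q x ->
  ((l ^+ 3)%:E * (`|w x - cube_mean|)%:E
   <= (l ^+ 3)%:E * A1 x + ((l * l)%:E * L x.2 + l%:E * \int[mu]_(y in Q) g i2 y))%E.
Proof.
move=> Qx; have l3 : 0 < l ^+ 3 by exact: exprn_gt0.
have A1_ge0 z : (0 <= A1 z)%E by apply: integral_ge0.
have A2_ge0 z t : (0 <= A2 z t)%E by apply: integral_ge0.
have A3_ge0 z : (0 <= A3 z)%E by apply: integral_ge0.
have cst_int (k : R) : mu.-integrable (Q : set mR3) (EFin \o cst k).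
  by apply: (@bounded_integrable R Q (cst k) `|k|) => //; rewrite lebesgue3_cube// ltry.
have e : l ^+ 3 * `|w x - cube_mean| = `|\int[mu]_(y in Q) (w x - w y)|.
  rewrite (RintegralB mQ (cst_int (w x)) w_int) Rintegral_cst// lebesgue3_cube//=.
  have e' : l ^+ 3 * cube_mean = \int[mu]_(y in Q) w y.
    by rewrite /cube_mean mulrC divfK// gt_eqF.
  by rewrite -[X in X * _](ger0_norm (ltW l3)) -normrM mulrBr e' mulrC.
rewrite -EFinM e EFin_normr_Rintegral//; last exact: (integrableB mQ (cst_int (w x)) w_int).
have mwx : measurable_fun (Q : set mR3) (fun y : mR3 => (w x - w y)%:E).
  by have /integrableP[] := integrableB mQ (cst_int (w x)) w_int.
apply: le_trans (le_abse_integral mu mQ mwx) _.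
have mT (f : mR3 -> \bar R) : measurable_fun setT f -> measurable_fun (Q : set mR3) f.
  exact: measurable_funTS.
apply: (@le_trans _ _ (\int[mu]_(y in Q) (A1 x + (A2 y x.2 + A3 y)))%E).
  apply: ge0_le_integral => //.
  - exact: measurableT_comp.
  - apply: emeasurable_funD; first exact: measurable_cst.
    by apply: emeasurable_funD; apply: mT.
  - by move=> y Qy; exact: increment_le.
rewrite ge0_integralD//; do ?[exact: measurable_cst
  |by move=> y _; exact: adde_ge0|by apply: emeasurable_funD; apply: mT].
rewrite ge0_integralD//; do ?exact: mT.
rewrite (_ : (\int[mu]_(_ in Q) A1 x)%E = ((l ^+ 3)%:E * A1 x)%E); last first.
  by rewrite (integral_cst mu mQ (A1 x)) lebesgue3_cube// muleC.
apply: leeD => //; apply: leeD.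
- by rewrite (marginal2 mI mJ mK (leb_side _) (leb_side _) (mg i1) (g_ge0 i1)).
- by rewrite (marginal3 mI mJ mK (leb_side _) (mg i2) (g_ge0 i2)).
Qed.

(** The increment between two points of the cube is at most the sum of three
    edge integrals of the partial derivatives; averaging over both points and
    exchanging integrals turns each of them into [l] times an integral over the
    cube. *)
Lemma poincare_wirtinger :
  (\int[mu]_(x in Q) (`|w x - cube_mean|)%:E
   <= l%:E * \sum_(i < 3) \int[mu]_(x in Q) (`|dw i x|)%:E)%E.
Proof.
have l3 : 0 < l ^+ 3 by exact: exprn_gt0.
have A1_ge0 z : (0 <= A1 z)%E by apply: integral_ge0.
have L_ge0 z : (0 <= L z)%E by apply: integral_ge0.
have G_ge0 i : (0 <= \int[mu]_(y in Q) g i y)%E by apply: integral_ge0.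
have mdev : measurable_fun (Q : set mR3) (fun x : mR3 => (`|w x - cube_mean|)%:E).
  apply/measurable_EFinP; apply: measurableT_comp => //.
  apply: measurable_funB; last exact: measurable_cst.
  by have /integrableP[/measurable_EFinP] := w_int.
rewrite -(@lee_pmul2l _ (l ^+ 3)%:E)//.
rewrite -ge0_integralZl//; last by rewrite lee_fin ltW.
apply: (@le_trans _ _ (\int[mu]_(x in Q) ((l ^+ 3)%:E * A1 x
   + ((l * l)%:E * L x.2 + l%:E * \int[mu]_(y in Q) g i2 y)))%E).
  apply: ge0_le_integral => //.
  - by move=> x _; rewrite mule_ge0// lee_fin ltW.
  - exact: measurable_funeM.
  - apply: emeasurable_funD; first by apply: measurable_funeM; exact: measurable_funTS.
    apply: emeasurable_funD; last exact: measurable_cst.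
    by apply: measurable_funeM; exact: measurable_funTS.
have p1 : (0 <= (l ^+ 3)%:E)%E by rewrite lee_fin ltW.
have p2 : (0 <= (l * l)%:E)%E by rewrite lee_fin mulr_ge0 ?ltW.
have p3 : (0 <= l%:E)%E by rewrite lee_fin ltW.
have mA1' : measurable_fun (Q : set mR3) (fun x : mR3 => (l ^+ 3)%:E * A1 x)%E.
  by apply: measurable_funeM; exact: measurable_funTS.
have mL' : measurable_fun (Q : set mR3) (fun x : mR3 => (l * l)%:E * L x.2)%E.
  by apply: measurable_funeM; exact: measurable_funTS.
rewrite ge0_integralD//; do ?[by move=> x _; exact: mule_ge0
  |by move=> x _; rewrite adde_ge0// mule_ge0
  |by apply: emeasurable_funD => //; exact: measurable_cst].
rewrite ge0_integralD//; do ?[by move=> x _; exact: mule_ge0|exact: measurable_cst].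
rewrite ge0_integralZl//; last exact: measurable_funTS.
rewrite ge0_integralZl//; last exact: measurable_funTS.
rewrite (integral_cst mu mQ) lebesgue3_cube//.
rewrite (marginal1 mI mJ mK (leb_side _) (ltW l_gt0) (mg i0) (g_ge0 i0)).
rewrite (marginal2' mI mJ mK (leb_side _) (leb_side _) (mg i1) (g_ge0 i1)).
rewrite [X in (_ <= X)%E]muleA sum_ord3 !gI.
have G_ge0' i : (0 <= \int[mu]_(y in Q) (`|dw i y|)%:E)%E by rewrite -gI.
have dist k (a b d : \bar R) : (0 <= a)%E -> (0 <= b)%E -> (0 <= d)%E ->
    (k * (a + (b + d)) = k * a + (k * b + k * d))%E.
  by move=> a0 b0 d0; rewrite ge0_muleDr ?adde_ge0// ge0_muleDr.
rewrite dist// !muleA -!EFinM [X in (_ + (_ + X) <= _)%E]muleAC -!EFinM.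
have E1 : l * l * (l * l) = l ^+ 3 * l by rewrite !exprS expr0 mulr1 !mulrA.
have E2 : l * l ^+ 3 = l ^+ 3 * l by rewrite mulrC.
rewrite E1 E2; exact: lexx.
Qed.

End PoincareWirtinger.

(** * Rigidity of minimisers on cubes *)

Section GroundStateOnCubes.
Context {R : realType}.
Local Notation R3 := (R * R * R)%type.
Local Notation mR := (measurableTypeR R).
Local Notation mR3 := (mR * mR * mR)%type.
Local Notation mu := (@lebesgue3 R).

(** Pointwise, [|f| <= e + f ^ 2 / e]. The free parameter [e] does the work of
    the Cauchy-Schwarz inequality: it is later taken to be a
    bound of the [L2]-norm of [f]. *)
Lemma cube_L1_le_L2 (D : set R3) (f : R3 -> R) c h (e : R) : open D -> 0 < h ->
  cube c h `<=` D -> L2 D f -> 0 < e ->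
  (\int[mu]_(x in cube c h) (`|f x|)%:E
    <= (e * (h *+ 2) ^+ 3 + e^-1 * L2_ip D f f)%:E)%E.
Proof.
move=> oD h0 QD Lf e0; have mD := open_measurable3 oD.
have mQ : measurable (cube c h : set mR3) := cube_measurable c h.
have mf := L2_measurable mD Lf.
have mfQ : measurable_fun (cube c h : set mR3) (f : mR3 -> mR) := measurable_funS mD QD mf.
have mff : measurable_fun (D : set mR3) (fun x : mR3 => (e^-1 * (f x * f x))%:E).
  by apply/measurable_EFinP; apply: measurable_funM => //; exact: measurable_funM.
have ei : 0 < e^-1 by rewrite invr_gt0.
have ff0 x : (0 <= (e^-1 * (f x * f x))%:E)%E.
  by rewrite lee_fin; apply: mulr_ge0; [exact: ltW|rewrite -expr2 sqr_ge0].
apply: (@le_trans _ _ (\int[mu]_(x in cube c h) (e%:E + (e^-1 * (f x * f x))%:E))%E).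
  apply: ge0_le_integral => //.
  - by apply/measurable_EFinP; apply: measurableT_comp.
  - by apply: emeasurable_funD; [exact: measurable_cst|exact: measurable_funS mD QD mff].
  - move=> x _; rewrite -EFinD lee_fin -(ler_pM2r e0).
    have -> : (e + e^-1 * (f x * f x)) * e = e ^+ 2 + `|f x| ^+ 2.
      by rewrite real_normK ?num_real//; field; rewrite gt_eqF.
    by have := normr_ge0 (f x); have := sqr_ge0 (`|f x| - e); nra.
rewrite ge0_integralD//; last 2 first.
- by move=> x _; rewrite lee_fin ltW.
- exact: measurable_funS mD QD mff.
rewrite (integral_cst mu mQ e%:E) lebesgue3_cube// -EFinM EFinD leeD2l//.
apply: (@le_trans _ _ (\int[mu]_(x in D) (e^-1 * (f x * f x))%:E)%E).
  exact: ge0_subset_integral.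
have Lff := L2_mul_integrable mD Lf Lf.
rewrite /L2_ip /Rintegral EFinM fineK; last exact: integrable_fin_num.
rewrite le_eqVlt; apply/orP; left; apply/eqP; exact: (integralZl mD Lff e^-1).
Qed.

Section Cube.
Variables (D : set R3) (u : R3 -> R) (du ddu : 'I_3 -> R3 -> R) (k : R).
Hypothesis oD : open D.
Hypothesis u_du : forall i x, D x -> is_derive x (basis3 i) u (du i x).
Hypothesis du_ddu : forall i x, D x -> is_derive x (basis3 i) (du i) (ddu i x).
Hypothesis cu : cont_on D u.
Hypothesis cdu : forall i, cont_on D (du i).
Hypothesis cddu : forall i, cont_on D (ddu i).
Hypothesis u_gt0 : forall x, D x -> 0 < u x.
Hypothesis u_eigen : forall x, D x -> \sum_(i < 3) ddu i x = - (k * u x).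

Let mD : measurable (D : set mR3) := open_measurable3 oD.
Let u_neq0 x : D x -> u x != 0. Proof. by move=> Dx; rewrite gt_eqF ?u_gt0. Qed.
Let cui : cont_on D (fun x => (u x)^-1). Proof. exact: cont_onV. Qed.

(* This is [u] times the partial derivative of [f / u]. *)
Let excess (f : R3 -> R) i x : R := partial i f x - f x * (du i x / u x).

Let cexcess f i : test_function D f -> cont_on D (excess f i).
Proof.
move=> tf; apply: cont_onB; first exact: cont_on_test (test_partial i tf).
apply: cont_onM; first exact: cont_on_test tf.
by apply: cont_onM => //; exact: cdu.
Qed.

Let excess_L2 f i : test_function D f -> L2 D (excess f i).
Proof.
move=> tf; have ce := (@cexcess _ i tf).
apply: (L2_of_integrable mD); first exact: continuous_measurable3.
have cpe : cont_on D (fun x => du i x / u x * excess f i x).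
  by apply: cont_onM => //; apply: cont_onM => //; exact: cdu.
have := integrableB mD (test_mul_integrable oD (test_partial i tf) ce)
  (test_mul_integrable oD tf cpe).
by apply: eq_integrable => // x _ /=; rewrite -EFinB; congr EFin; rewrite /excess; ring.
Qed.

Lemma excess_sum f : test_function D f ->
  \sum_(i < 3) L2_ip D (excess f i) (excess f i)
  = L2_ip D (- laplacian f) f - k * L2_ip D f f.
Proof.
move=> tf; rewrite (jacobi_identity oD u_du du_ddu cu cdu cddu u_gt0 u_eigen tf).
by apply: eq_bigr => i _; apply: eq_Rintegral => x _; rewrite expr2.
Qed.

Let quotient_derive f i x : test_function D f -> D x ->
  is_derive x (basis3 i) (fun y => f y * (u y)^-1) (excess f i x * (u x)^-1).
Proof.
move=> tf Dx; have df := smooth_is_derive i x (test_smooth tf).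
have d := u_du i Dx.
have dV : is_derive x (basis3 i) (fun y => (u y)^-1) (- u x ^- 2 *: du i x).
  apply: DeriveDef; first by apply: derivableV; [exact: u_neq0|exact: ex_derive].
  by rewrite deriveV ?derive_val//; exact: u_neq0.
have h := @is_deriveM _ _ f (fun y => (u y)^-1) x (basis3 i) _ _ df dV.
apply: (is_derive_eq h); rewrite /excess /GRing.scale/=.
by field; exact: u_neq0.
Qed.

Variables (v : R3 -> R) (vn : nat -> R3 -> R).
Hypothesis vL2 : L2 D v.
Hypothesis vn_test : forall n, test_function D (vn n).
Hypothesis vn_v : (fun n => L2_ip D (vn n - v) (vn n - v)) @ \oo --> 0.
Hypothesis vn_excess : forall e : R, 0 < e -> exists N : nat, forall n, (N <= n)%N ->
  L2_ip D (- laplacian (vn n)) (vn n) - k * L2_ip D (vn n) (vn n) <= e.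

Variables (c : R3) (h : R).
Hypotheses (h0 : 0 < h) (QD : cube c h `<=` D).
Local Notation Q := (cube c h).
Let mQ : measurable (Q : set mR3) := cube_measurable c h.
Let l := h *+ 2.
Let l0 : 0 < l. Proof. by rewrite /l pmulrn_lgt0. Qed.

Let w x := v x * (u x)^-1.
Let wn n x := vn n x * (u x)^-1.
Let cube_L1 (f : R3 -> R) : \bar R := (\int[mu]_(x in Q) (`|f x|)%:E)%E.

Let bound_inv : exists2 B : R, 0 < B & forall x, Q x -> `|(u x)^-1| <= B.
Proof.
have /compact_bounded[B [Br hB]] : compact ((fun x => (u x)^-1) @` Q).
  apply: continuous_compact (@cube_compact R c h).
  by apply: continuous_in_subspaceT => x /set_mem /QD; exact: cui.
exists (`|B| + 1); first by rewrite ltr_wpDl.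
move=> x Qx; apply: hB; last by exists x.
by rewrite (le_lt_trans (ler_norm B)) ?ltrDl.
Qed.

Let mu_inv : measurable_fun (Q : set mR3) ((fun x => (u x)^-1) : mR3 -> mR).
Proof. exact: measurable_funS mD QD (continuous_measurable3 oD cui). Qed.

Let cube_L1_quotient (f : R3 -> R) (B e : R) : 0 < B -> (forall x, Q x -> `|(u x)^-1| <= B) ->
  L2 D f -> 0 < e ->
  (cube_L1 (fun x => (f x * (u x)^-1)%R) <= (B * (e * l ^+ 3 + e^-1 * L2_ip D f f))%:E)%E.
Proof.
move=> B0 hB Lf e0.
have mf : measurable_fun (Q : set mR3) (f : mR3 -> mR).
  exact: measurable_funS mD QD (L2_measurable mD Lf).
have mfE : measurable_fun (Q : set mR3) (fun x : mR3 => (`|f x|)%:E).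
  by apply/measurable_EFinP; exact: measurableT_comp.
rewrite EFinM; apply: le_trans (lee_wpmul2l _ (cube_L1_le_L2 oD h0 QD Lf e0)); last first.
  by rewrite lee_fin ltW.
rewrite -ge0_integralZl//; last by rewrite lee_fin ltW.
apply: ge0_le_integral => //.
- by apply/measurable_EFinP; apply: measurableT_comp => //; exact: measurable_funM.
- exact: measurable_funeM.
- by move=> x Qx; rewrite -EFinM lee_fin normrM mulrC ler_wpM2r ?hB.
Qed.

Let wn_int n : mu.-integrable (Q : set mR3) (EFin \o wn n).
Proof.
have := test_mul_integrable oD (vn_test n) cui.
exact: integrableS.
Qed.

Let w_measurable : measurable_fun (Q : set mR3) (w : mR3 -> mR).
Proof. by apply: measurable_funM => //; exact: measurable_funS mD QD (L2_measurable mD vL2). Qed.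

Let w_int : mu.-integrable (Q : set mR3) (EFin \o w).
Proof.
have [B B0 hB] := bound_inv.
apply/integrableP; split; first exact/measurable_EFinP.
by apply: le_lt_trans (cube_L1_quotient B0 hB vL2 ltr01) _; rewrite ltry.
Qed.

Let cube_L1_triangle (f g : R3 -> R) :
  measurable_fun (Q : set mR3) (f : mR3 -> mR) ->
  measurable_fun (Q : set mR3) (g : mR3 -> mR) ->
  (cube_L1 (fun x => (f x + g x)%R) <= cube_L1 f + cube_L1 g)%E.
Proof.
move=> mf mg.
have mE (f1 : R3 -> R) : measurable_fun (Q : set mR3) (f1 : mR3 -> mR) ->
    measurable_fun (Q : set mR3) (fun x : mR3 => (`|f1 x|)%:E).
  by move=> m1; apply/measurable_EFinP; exact: measurableT_comp.
rewrite /cube_L1 -ge0_integralD//; [|exact: mE|exact: mE].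
apply: ge0_le_integral => //.
- by apply: mE; exact: measurable_funD.
- by apply: emeasurable_funD; exact: mE.
- by move=> x _; rewrite -EFinD lee_fin ler_normD.
Qed.

Let m := (\int[mu]_(x in Q) w x) / l ^+ 3.

(* For [n] large, [w] is within [e] of the quotient [wn n] in the L1-norm of the
   cube, and so are their means; the gradient of [wn n] is small because its
   weighted square is the excess. The Poincare-Wirtinger inequality for [wn n]
   closes the estimate. *)
Let cube_L1_w_m (e : R) : 0 < e -> e <= 1 ->
  forall B, 0 < B -> (forall x, Q x -> `|(u x)^-1| <= B) ->
  (cube_L1 (fun x => (w x - m)%R) <= (e * (B * (l ^+ 3 + 1) * 2 + l * (B * (l ^+ 3 + 1) * 3)))%:E)%E.
Proof.
move=> e0 e1 B B0 hB.
have e2 : 0 < e ^+ 2 by exact: exprn_gt0.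
have [N hN] := vn_excess e2.
have : \forall n \near \oo, L2_ip D (vn n - v) (vn n - v) < e ^+ 2.
  exact: (cvgr_lt _ vn_v).
move=> [N' _ hN'].
pose n := maxn N N'.
have en := hN n (leq_maxl _ _); have vv := hN' n (leq_maxr _ _).
rewrite -excess_sum// in en.
have l3 : 0 < l ^+ 3 by exact: exprn_gt0.
have mwn : measurable_fun (Q : set mR3) (wn n : mR3 -> mR).
  by have /integrableP[/measurable_EFinP] := wn_int n.
have Lvv : L2 D (v - vn n).
  have -> : v - vn n = v + (-1) *: vn n by rewrite scaleN1r.
  by apply: (L2_add mD) => //; apply: (L2_scale mD); exact: test_L2.
have vvE : L2_ip D (v - vn n) (v - vn n) = L2_ip D (vn n - v) (vn n - v).
  apply: eq_Rintegral => x _.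
  rewrite (_ : (v - vn n) x = v x - vn n x)// (_ : (vn n - v) x = vn n x - v x)//.
  by rewrite -[X in X * X = _]opprB mulrNN.
have b1 : (cube_L1 (fun x => (w x - wn n x)%R) <= (e * (B * (l ^+ 3 + 1)))%:E)%E.
  have -> : cube_L1 (fun x => w x - wn n x) = cube_L1 (fun x => (v - vn n) x * (u x)^-1).
    by apply: eq_integral => x _; rewrite /w /wn -mulrBl.
  apply: le_trans (cube_L1_quotient B0 hB Lvv e0) _.
  rewrite lee_fin vvE [leRHS]mulrCA; apply: ler_wpM2l; first exact: ltW.
  by rewrite mulrDr lerD2l mulr1 ler_pdivrMl// -expr2 ltW.
have b2 i : (cube_L1 (fun x => (excess (vn n) i x * (u x)^-1)%R) <= (e * (B * (l ^+ 3 + 1)))%:E)%E.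
  apply: le_trans (cube_L1_quotient B0 hB (@excess_L2 _ i (vn_test n)) e0) _.
  rewrite lee_fin [leRHS]mulrCA; apply: ler_wpM2l; first exact: ltW.
  rewrite mulrDr lerD2l mulr1 ler_pdivrMl// -expr2; apply: le_trans en.
  rewrite (bigD1 i)//= lerDl; apply: sumr_ge0 => j _.
  exact: L2_ip_ge0 (@excess_L2 _ j (vn_test n)).
have PW := @poincare_wirtinger R D (wn n) (fun i x => excess (vn n) i x * (u x)^-1) c h
  oD h0 QD (fun i x Dx => @quotient_derive _ i x (vn_test n) Dx)
  (cont_onM (cont_on_test (vn_test n)) cui) (fun i => cont_onM (@cexcess _ i (vn_test n)) cui).
set mn := cube_mean _ _ _ in PW.
have b3 : (cube_L1 (fun x => (wn n x - mn)%R) <= (l * (e * (B * (l ^+ 3 + 1)) * 3))%:E)%E.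
  apply: le_trans PW _; rewrite EFinM; apply: lee_wpmul2l; first by rewrite lee_fin ltW.
  apply: (@le_trans _ _ (\sum_(i < 3) (e * (B * (l ^+ 3 + 1)))%:E)%E).
    by apply: lee_sum => i _; exact: b2.
  by rewrite sumEFin lee_fin sumr_const card_ord -[leLHS]mulr_natr.
have b4 : (cube_L1 (fun=> (mn - m)%R) <= (e * (B * (l ^+ 3 + 1)))%:E)%E.
  rewrite /cube_L1 (integral_cst mu mQ) lebesgue3_cube// -EFinM.
  have -> : `|mn - m| * (h *+ 2) ^+ 3 = `|\int[mu]_(x in Q) (w x - wn n x)|.
    rewrite (RintegralB mQ w_int (wn_int n)) distrC -[X in _ * X](ger0_norm (ltW l3)) -normrM.
    by congr (`| _ |); rewrite /m /mn /cube_mean -/l -mulrBl divfK ?gt_eqF.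
  rewrite EFin_normr_Rintegral//; last exact: (integrableB mQ w_int (wn_int n)).
  apply: le_trans b1; apply: le_abse_integral => //.
  by apply/measurable_EFinP; exact: measurable_funB.
have -> : cube_L1 (fun x => w x - m) = cube_L1 (fun x => (w x - wn n x) + ((wn n x - mn) + (mn - m))).
  by apply: eq_integral => x _; congr (`| _ |%:E); ring.
apply: le_trans (cube_L1_triangle _ _) _.
- exact: measurable_funB.
- by apply: measurable_funD; [apply: measurable_funB|]; try exact: measurable_cst.
apply: le_trans (leeD2l _ (cube_L1_triangle _ _)) _.
- by apply: measurable_funB => //; exact: measurable_cst.
- exact: measurable_cst.
apply: le_trans (leeD b1 (leeD b3 b4)) _.
by rewrite -!EFinD lee_fin; lra.
Qed.

(** The quotient of [v] by [u] is the L1-limit of functions whose gradients tend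
    to zero in L1, so it equals its mean on the cube. *)
Lemma quotient_constant_on_cube :
  mu.-negligible (Q `&` [set x | v x != m * u x] : set mR3).
Proof.
have [B B0 hB] := bound_inv.
set C := B * (l ^+ 3 + 1) * 2 + l * (B * (l ^+ 3 + 1) * 3).
have l3 : 0 < l ^+ 3 by exact: exprn_gt0.
have C0 : 0 < C.
  have b : 0 < B * (l ^+ 3 + 1) by apply: mulr_gt0 => //; lra.
  by rewrite /C; apply: addr_gt0; [lra|apply: mulr_gt0 => //; lra].
have N0 : cube_L1 (fun x => w x - m) = 0%E.
  apply/eqP; rewrite eq_le; apply/andP; split; last exact: integral_ge0.
  apply/lee_addgt0Pr => e e0; rewrite add0e.
  pose e' := Num.min 1 (e / C).
  have e'0 : 0 < e' by rewrite lt_min ltr01 divr_gt0.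
  have e'1 : e' <= 1 by rewrite ge_min lexx.
  apply: le_trans (cube_L1_w_m e'0 e'1 B0 hB) _; rewrite -/C lee_fin.
  by rewrite -ler_pdivlMr// ge_min lexx orbT.
have mwm : measurable_fun (Q : set mR3) (fun x : mR3 => (w x - m)%:E).
  by apply/measurable_EFinP; apply: measurable_funB => //; exact: measurable_cst.
have : (\int[mu]_(x in Q) `|(w x - m)%:E| = 0)%E by exact: N0.
move=> /(ae_eq_integral_abs _ mQ mwm).1 [Z [mZ Z0 hZ]].
exists Z; split=> // x [Qx vx]; apply: hZ => /= /(_ Qx) /eqP.
rewrite eqe subr_eq0 => /eqP wm; move/negP: vx; apply.
by rewrite -wm /w divfK// u_neq0//; exact: QD.
Qed.

End Cube.

End GroundStateOnCubes.

(** * From cubes to the annulus *)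

Section Connectedness.
Context {R : realType}.
Local Notation R3 := (R * R * R)%type.
Implicit Types (x : R3).

Lemma path_continuous (f1 f2 f3 : R -> R) : continuous f1 -> continuous f2 ->
  continuous f3 -> continuous (fun t : R => ((f1 t, f2 t), f3 t) : R3).
Proof.
move=> c1 c2 c3 t U /nbhs_cube[h h0 sub].
have n (g : R -> R) : continuous g -> \forall s \near t, `|g s - g t| <= h.
  move=> cg; have /cvgrPdist_le /(_ h h0) := cg t.
  by apply: filterS => s; rewrite distrC.
have n1 := n _ c1; have n2 := n _ c2; have n3 := n _ c3.
near=> s; apply: sub; apply/cubeP; split => /=; near: s.
- exact: n1.
- exact: n2.
- exact: n3.
Unshelve. all: by end_near. Qed.

Variables (A : R) (f : R3 -> R).
Hypothesis A_gt0 : 0 < A.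
Local Notation D := (annulus A).
Hypothesis f_loc : forall x, D x -> \forall y \near x, f y = f x.

Let along_path (p : R -> R3) (s t : R) : continuous p -> (forall u, D (p u)) ->
  f (p s) = f (p t).
Proof.
move=> cp Dp; apply: (@is_derive_0_is_cst R (f \o p)) => u.
have h : \forall z \near u, f (p z) = f (p u) := cp u _ (f_loc (Dp u)).
apply: (@near_eq_is_derive R R R (cst (f (p u))) (f \o p)).
by apply: filterS h => z /= ->.
Qed.

Let normE (x y z : R) : euclidean_norm (x, y, z) = Num.sqrt (x ^+ 2 + y ^+ 2 + z ^+ 2) :> R.
Proof. by []. Qed.

(* The expression takes opposite values at the angles [0] and [pi]. *)
Let rotation_angle (y z : R) : exists t : R, y * sin t + z * cos t = 0.
Proof.
have pi0 := pi_ge0 R.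
pose g t : R := y * sin t + z * cos t.
have cg : continuous g.
  move=> t; apply: (@continuousD R R R (fun t => y * sin t) (fun t => z * cos t) t).
    by apply: (@continuousM R R (cst y) sin t); [exact: cvg_cst|exact: continuous_sin].
  by apply: (@continuousM R R (cst z) cos t); [exact: cvg_cst|exact: continuous_cos].
have [||t _ ht] := @IVT R g 0 pi 0 pi0; last by exists t.
- exact: continuous_subspaceT.
- rewrite /g sin0 cos0 sinpi cospi !mulr0 !add0r mulr1 mulrN1.
  by rewrite ge_min le_max; have [z0|z0] := leP 0 z; lra.
Qed.

Let rotate_xy (x y z : R) : D (x, y, z) ->
  exists2 s : R, s ^+ 2 = x ^+ 2 + y ^+ 2 & f (x, y, z) = f (s, 0, z).
Proof.
move=> Dx; have [t ht] := rotation_angle x y.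
pose p u : R3 := ((x * cos u - y * sin u, x * sin u + y * cos u), z).
have cM (k : R) (g : R -> R) : continuous g -> continuous (fun u => k * g u).
  by move=> cg u; apply: (@continuousM R R (cst k) g u); [exact: cvg_cst|exact: cg].
have n2 u : (x * cos u - y * sin u) ^+ 2 + (x * sin u + y * cos u) ^+ 2 = x ^+ 2 + y ^+ 2.
  by have := cos2Dsin2 u => E; rewrite -[RHS]mulr1 -E; ring.
exists (x * cos t - y * sin t).
  by rewrite -(n2 t) ht expr0n addr0.
have -> : (x, y, z) = p 0 by rewrite /p sin0 cos0 !mulr0 !mulr1 subr0 add0r.
rewrite (@along_path p 0 t); first by rewrite /p ht.
- apply: path_continuous => u; last exact: cvg_cst.
  + apply: (@continuousB R R R (fun u => x * cos u) (fun u => y * sin u) u); apply: cM.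
      exact: continuous_cos.
    exact: continuous_sin.
  + apply: (@continuousD R R R (fun u => x * sin u) (fun u => y * cos u) u); apply: cM.
      exact: continuous_sin.
    exact: continuous_cos.
- by move=> u; move: Dx; rewrite /annulus/= !normE n2.
Qed.

Let rotate_xz (x z : R) : D (x, 0, z) ->
  exists2 s : R, s ^+ 2 = x ^+ 2 + z ^+ 2 & f (x, 0, z) = f (s, 0, 0).
Proof.
move=> Dx; have [t ht] := rotation_angle x z.
pose p u : R3 := ((x * cos u - z * sin u, 0), x * sin u + z * cos u).
have cM (k : R) (g : R -> R) : continuous g -> continuous (fun u => k * g u).
  by move=> cg u; apply: (@continuousM R R (cst k) g u); [exact: cvg_cst|exact: cg].
have n2 u : (x * cos u - z * sin u) ^+ 2 + (x * sin u + z * cos u) ^+ 2 = x ^+ 2 + z ^+ 2.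
  by have := cos2Dsin2 u => E; rewrite -[RHS]mulr1 -E; ring.
exists (x * cos t - z * sin t).
  by rewrite -(n2 t) ht expr0n addr0.
have -> : (x, 0, z) = p 0 by rewrite /p sin0 cos0 !mulr0 !mulr1 subr0 add0r.
rewrite (@along_path p 0 t); first by rewrite /p ht.
- apply: path_continuous => u; [|exact: cvg_cst|].
  + apply: (@continuousB R R R (fun u => x * cos u) (fun u => z * sin u) u); apply: cM.
      exact: continuous_cos.
    exact: continuous_sin.
  + apply: (@continuousD R R R (fun u => x * sin u) (fun u => z * cos u) u); apply: cM.
      exact: continuous_sin.
    exact: continuous_cos.
- move=> u; move: Dx; rewrite /annulus/= !normE.
  by rewrite expr0n/= !addr0 n2.
Qed.

(* Two rotations bring [x] to the first axis, on one side or the other of the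
   origin; a half-turn exchanges the two sides. *)
Let to_axis x : D x -> f x = f (euclidean_norm x, 0, 0).
Proof.
case: x => -[x y] z Dx; have [s s2 ->] := rotate_xy Dx.
have Ds : D (s, 0, z).
  by move: Dx; rewrite /annulus/= !normE s2 expr0n/= addr0.
have [t t2 ->] := rotate_xz Ds.
have Dt : D (t, 0, 0).
  by move: Ds; rewrite /annulus/= !normE t2 expr0n/= !addr0.
have nt : euclidean_norm (x, y, z) = `|t| by rewrite normE -s2 -t2 sqrtr_sqr.
rewrite nt; have [t0|t0] := leP 0 t; first by rewrite ger0_norm.
rewrite ltr0_norm//.
pose p u : R3 := ((t * cos u, t * sin u), 0).
have -> : (t, 0, 0) = p 0 by rewrite /p sin0 cos0 mulr0 mulr1.
have -> : (- t, 0, 0) = p pi by rewrite /p sinpi cospi mulr0 mulrN1.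
have cM (k : R) (g : R -> R) : continuous g -> continuous (fun u => k * g u).
  by move=> cg u; apply: (@continuousM R R (cst k) g u); [exact: cvg_cst|exact: cg].
apply: along_path.
- apply: path_continuous => u; last exact: cvg_cst.
  + by apply: cM; exact: continuous_cos.
  + by apply: cM; exact: continuous_sin.
- move=> u; move: Dt; rewrite /annulus/= !normE.
  rewrite (_ : (t * cos u) ^+ 2 + (t * sin u) ^+ 2 = t ^+ 2 + 0 ^+ 2)//.
  by have := cos2Dsin2 u => E; rewrite -[t ^+ 2]mulr1 -E; ring.
Qed.

Lemma annulus_nonempty : D !=set0.
Proof.
have A0 := A_gt0; exists (((1 / 2 + A / 2, 0), 0) : R3).
rewrite /annulus/= /euclidean_norm/= expr0n/= !addr0 sqrtr_sqr ger0_norm; last lra.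
by apply/andP; split; lra.
Qed.

(** The annulus is path connected, and a locally constant function is constant
    along a path, its composite with the path having derivative zero. The paths
    are rotations, followed by a radial segment. All are parametrised on the
    whole line by trigonometric functions, which keeps them inside the annulus
    for every value of the parameter. *)
Lemma locally_constant_annulus x y : D x -> D y -> f x = f y.
Proof.
move=> Dx Dy; rewrite (to_axis Dx) (to_axis Dy).
move: (Dx) (Dy) => /andP[a1 a2] /andP[b1 b2].
set r := euclidean_norm x in a1 a2 *; set s := euclidean_norm y in b1 b2 *.
pose g u : R := (r + s) / 2 + (r - s) / 2 * cos u.
have cg : continuous g.
  move=> u; apply: (@continuousD R R R (cst _) (fun u => (r - s) / 2 * cos u) u).
    exact: cvg_cst.
  by apply: (@continuousM R R (cst _) cos u); [exact: cvg_cst|exact: continuous_cos].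
have -> : r = g 0 by rewrite /g cos0; field.
have -> : s = g pi by rewrite /g cospi; field.
have A0 := A_gt0.
apply: (@along_path (fun u => ((g u, 0), 0))).
  by apply: path_continuous => // u; exact: cvg_cst.
move=> u; have c1 := cos_le1 u; have c2 := cos_geN1 u.
have gb : A / 2 < g u < 1 + A / 2.
  have E : g u = r * ((1 + cos u) / 2) + s * ((1 - cos u) / 2) by rewrite /g; field.
  rewrite E; set q := (1 + cos u) / 2.
  have -> : (1 - cos u) / 2 = 1 - q by rewrite /q; field.
  have q0 : 0 <= q by rewrite /q; lra.
  have q1 : q <= 1 by rewrite /q; lra.
  have q1' : 0 <= 1 - q by rewrite subr_ge0.
  have [rs|sr] := leP r s.
    have rs' : 0 <= s - r by rewrite subr_ge0.
    have e1 := mulr_ge0 rs' q0; have e2 := mulr_ge0 rs' q1'.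
    by apply/andP; split; lra.
  have sr' : 0 <= r - s by rewrite subr_ge0 ltW.
  have e1 := mulr_ge0 sr' q0; have e2 := mulr_ge0 sr' q1'.
  by apply/andP; split; lra.
rewrite /annulus/= normE expr0n/= !addr0 sqrtr_sqr ger0_norm//.
by case/andP: gb => g1 _; lra.
Qed.

End Connectedness.

Section Gluing.
Context {R : realType}.
Local Notation R3 := (R * R * R)%type.
Local Notation mR := (measurableTypeR R).
Local Notation mR3 := (mR * mR * mR)%type.
Local Notation mu := (@lebesgue3 R).
Variables (A : R) (u v : R3 -> R).
Hypothesis A_gt0 : 0 < A.
Local Notation D := (annulus A).
Hypothesis u_gt0 : forall x, D x -> 0 < u x.
Hypothesis on_cube : forall c h, 0 < h -> cube c h `<=` D ->
  exists m : R, mu.-negligible (cube c h `&` [set x | v x != m * u x] : set mR3).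

Lemma cube_not_negligible c (h : R) : 0 < h -> ~ mu.-negligible (cube c h : set mR3).
Proof.
move=> h0 [N [mN N0 sub]].
have : (mu (cube c h) <= mu N)%E by apply: le_measure; rewrite ?inE//; exact: cube_measurable.
rewrite N0 lebesgue3_cube// lee_fin leNgt => /negP; apply.
by apply: exprn_gt0; rewrite pmulrn_lgt0.
Qed.

Lemma cubeS c (h h' : R) : h <= h' -> cube c h `<=` cube c h'.
Proof. by move=> hh x /cubeP[h1 h2 h3]; apply/cubeP; split; apply: le_trans hh. Qed.

(* The relation says that [v] is [m * u] near [x]; as [u > 0], it determines
   [m]. *)
Let slope x m := exists2 h : R, 0 < h &
  cube x h `<=` D /\ mu.-negligible (cube x h `&` [set x | v x != m * u x] : set mR3).

Let slope_uniq x m m' : slope x m -> slope x m' -> m = m'.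
Proof.
move=> [h h0 [hD hN]] [h' h'0 [h'D h'N]]; apply: contrapT => mm.
have k0 : 0 < Num.min h h' by rewrite lt_min h0.
apply: (@cube_not_negligible x _ k0).
apply: negligibleS (negligibleU hN h'N) => y ky.
have yh : cube x h y by apply: cubeS ky; rewrite ge_min lexx.
have yh' : cube x h' y by apply: cubeS ky; rewrite ge_min lexx orbT.
have uy := u_gt0 (hD _ yh).
have [vy|vy] := eqVneq (v y) (m * u y); last by left.
right; split => //=; apply/eqP => vy'; apply: mm.
apply: (@mulIf _ (u y)); first by rewrite gt_eqF.
by rewrite -vy -vy'.
Qed.

Let slope_ex x : D x -> exists m, slope x m.
Proof.
move=> Dx; have : nbhs x D by apply: open_nbhs_nbhs; split=> //; exact: annulus_open.
move=> /nbhs_cube[h h0 hD]; have [m hm] := on_cube h0 hD.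
by exists m, h.
Qed.

Let k x : R := get (slope x).

Let kP x : D x -> slope x (k x).
Proof. by move=> Dx; have [m hm] := slope_ex Dx; exact: getI hm. Qed.

Let k_loc x : D x -> \forall y \near x, k y = k x.
Proof.
move=> Dx; have [h h0 [hD hN]] := kP Dx.
have h2 : 0 < h / 2 by rewrite divr_gt0.
apply/nbhs_cube; exists (h / 2) => // y xy.
have sub : cube y (h / 2) `<=` cube x h.
  move: xy => /cubeP[a1 a2 a3] z /cubeP[b1 b2 b3].
  have tri (a b c : R) : `|a - b| <= h / 2 -> `|c - a| <= h / 2 -> `|c - b| <= h.
    move=> ab ca; rewrite -(subrK a c) -addrA (splitr h) addrC.
    by rewrite addrC; apply: le_trans (ler_normD _ _) _; apply: lerD.
  by apply/cubeP; split; [exact: tri a1 b1|exact: tri a2 b2|exact: tri a3 b3].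
have yy : cube y (h / 2) y by apply: cube_center; exact: ltW.
apply: (@slope_uniq y); first by apply: kP; apply: hD; exact: sub.
exists (h / 2) => //; split; first exact: subset_trans sub hD.
by apply: negligibleS hN => z [zy vz]; split => //; exact: sub.
Qed.

(** The proportionality factor of a cube around [x] is a locally constant
    function of [x], hence constant on the annulus; countably many cubes cover
    it. *)
Lemma proportional_on_annulus : exists m : R,
  mu.-negligible (D `&` [set x | v x != m * u x] : set mR3).
Proof.
have A0 := A_gt0.
have [x0 Dx0] := annulus_nonempty A_gt0.
exists (k x0); set m := k x0.
have km x : D x -> k x = m.
  by move=> Dx; exact: (@locally_constant_annulus R A k A_gt0 k_loc).
pose J := ((rat * rat * rat) * rat)%type.
pose inside (i : J) := 0 < (ratr i.2 : R) /\ cube (rat_point i.1) (ratr i.2) `<=` D.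
pose F (n : nat) : set mR3 := if unpickle n is Some i then
  [set x | inside i /\ cube (rat_point i.1) (ratr i.2) x /\ v x != m * u x] else set0.
suff sub : (D `&` [set x | v x != m * u x] : set mR3) `<=` \bigcup_n F n.
  apply: (@negligibleS _ mR3 _ mu _ _ sub); apply: negligible_bigcup => n; rewrite /F.
  case: (unpickle n) => [i|]; last exact: negligible_set0.
  have [[s0 sD]|ni] := pselect (inside i); last first.
    by apply: (@negligibleS _ _ _ mu _ _ _ (@negligible_set0 _ _ _ mu)) => x [].
  have [m' hm'] := on_cube s0 sD.
  have Dc : D (rat_point i.1) by apply: sD; apply: cube_center; exact: ltW.
  have mm' : m' = m.
    rewrite -(km _ Dc); apply: (slope_uniq _ (kP Dc)).
    by exists (ratr i.2).
  rewrite mm' in hm'.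
  by apply: negligibleS hm' => x [_ [xc vx]].
move=> x [Dx vx]; have : nbhs x D by apply: open_nbhs_nbhs; split=> //; exact: annulus_open.
move=> /rat_cube_cover[q [s [s0 xs sD]]].
exists (pickle (q, s)); first exact: I.
by rewrite /F pickleK; split; [split|split].
Qed.

End Gluing.

(** * The first eigenvalue *)

Section PrincipalEigenvalue.
Context {R : realType} {A : R} (A_gt0 : 0 < A).
Local Notation R3 := (R * R * R)%type.
Local Notation mR := (measurableTypeR R).
Local Notation mR3 := (mR * mR * mR)%type.
Local Notation mu := (@lebesgue3 R).
Local Notation D := (annulus A).
Local Notation S := (@minimal_laplace R D).
Local Notation T := (@laplace_operator R D).

Let oD : open D := @annulus_open R A.
Let mD : measurable (D : set mR3) := open_measurable3 oD.

Let u_du i x (Dx : D x) := is_derive_ground_state A i (annulus_punctured A_gt0 Dx).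
Let du_ddu i x (Dx : D x) := is_derive_dground_state A i (annulus_punctured A_gt0 Dx).
Let u_eigen x (Dx : D x) := ground_state_eigen A (annulus_punctured A_gt0 Dx).
Let u_gt0 x (Dx : D x) := ground_state_gt0 A_gt0 Dx.
Let cu : cont_on D (ground_state A) := ground_state_cont_on A_gt0.
Let cdu i : cont_on D (dground_state A i) .
Proof. exact: dground_state_cont_on. Qed.
Let cddu i : cont_on D (ddground_state A i) .
Proof. exact: ddground_state_cont_on. Qed.

Let SH v g : S v g -> L2 D v /\ L2 D g.
Proof. by move=> [tv ->]; split; [exact: test_L2|exact: test_laplacian_L2]. Qed.

Let S_sym v g w h : S v g -> S w h -> L2_ip D g w = L2_ip D v h.
Proof. by move=> [tv ->] [tw ->]; exact: laplacian_symmetric. Qed.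

Let S_ge v g : S v g -> pi ^+ 2 * L2_ip D v v <= L2_ip D g v.
Proof.
move=> [tv ->].
exact: (barta_lower_bound oD u_du du_ddu cu cdu cddu u_gt0 u_eigen).
Qed.

Lemma ground_state_eigenvector : eigenvector (L2_ip D) T (pi ^+ 2) (ground_state A).
Proof.
split.
  split; last exact: ground_state_form_domain.
  split; first exact: ground_state_L2.
  split; first by apply: (L2_scale mD); exact: ground_state_L2.
  move=> v g [tv ->].
  rewrite (L2_ipZ mD); [|exact: ground_state_L2|exact: test_L2].
  exact: (weak_eigenfunction oD u_du du_ddu cu cdu cddu u_eigen).
rewrite /same_vector subr0 => /(L2_ip_eq0 mD (ground_state_L2 A_gt0)) uN.
have [x Dx] := annulus_nonempty A_gt0.
have : nbhs x D by apply: open_nbhs_nbhs.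
move=> /nbhs_cube[h h0 hD]; apply: (@cube_not_negligible R x h h0).
apply: negligibleS uN => y hy; split; first exact: hD.
by rewrite /= gt_eqF// u_gt0//; exact: hD.
Qed.

Lemma laplace_eigenvalue_ge l v : eigenvector (L2_ip D) T l v -> pi ^+ 2 <= l.
Proof.
exact: (friedrichs_eigenvalue_ge (L2_add mD) (L2_scale mD) (@L2_ipC R D)
  (L2_ipD mD) (L2_ipZ mD) (@L2_ip_ge0 R D) SH S_sym S_ge).
Qed.

(** Form approximants of an eigenvector for the bottom value [pi ^+ 2] have
    vanishing excess, which forces the quotient by the ground state to be
    constant. *)
Lemma ground_state_proportional v : T v (pi ^+ 2 *: v) ->
  exists c : R, same_vector (L2_ip D) v (c *: ground_state A).
Proof.
move=> Tv.
have [vL2 [vn [gn [Sn vn_v excess]]]] := friedrichs_ground_state (L2_add mD)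
  (L2_scale mD) (@L2_ipC R D) (L2_ipD mD) (L2_ipZ mD) (@L2_ip_ge0 R D) SH S_sym
  S_ge (sqr_ge0 pi) Tv.
have gnE n : gn n = - laplacian (vn n) by case: (Sn n).
have vn_test n : test_function D (vn n) by case: (Sn n).
have vn_excess (e : R) : 0 < e -> exists N : nat, forall n, (N <= n)%N ->
    L2_ip D (- laplacian (vn n)) (vn n) - pi ^+ 2 * L2_ip D (vn n) (vn n) <= e.
  by move=> /excess[N hN]; exists N => n /hN; rewrite gnE.
have [c vN] : exists m : R,
    mu.-negligible (D `&` [set x | v x != m * ground_state A x] : set mR3).
  apply: (proportional_on_annulus A_gt0 u_gt0) => q h h0 qD.
  eexists; exact: (quotient_constant_on_cube oD u_du du_ddu cu cdu cddu u_gt0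
    u_eigen vL2 vn_test vn_v vn_excess h0 qD).
exists c.
have dL2 : L2 D (v - c *: ground_state A).
  apply: (L2_add mD vL2); rewrite -scaleN1r.
  by apply: (L2_scale mD); apply: (L2_scale mD); exact: ground_state_L2.
apply: (L2_ip_negligible mD dL2 dL2); apply: negligibleS vN => x [Dx nx].
split=> //; apply: contra nx => /eqP vx.
have -> : (v - c *: ground_state A) x = v x - c * ground_state A x by [].
by rewrite vx subrr.
Qed.

End PrincipalEigenvalue.

Theorem corollary5 (R : realType) (A : R) (A_gt0 : 0 < A) :
  smallest_eigenvalue (L2_ip (annulus A)) (laplace_operator (annulus A))
    (pi ^+ 2)
  /\ simple_eigenvalue (L2_ip (annulus A)) (laplace_operator (annulus A))
    (pi ^+ 2).
Proof.
split; first split.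
- by exists (ground_state A); exact: ground_state_eigenvector.
- by move=> l [v vl]; exact: laplace_eigenvalue_ge vl.
- by exists (ground_state A); [exact: ground_state_eigenvector|exact: ground_state_proportional].
Qed.
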